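(* Let $\lambda\in\mathbb C$ and let $n\ge 1$ be an integer. Every $\lambda$-polyharmonic function $f:\mathbb D\to\mathbb C$ of order $n$ has a unique representation of the form $$ f(z)=\sum_{k=0}^{n-1}\int_{\partial\mathbb D}\mathfrak h(z,\xi)^k\,P(z,\xi)^{s(\lambda)+1/2}\,d\nu_k(\xi)\quad\text{if }\lambda\neq-\tfrac14, $$ $$ f(z)=\sum_{k=0}^{n-1}\int_{\partial\mathbb D}\mathfrak h(z,\xi)^{2k}\,P(z,\xi)^{1/2}\,d\nu_k(\xi)\quad\text{if }\lambda=-\tfrac14 $$ ($z\in\mathbb D$), where $\nu_0,\dots,\nu_{n-1}$ are analytic functionals on $\partial\mathbb D$.
   Context: $\mathbb D=\{z=x+iy\in\mathbb C:|z|<1\}$ is the open unit disk, $\partial\mathbb D$ the unit circle. The hyperbolic Laplacian is $\mathfrak L=\frac{(1-|z|^2)^2}{4}(\partial_x^2+\partial_y^2)$ and $I$ is the identity operator. A $\lambda$-polyharmonic function of order $n$ is a function $f:\mathbb D\to\mathbb C$ with $(\mathfrak L-\lambda I)^nf=0$ on $\mathbb D$. The Poisson kernel is $P(z,\xi)=\frac{1-|z|^2}{|\xi-z|^2}$ for $z\in\mathbb D$, $\xi\in\partial\mathbb D$, and the Busemann function is $\mathfrak h(z,\xi)=-\log P(z,\xi)$. For $\lambda\in\mathbb C$, $s(\lambda)=\sqrt{\lambda+\frac14}$, where the square root of $re^{i\phi}$ ($r\ge0$, $\phi\in(-\pi,\pi]$) is $\sqrt r\,e^{i\phi/2}$; thus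 $\Re s(\lambda)\ge0$. Analytic functionals: for $\delta>0$ let $\mathcal H(\mathbb A_\delta)$ be the space of holomorphic functions on the annulus $\mathbb A_\delta=\{z\in\mathbb C:1-\delta<|z|<1+\delta\}$ with the topology of uniform convergence on compact sets. $\mathcal H(\partial\mathbb D)$ is the space of functions $g:\partial\mathbb D\to\mathbb C$ which possess an extension in $\mathcal H(\mathbb A_\delta)$ for some $\delta=\delta(g)>0$, with the inductive limit topology as $\delta\to0$. An analytic functional $\nu$ on $\partial\mathbb D$ is an element of the dual space of $\mathcal H(\partial\mathbb D)$, and one writes $\int_{\partial\mathbb D}g\,d\nu:=\nu(g)$. For fixed $z\in\mathbb D$ the functions of $\xi$ in the integrals belong to $\mathcal H(\partial\mathbb D)$, because $P(z,\xi)=\frac{1-|z|^2}{(\xi-z)(1/\xi-\bar z)}$ on $\partial\mathbb D$. *)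

(* Defs.v *)
From Stdlib Require Import Reals Lra Lia Psatz List.
From Coquelicot Require Import Coquelicot.

Open Scope R_scope.

(** * Complex exponential, complex powers of positive reals, square root *)

Definition Cexp (z : C) : C := (exp (Re z) * cos (Im z), exp (Re z) * sin (Im z)).

(** [p ^ w], meant for [p > 0]. *)
Definition Rcpow (p : R) (w : C) : C := Cexp (w * RtoC (ln p))%C.

(** The argument in [(-PI, PI]]; the value at 0 (where [Re w / 0] occurs) is
    irrelevant, see [Carg_bounds] and [Carg_polar]. *)
Definition Carg (w : C) : R :=
  if Rle_dec 0 (Im w) then acos (Re w / Cmod w) else - acos (Re w / Cmod w).

Definition Csqrt (w : C) : C :=
  (RtoC (sqrt (Cmod w)) * Cexp (Ci * RtoC (Carg w / 2)))%C.

Lemma Cexp_Ci (t : R) : Cexp (Ci * RtoC t) = (cos t, sin t).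
Proof.
unfold Cexp; rewrite re_mult, im_mult, re_RtoC, im_RtoC; cbn [Re Im Ci fst snd].
replace (0 * t - 1 * 0) with 0 by ring; replace (0 * 0 + 1 * t) with t by ring.
now rewrite exp_0, !Rmult_1_l.
Qed.

Lemma Cmod_sqr (w : C) : Cmod w * Cmod w = Re w * Re w + Im w * Im w.
Proof. generalize (Cmod2_alt w); simpl; lra. Qed.

Lemma Carg_bounds (w : C) : - PI < Carg w <= PI.
Proof.
unfold Carg.
destruct (acos_bound (Re w / Cmod w)) as [h0 h1].
generalize PI_RGT_0; intro hpi.
destruct (Rle_dec 0 (Im w)) as [h|h]; [lra|].
split; [|lra].
destruct (Req_dec (acos (Re w / Cmod w)) PI) as [e|ne]; [|lra].
exfalso.
assert (hw : 0 < Cmod w).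
{ apply Cmod_gt_0; intros ->; simpl in h; lra. }
generalize (Cmod_sqr w); intro hsq.
assert (hb : - Cmod w < Re w < Cmod w) by nra.
assert (hq : -1 < Re w / Cmod w < 1).
{ split.
  - apply (Rmult_lt_reg_r (Cmod w)); [easy|]; unfold Rdiv.
    rewrite Rmult_assoc, Rinv_l; lra.
  - apply (Rmult_lt_reg_r (Cmod w)); [easy|]; unfold Rdiv.
    rewrite Rmult_assoc, Rinv_l; lra. }
assert (hc := cos_acos (Re w / Cmod w)).
rewrite e, cos_PI in hc; lra.
Qed.

Lemma Carg_polar (w : C) : w = (RtoC (Cmod w) * Cexp (Ci * RtoC (Carg w)))%C.
Proof.
destruct (Ceq_dec w 0) as [->|hw].
{ rewrite Cmod_0; ring. }
apply Cmod_gt_0 in hw.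
generalize (Cmod_sqr w); intro hsq.
assert (hq : -1 <= Re w / Cmod w <= 1).
{ split.
  - apply (Rmult_le_reg_r (Cmod w)); [easy|]; unfold Rdiv.
    rewrite Rmult_assoc, Rinv_l; nra.
  - apply (Rmult_le_reg_r (Cmod w)); [easy|]; unfold Rdiv.
    rewrite Rmult_assoc, Rinv_l; nra. }
assert (hs : Cmod w * sqrt (1 - (Re w / Cmod w)²) = Rabs (Im w)).
{ rewrite <- (sqrt_Rsqr (Cmod w)) at 1 by lra.
  rewrite <- sqrt_mult_alt by apply Rle_0_sqr.
  rewrite <- sqrt_Rsqr_abs; f_equal; unfold Rsqr.
  transitivity (Cmod w * Cmod w - Re w * Re w); [field|]; lra. }
rewrite Cexp_Ci; unfold Carg.
destruct (Rle_dec 0 (Im w)) as [h|h].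
- rewrite cos_acos, sin_acos by easy.
  rewrite Rabs_pos_eq in hs by easy.
  destruct w as [x y]; apply injective_projections; cbn [Re Im fst snd] in *; simpl.
  + field_simplify; lra.
  + lra.
- rewrite cos_neg, sin_neg, cos_acos, sin_acos by easy.
  rewrite Rabs_left in hs by lra.
  destruct w as [x y]; apply injective_projections; cbn [Re Im fst snd] in *; simpl.
  + field_simplify; lra.
  + lra.
Qed.

(** * Polyharmonic functions on the disk *)

Definition disk (z : C) : Prop := Cmod z < 1.

Definition Dx (f : C -> C) (z : C) : C :=
  (Derive (fun t => Re (f (t, Im z))) (Re z),
   Derive (fun t => Im (f (t, Im z))) (Re z)).

Definition Dy (f : C -> C) (z : C) : C :=
  (Derive (fun t => Re (f (Re z, t))) (Im z),
   Derive (fun t => Im (f (Re z, t))) (Im z)).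

(** Real differentiability class [C^k] on the disk. *)
Fixpoint Ck_disk (k : nat) (f : C -> C) : Prop :=
  (forall z, disk z -> continuous f z) /\
  match k with
  | O => True
  | S k' =>
      (forall z, disk z ->
         ex_derive (V := C_R_NormedModule) (fun t => f (t, Im z)) (Re z) /\
         ex_derive (V := C_R_NormedModule) (fun t => f (Re z, t)) (Im z)) /\
      Ck_disk k' (Dx f) /\ Ck_disk k' (Dy f)
  end.

Definition hyp_laplacian (f : C -> C) (z : C) : C :=
  (RtoC ((1 - Cmod z ^ 2) ^ 2 / 4) * (Dx (Dx f) z + Dy (Dy f) z))%C.

Definition laplacian_minus (lambda : C) (f : C -> C) (z : C) : C :=
  (hyp_laplacian f z - lambda * f z)%C.

(** Only the values of [f] on the disk matter, since the disk is open.  The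
    operator has order [2 * n], whence the regularity class. *)
Definition polyharmonic (lambda : C) (n : nat) (f : C -> C) : Prop :=
  Ck_disk (2 * n) f /\
  forall z, disk z -> Nat.iter n (laplacian_minus lambda) f z = RtoC 0.

(** * Analytic functionals on the circle *)

Definition circle : Type := {xi : C | Cmod xi = 1}.

Definition circle_C (xi : circle) : C := proj1_sig xi.
Coercion circle_C : circle >-> C.

Definition annulus (delta : R) (z : C) : Prop :=
  1 - delta < Cmod z < 1 + delta.

(** Membership in H(A_delta); functions on the annulus are represented by total
    functions, whose values elsewhere play no role. *)
Definition holomorphic_annulus (delta : R) (F : C -> C) : Prop :=
  forall z, annulus delta z -> ex_derive (K := C_AbsRing) (V := C_NormedModule) F z.

Definition Hcircle : Type :=
  {g : circle -> C |
    exists delta : R, 0 < delta /\ exists F : C -> C,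
      holomorphic_annulus delta F /\ forall xi : circle, F xi = g xi}.

Definition Hcircle_fun (g : Hcircle) : circle -> C := proj1_sig g.
Coercion Hcircle_fun : Hcircle >-> Funclass.

Definition compact_C (K : C -> Prop) : Prop :=
  forall (I : Type) (U : I -> C -> Prop),
    (forall i, open (U i)) ->
    (forall z, K z -> exists i, U i z) ->
    exists l : list I, forall z, K z -> exists i, In i l /\ U i z.

(** Neighbourhoods of 0 in H(A_delta), for uniform convergence on compact sets. *)
Definition nbhs0_annulus (delta : R) (V : (C -> C) -> Prop) : Prop :=
  exists (K : C -> Prop) (eps : R),
    compact_C K /\ (forall z, K z -> annulus delta z) /\ 0 < eps /\
    forall F, holomorphic_annulus delta F ->
      (forall z, K z -> Cmod (F z) < eps) -> V F.

(** [h = a g1 + b g2] *)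
Definition lincomb (a b : C) (g1 g2 h : Hcircle) : Prop :=
  forall xi, h xi = (a * g1 xi + b * g2 xi)%C.

Definition abs_convex (W : Hcircle -> Prop) : Prop :=
  forall a b g1 g2 h, Cmod a + Cmod b <= 1 -> W g1 -> W g2 ->
    lincomb a b g1 g2 h -> W h.

(** Neighbourhoods of 0 for the inductive limit topology, i.e. the finest locally
    convex topology making every restriction map from H(A_delta) continuous: a base
    is given by the absolutely convex sets [W] whose preimages are neighbourhoods of
    0 in every H(A_delta). *)
Definition nbhs0_circle (U : Hcircle -> Prop) : Prop :=
  exists W : Hcircle -> Prop,
    abs_convex W /\
    (forall delta, 0 < delta ->
       nbhs0_annulus delta
         (fun F => forall g : Hcircle, (forall xi : circle, F xi = g xi) -> W g)) /\
    forall g, W g -> U g.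

(** The dual space; [nu g] is the integral of [g] against [nu]. *)
Record analytic_functional : Type := {
  af_fun :> Hcircle -> C;
  af_linear : forall a b g1 g2 h, lincomb a b g1 g2 h ->
    af_fun h = (a * af_fun g1 + b * af_fun g2)%C;
  af_continuous : forall (g : Hcircle) (eps : R), 0 < eps ->
    nbhs0_circle (fun u => forall h, lincomb 1 1 g u h ->
      Cmod (af_fun h - af_fun g)%C < eps)
}.

(** * Kernels *)

Definition poisson (z xi : C) : R := (1 - Cmod z ^ 2) / Cmod (xi - z)%C ^ 2.

Definition busemann (z xi : C) : R := - ln (poisson z xi).

Definition kernel_fun (j : nat) (w z : C) (xi : circle) : C :=
  (RtoC (busemann z xi ^ j) * Rcpow (poisson z xi) w)%C.

(** The kernels belong to H(dD): the following lemmas exhibit a holomorphic extension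
    of [kernel_fun j w z] to an annulus. *)

Lemma is_derive_C (f : C -> C) (z l : C) :
  @is_derive C_AbsRing (AbsRing_NormedModule C_AbsRing) f z l <->
  is_derive (K := C_AbsRing) (V := C_NormedModule) f z l.
Proof.
split; intros [[hp hs hn] h]; split; try exact h; constructor; auto.
Qed.

(** Cauchy-Riemann *)
Lemma is_derive_CR (u v : R -> R -> R) (x y a b : R) :
  differentiable_pt_lim u x y a (- b) -> differentiable_pt_lim v x y b a ->
  is_derive (K := C_AbsRing) (V := C_NormedModule)
    (fun z : C => (u (Re z) (Im z), v (Re z) (Im z)) : C) (x, y) (a, b).
Proof.
intros hu hv; split.
{ exact (is_linear_scal_l (V := C_NormedModule) (a, b)). }
intros z hz.
apply (is_filter_lim_locally_unique (V := AbsRing_NormedModule C_AbsRing)) in hz.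
rewrite <- hz; clear z hz; intros eps.
assert (he : 0 < eps / 2) by (destruct eps; simpl; lra).
destruct (hu (mkposreal _ he)) as [d1 h1], (hv (mkposreal _ he)) as [d2 h2].
assert (hd : 0 < Rmin d1 d2) by (apply Rmin_pos; [apply d1 | apply d2]).
exists (mkposreal _ hd); intros z hz.
change (Cmod (z - (x, y))%C < Rmin d1 d2) in hz.
destruct z as [s t].
assert (hm := Rmax_Cmod ((s, t) - (x, y))%C).
unfold Cminus, Cplus, Copp in hm, hz; cbn [fst snd] in hm, hz.
fold (Rminus s x) in *; fold (Rminus t y) in *.
assert (hs : Rabs (s - x) < Rmin d1 d2)
  by (eapply Rle_lt_trans; [eapply Rle_trans; [apply Rmax_l | apply hm] | apply hz]).
assert (ht : Rabs (t - y) < Rmin d1 d2)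
  by (eapply Rle_lt_trans; [eapply Rle_trans; [apply Rmax_r | apply hm] | apply hz]).
assert (k1 := Rmin_l d1 d2); assert (k2 := Rmin_r d1 d2).
specialize (h1 s t ltac:(lra) ltac:(lra)).
specialize (h2 s t ltac:(lra) ltac:(lra)).
simpl in h1, h2.
set (e1 := u s t - u x y - (a * (s - x) + - b * (t - y))) in *.
set (e2 := v s t - v x y - (b * (s - x) + a * (t - y))) in *.
assert (e : Cmod (e1, e2) <= eps * Cmod (s - x, t - y)).
{ apply Rle_trans with (Rabs e1 + Rabs e2).
  - replace (e1, e2) with (RtoC e1 + Ci * RtoC e2)%C
      by (apply injective_projections; simpl; ring).
    eapply Rle_trans; [apply Cmod_triangle|].
    rewrite Cmod_mult, Cmod_Ci, !Cmod_R; lra.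
  - destruct eps as [e' he']; simpl in *; nra. }
change (Cmod ((((u s t, v s t) - (u x y, v x y)) - ((s, t) - (x, y)) * (a, b))%C)
  <= eps * Cmod ((s, t) - (x, y))%C).
replace (((u s t, v s t) - (u x y, v x y)) - ((s, t) - (x, y)) * (a, b))%C
  with ((e1, e2) : C).
2: { unfold e1, e2; apply injective_projections; simpl; ring. }
exact e.
Qed.

Lemma differentiable_pt_lim_partial (f dx : R -> R -> R) (x y dy : R) :
  locally_2d (fun s t => is_derive (fun s' => f s' t) s (dx s t)) x y ->
  is_derive (fun t => f x t) y dy ->
  continuity_2d_pt dx x y ->
  differentiable_pt_lim f x y (dx x y) dy.
Proof.
intros h1 h2 h3.
apply filterdiff_differentiable_pt_lim.
apply is_derive_filterdiff with (dfx := dx); [|exact h2|].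
- now apply locally_2d_locally in h1.
- now apply continuity_2d_pt_filterlim in h3.
Qed.

Lemma is_derive_Cexp (z : C) :
  is_derive (K := C_AbsRing) (V := C_NormedModule) Cexp z (Cexp z).
Proof.
destruct z as [x y].
apply (is_derive_CR (fun x y => exp x * cos y) (fun x y => exp x * sin y)).
- simpl; apply (differentiable_pt_lim_partial (fun x y => exp x * cos y)
    (fun x y => exp x * cos y)).
  + apply locally_2d_forall; intros s t; auto_derive; [easy|ring].
  + auto_derive; [easy|ring].
  + apply continuity_2d_pt_mult.
    * apply (continuity_1d_2d_pt_comp exp (fun s _ => s)); [|apply continuity_2d_pt_id1].
      apply derivable_continuous_pt, derivable_pt_exp.
    * apply (continuity_1d_2d_pt_comp cos (fun _ t => t)); [|apply continuity_2d_pt_id2].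
      apply continuity_cos.
- simpl; apply (differentiable_pt_lim_partial (fun x y => exp x * sin y)
    (fun x y => exp x * sin y)).
  + apply locally_2d_forall; intros s t; auto_derive; [easy|ring].
  + auto_derive; [easy|ring].
  + apply continuity_2d_pt_mult.
    * apply (continuity_1d_2d_pt_comp exp (fun s _ => s)); [|apply continuity_2d_pt_id1].
      apply derivable_continuous_pt, derivable_pt_exp.
    * apply (continuity_1d_2d_pt_comp sin (fun _ t => t)); [|apply continuity_2d_pt_id2].
      apply continuity_sin.
Qed.

(** Principal logarithm, on the right half-plane. *)
Definition Clog_right (z : C) : C :=
  (ln (Re z ^ 2 + Im z ^ 2) / 2, atan (Im z / Re z)).

Lemma ex_derive_Clog_right (z : C) : 0 < Re z ->
  ex_derive (K := C_AbsRing) (V := C_NormedModule) Clog_right z.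
Proof.
destruct z as [x y]; cbn [Re fst]; intros hx.
assert (hr : forall s t, 0 < s -> 0 < s ^ 2 + t ^ 2) by (intros; nra).
assert (hloc : locally_2d (fun s _ => 0 < s) x y).
{ exists (mkposreal x hx); simpl; intros s t hs _.
  apply Rabs_lt_between' in hs; lra. }
assert (hc : continuity_2d_pt (fun s t => s ^ 2 + t ^ 2) x y).
{ simpl; apply continuity_2d_pt_plus; repeat apply continuity_2d_pt_mult;
  auto using continuity_2d_pt_id1, continuity_2d_pt_id2, continuity_2d_pt_const. }
set (a := x / (x ^ 2 + y ^ 2)); set (b := - y / (x ^ 2 + y ^ 2)).
exists (a, b).
apply (is_derive_CR (fun s t => ln (s ^ 2 + t ^ 2) / 2) (fun s t => atan (t / s))).
- apply (differentiable_pt_lim_partial (fun s t => ln (s ^ 2 + t ^ 2) / 2)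
    (fun s t => s / (s ^ 2 + t ^ 2))).
  + revert hloc; apply locally_2d_impl, locally_2d_forall; intros s t hs.
    specialize (hr s t hs); auto_derive; [simpl in hr; lra|field; simpl in hr; lra].
  + specialize (hr x y hx); unfold b; auto_derive; [simpl in hr; lra|field; simpl in hr; lra].
  + apply continuity_2d_pt_mult; [apply continuity_2d_pt_id1|].
    apply continuity_2d_pt_inv; [easy|]. specialize (hr x y hx); lra.
- apply (differentiable_pt_lim_partial (fun s t => atan (t / s))
    (fun s t => - t / (s ^ 2 + t ^ 2))).
  + revert hloc; apply locally_2d_impl, locally_2d_forall; intros s t hs.
    specialize (hr s t hs); auto_derive; [lra|field; simpl in hr; repeat split; nra].
  + specialize (hr x y hx); unfold a; auto_derive; [lra|field; simpl in hr; repeat split; nra].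
  + apply continuity_2d_pt_mult.
    * apply continuity_2d_pt_opp, continuity_2d_pt_id2.
    * apply continuity_2d_pt_inv; [easy|]. specialize (hr x y hx); lra.
Qed.

Lemma ex_derive_Cinv (z : C) : z <> 0 ->
  ex_derive (K := C_AbsRing) (V := C_NormedModule) Cinv z.
Proof.
destruct z as [x y]; intros hz.
apply Cmod_gt_0 in hz.
assert (h0 : 0 < x ^ 2 + y ^ 2).
{ generalize (Cmod_sqr (x, y)); cbn [Re Im fst snd]; intro e; simpl; nra. }
assert (hc : continuity_2d_pt (fun s t => s ^ 2 + t ^ 2) x y).
{ simpl; apply continuity_2d_pt_plus; repeat apply continuity_2d_pt_mult;
  auto using continuity_2d_pt_id1, continuity_2d_pt_id2, continuity_2d_pt_const. }
assert (hloc : locally_2d (fun s t => 0 < s ^ 2 + t ^ 2) x y).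
{ destruct (hc (mkposreal _ h0)) as [d h]; exists d; intros s t hs ht.
  specialize (h s t hs ht); simpl pos in h; apply Rabs_lt_between' in h; lra. }
assert (hc2 : continuity_2d_pt (fun s t => / ((s ^ 2 + t ^ 2) * (s ^ 2 + t ^ 2))) x y).
{ apply continuity_2d_pt_inv; [now apply continuity_2d_pt_mult|nra]. }
assert (hd : continuity_2d_pt (fun s t => t ^ 2 - s ^ 2) x y).
{ simpl; apply continuity_2d_pt_minus; repeat apply continuity_2d_pt_mult;
  auto using continuity_2d_pt_id1, continuity_2d_pt_id2, continuity_2d_pt_const. }
exists ((y ^ 2 - x ^ 2) / ((x ^ 2 + y ^ 2) * (x ^ 2 + y ^ 2)),
        2 * x * y / ((x ^ 2 + y ^ 2) * (x ^ 2 + y ^ 2))).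
apply (is_derive_CR (fun s t => s / (s ^ 2 + t ^ 2)) (fun s t => - t / (s ^ 2 + t ^ 2))).
- apply (differentiable_pt_lim_partial (fun s t => s / (s ^ 2 + t ^ 2))
    (fun s t => (t ^ 2 - s ^ 2) / ((s ^ 2 + t ^ 2) * (s ^ 2 + t ^ 2)))).
  + revert hloc; apply locally_2d_impl, locally_2d_forall; intros s t hs.
    auto_derive; [simpl in hs; lra|field; simpl in hs; lra].
  + auto_derive; [simpl in h0; lra|field; simpl in h0; lra].
  + now apply continuity_2d_pt_mult.
- apply (differentiable_pt_lim_partial (fun s t => - t / (s ^ 2 + t ^ 2))
    (fun s t => 2 * s * t / ((s ^ 2 + t ^ 2) * (s ^ 2 + t ^ 2)))).
  + revert hloc; apply locally_2d_impl, locally_2d_forall; intros s t hs.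
    auto_derive; [simpl in hs; lra|field; simpl in hs; lra].
  + auto_derive; [simpl in h0; lra|field; simpl in h0; lra].
  + apply continuity_2d_pt_mult; [|easy].
    repeat apply continuity_2d_pt_mult;
      auto using continuity_2d_pt_id1, continuity_2d_pt_id2, continuity_2d_pt_const.
Qed.

Lemma ex_derive_Ccomp (f g : C -> C) (z : C) :
  ex_derive (K := C_AbsRing) (V := C_NormedModule) f (g z) ->
  ex_derive (K := C_AbsRing) (V := C_NormedModule) g z ->
  ex_derive (K := C_AbsRing) (V := C_NormedModule) (fun w => f (g w)) z.
Proof.
intros [a ha] [b hb]; exists (b * a)%C.
apply is_derive_C in hb.
exact (is_derive_comp (K := C_AbsRing) (V := C_NormedModule) f g z a b ha hb).
Qed.

Lemma ex_derive_Cmult (f g : C -> C) (z : C) :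
  ex_derive (K := C_AbsRing) (V := C_NormedModule) f z ->
  ex_derive (K := C_AbsRing) (V := C_NormedModule) g z ->
  ex_derive (K := C_AbsRing) (V := C_NormedModule) (fun w => f w * g w)%C z.
Proof.
intros [a ha] [b hb]; exists (a * g z + f z * b)%C.
apply is_derive_C in ha, hb; apply is_derive_C.
exact (is_derive_mult (K := C_AbsRing) f g z a b ha hb Cmult_comm).
Qed.

Lemma ex_derive_Cpow (f : C -> C) (j : nat) (z : C) :
  ex_derive (K := C_AbsRing) (V := C_NormedModule) f z ->
  ex_derive (K := C_AbsRing) (V := C_NormedModule) (fun w => f w ^ j)%C z.
Proof.
intros hf; induction j as [|j ih]; simpl.
- apply (ex_derive_const (K := C_AbsRing) (V := C_NormedModule)).
- now apply ex_derive_Cmult.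
Qed.

Lemma ex_derive_Cid (z : C) :
  ex_derive (K := C_AbsRing) (V := C_NormedModule) (fun w => w) z.
Proof. eexists; apply is_derive_C, (is_derive_id (K := C_AbsRing)). Qed.

(** Holomorphic extension of [ln (poisson z xi)] to [annulus (1 - Cmod z)]. *)
Definition log_poisson_ext (z xi : C) : C :=
  (RtoC (ln (1 - Cmod z ^ 2)) - (Clog_right (1 - z * / xi) + Clog_right (1 - Cconj z * xi)))%C.

Lemma Re_1_minus (w : C) : Cmod w < 1 -> 0 < Re (1 - w)%C.
Proof.
intros h; generalize (re_le_Cmod w); intro h'.
apply Rabs_le_between in h'; unfold Cminus; rewrite re_plus, re_opp, re_RtoC; lra.
Qed.

Lemma log_poisson_ext_holo (z : C) : disk z ->
  holomorphic_annulus (1 - Cmod z) (log_poisson_ext z).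
Proof.
unfold disk; intros hz xi [h1 h2].
generalize (Cmod_ge_0 z); intro hz0.
assert (hxi : 0 < Cmod xi) by lra.
assert (hne : xi <> 0) by now apply Cmod_gt_0.
apply (ex_derive_minus (K := C_AbsRing) (V := C_NormedModule) (fun _ => RtoC (ln (1 - Cmod z ^ 2)))).
{ apply (ex_derive_const (K := C_AbsRing) (V := C_NormedModule)). }
apply (ex_derive_plus (K := C_AbsRing) (V := C_NormedModule)
  (fun xi => Clog_right (1 - z * / xi)%C) (fun xi => Clog_right (1 - Cconj z * xi)%C)).
- apply (ex_derive_Ccomp Clog_right (fun xi => 1 - z * / xi)%C).
  + apply ex_derive_Clog_right, Re_1_minus.
    rewrite Cmod_mult, Cmod_inv by easy.
    apply (Rmult_lt_reg_r (Cmod xi)); [easy|].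
    rewrite Rmult_assoc, Rinv_l; lra.
  + apply (ex_derive_minus (K := C_AbsRing) (V := C_NormedModule) (fun _ => RtoC 1)
      (fun xi => z * / xi)%C).
    { apply (ex_derive_const (K := C_AbsRing) (V := C_NormedModule)). }
    apply (ex_derive_Cmult (fun _ => z) Cinv).
    * apply (ex_derive_const (K := C_AbsRing) (V := C_NormedModule)).
    * now apply ex_derive_Cinv.
- apply (ex_derive_Ccomp Clog_right (fun xi => 1 - Cconj z * xi)%C).
  + apply ex_derive_Clog_right, Re_1_minus.
    rewrite Cmod_mult, Cmod_conj; nra.
  + apply (ex_derive_minus (K := C_AbsRing) (V := C_NormedModule) (fun _ => RtoC 1)
      (fun xi => Cconj z * xi)%C).
    { apply (ex_derive_const (K := C_AbsRing) (V := C_NormedModule)). }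
    apply (ex_derive_Cmult (fun _ => Cconj z) (fun xi => xi)).
    * apply (ex_derive_const (K := C_AbsRing) (V := C_NormedModule)).
    * apply ex_derive_Cid.
Qed.

Lemma log_poisson_ext_eq (z : C) (xi : circle) : disk z ->
  log_poisson_ext z xi = RtoC (ln (poisson z xi)).
Proof.
destruct xi as [xi hxi]; unfold disk; cbn [circle_C proj1_sig]; intros hz.
generalize (Cmod_ge_0 z); intro hz0.
assert (hne : xi <> 0) by (apply Cmod_gt_0; lra).
assert (hinv : (/ xi)%C = Cconj xi).
{ generalize (Cmod2_conj xi); rewrite hxi; intro e.
  replace (Cconj xi) with (/ xi * (xi * Cconj xi))%C by (field; easy).
  rewrite <- e; replace (1 ^ 2) with 1 by ring; ring. }
set (w := (1 - Cconj z * xi)%C).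
assert (e1 : (1 - z * / xi)%C = Cconj w).
{ unfold w; rewrite hinv, Cminus_conj, Cmult_conj, Cconj_conj.
  f_equal; apply injective_projections; simpl; ring. }
assert (hw : 0 < Re w) by (apply Re_1_minus; rewrite Cmod_mult, Cmod_conj; nra).
assert (e2 : Cmod (xi - z)%C = Cmod w).
{ rewrite <- (Cmod_conj w), <- e1.
  replace (xi - z)%C with (xi * (1 - z * / xi))%C by (field; easy).
  rewrite Cmod_mult, hxi; ring. }
unfold log_poisson_ext, poisson; fold w; rewrite e1, e2, (Cmod2_alt w).
unfold Clog_right; rewrite re_conj, im_conj.
assert (hp : 0 < Re w ^ 2 + Im w ^ 2)
  by (apply Rplus_lt_le_0_compat; [now apply pow_lt | apply pow2_ge_0]).
assert (hq : 0 < 1 - Cmod z ^ 2) by (simpl; nra).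
rewrite Rcomplements.ln_div by easy.
replace ((- Im w) ^ 2) with (Im w ^ 2) by ring.
replace (- Im w / Re w) with (- (Im w / Re w)) by (field; lra).
rewrite atan_opp.
apply injective_projections; simpl; field.
Qed.

Lemma kernel_in_Hcircle (j : nat) (w z : C) : disk z ->
  exists delta : R, 0 < delta /\ exists F : C -> C,
    holomorphic_annulus delta F /\ forall xi : circle, F xi = kernel_fun j w z xi.
Proof.
intros hz; exists (1 - Cmod z); split; [unfold disk in hz; lra|].
exists (fun xi => (- log_poisson_ext z xi) ^ j * Cexp (w * log_poisson_ext z xi))%C; split.
- intros xi hxi; assert (hl := log_poisson_ext_holo z hz xi hxi).
  apply (ex_derive_Cmult (fun xi => (- log_poisson_ext z xi) ^ j)%C
    (fun xi => Cexp (w * log_poisson_ext z xi))).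
  + apply (ex_derive_Cpow (fun xi => - log_poisson_ext z xi)%C).
    now apply (ex_derive_opp (K := C_AbsRing) (V := C_NormedModule) (log_poisson_ext z)).
  + apply (ex_derive_Ccomp Cexp (fun xi => w * log_poisson_ext z xi)%C).
    * eexists; apply is_derive_Cexp.
    * apply (ex_derive_Cmult (fun _ => w) (log_poisson_ext z)); [|easy].
      apply (ex_derive_const (K := C_AbsRing) (V := C_NormedModule)).
- intros xi; unfold kernel_fun, Rcpow, busemann.
  rewrite log_poisson_ext_eq by easy.
  now rewrite RtoC_pow, RtoC_opp.
Qed.

Definition kernel (j : nat) (w z : C) (hz : disk z) : Hcircle :=
  exist _ (kernel_fun j w z) (kernel_in_Hcircle j w z hz).

(** [f z = sum_{0 <= k < n} nu_k (K_k z)] on the disk, for [n >= 1]; only the first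
    [n] terms of the sequence [nu] play a role. *)
Definition represents (n : nat) (K : nat -> forall z : C, disk z -> Hcircle)
    (nu : nat -> analytic_functional) (f : C -> C) : Prop :=
  forall (z : C) (hz : disk z), f z = sum_n (fun k => nu k (K k z hz) : C) (n - 1).

(* Main.v *)
(** The operator [L - lambda] sends [h^k P^w] to [-(2w - 1) k h^(k-1) P^w + k (k - 1) h^(k-2) P^w] when
    [w (w - 1) = lambda].  Applying its [(n-1)]-st power therefore isolates the top functional of a
    representation of order [n], and subtracting the corresponding top term lowers the order, so that
    both existence and uniqueness reduce to eigenfunctions.

    The [m]-th Fourier coefficient of an eigenfunction on the circle of radius [r] solves a second-order
    differential equation in [r] whose solutions that are regular at the origin are proportional (the
    Wronskian vanishes).  Hence it is [c_m Phi_m(r)], where [Phi_m(r)] is the coefficient of [P^w].  A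
    three-term recurrence in [m] shows that [Phi_m(r)] decays like [r^|m|] up to subexponential factors;
    letting [r] tend to 1, the [c_m] grow subexponentially, that is, they are the moments of an analytic
    functional.  Conversely an analytic functional is determined by its moments, because Laurent series
    converge in [H(A_delta)]; this rests on Goursat's theorem in an annulus. *)

Require Import Defs.
From Stdlib Require Import Reals Lra Lia Psatz List ZArith Classical ClassicalEpsilon FunctionalExtensionality.
From Coquelicot Require Import Coquelicot.
Open Scope R_scope.

(** * Complex-valued functions of a real variable *)

(** The lower bound for [Phi_m(r)] at fixed [r] is the crux. Closed forms are hypergeometric; the
    recurrence comes from (1 + r^2 - 2 r cos t) K' = - 2 r w sin t K alone, where K is the kernel on
    a circle. Its solutions behave like r^m or like r^(-m), and Fourier coefficients, being bounded,
    cannot follow the second. Running it towards smaller m requires dividing by m + w, which is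
    possible because Re w >= 1/2.

    The radial equation is not verified on [Phi_m] by computation: [Phi_m] is a Fourier coefficient
    of the eigenfunction produced by evaluation at xi = 1, and inherits the equation that holds for
    the coefficients of every eigenfunction.

    The other obstacle is differentiating nu(K_z) in z. Continuity of nu is expressed annulus by
    annulus, so near each point one common annulus is fixed and difference quotients are controlled
    uniformly on its compact subsets. Derivatives of every order are reached at once because the
    kernels belong to a small syntax closed under differentiation.

    When 2w - 1 = 0 the operator lowers the power of h by two instead of one; this is the origin of
    the even powers at lambda = -1/4. *)

(** The prefix [RC] stands for functions from [R] to [C]; [RCc] is continuity, [RCd] is differentiability,
    both stated on real and imaginary parts. *)
Definition RCc (phi : R -> C) (t : R) : Prop :=
  continuous (fun u => Re (phi u)) t /\ continuous (fun u => Im (phi u)) t.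

Definition RCd (phi : R -> C) (t : R) (l : C) : Prop :=
  is_derive (fun u => Re (phi u)) t (Re l) /\ is_derive (fun u => Im (phi u)) t (Im l).

Lemma C_ext (a b : C) : Re a = Re b -> Im a = Im b -> a = b.
Proof. destruct a, b; simpl; intros -> ->; easy. Qed.

Lemma Cmult_integral (a b : C) : (a * b)%C = 0%C -> a = 0%C \/ b = 0%C.
Proof.
intros h; destruct (Ceq_dec a 0) as [|ha]; [now left|]; destruct (Ceq_dec b 0) as [|hb]; [now right|].
now destruct (Cmult_neq_0 a b ha hb).
Qed.

Lemma RCc_ext (phi psi : R -> C) t : (forall u, phi u = psi u) -> RCc phi t -> RCc psi t.
Proof.
intros e [h1 h2]; split.
- apply continuous_ext with (2 := h1); intro; now rewrite e.
- apply continuous_ext with (2 := h2); intro; now rewrite e.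
Qed.

Lemma RCc_const c t : RCc (fun _ => c) t.
Proof. split; apply continuous_const. Qed.

Lemma RCc_plus phi psi t : RCc phi t -> RCc psi t -> RCc (fun u => phi u + psi u)%C t.
Proof.
intros [h1 h2] [h3 h4]; split; simpl.
- now apply (continuous_plus (V := R_NormedModule) (fun u => Re (phi u)) (fun u => Re (psi u))).
- now apply (continuous_plus (V := R_NormedModule) (fun u => Im (phi u)) (fun u => Im (psi u))).
Qed.

Lemma RCc_mult phi psi t : RCc phi t -> RCc psi t -> RCc (fun u => phi u * psi u)%C t.
Proof.
intros [h1 h2] [h3 h4]; split.
- apply continuous_ext with (fun u => minus (mult (Re (phi u)) (Re (psi u)))
    (mult (Im (phi u)) (Im (psi u)))); [easy|].
  apply (continuous_minus (V := R_NormedModule)); now apply (continuous_mult (K := R_AbsRing)).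
- apply continuous_ext with (fun u => plus (mult (Re (phi u)) (Im (psi u)))
    (mult (Im (phi u)) (Re (psi u)))); [easy|].
  apply (continuous_plus (V := R_NormedModule)); now apply (continuous_mult (K := R_AbsRing)).
Qed.

Lemma RCc_opp phi t : RCc phi t -> RCc (fun u => - phi u)%C t.
Proof.
intros h; apply RCc_ext with (fun u => (RtoC (-1)) * phi u)%C; [intro; ring|].
apply RCc_mult; [apply RCc_const|easy].
Qed.

Lemma RCc_minus phi psi t : RCc phi t -> RCc psi t -> RCc (fun u => phi u - psi u)%C t.
Proof. intros; apply RCc_plus; [easy|now apply RCc_opp]. Qed.

Lemma RCc_RtoC (f : R -> R) t : continuous f t -> RCc (fun u => RtoC (f u)) t.
Proof. split; [easy|apply continuous_const]. Qed.

Lemma RCc_comp (g : R -> R) phi t : RCc phi (g t) -> continuous g t -> RCc (fun u => phi (g u)) t.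
Proof.
intros [h1 h2] hg; split.
- now apply (continuous_comp g (fun u => Re (phi u))).
- now apply (continuous_comp g (fun u => Im (phi u))).
Qed.

Lemma Cmod_Re (z : C) : Rabs (Re z) <= Cmod z.
Proof. apply re_le_Cmod. Qed.

Lemma Cmod_Im (z : C) : Rabs (Im z) <= Cmod z.
Proof. apply Rle_trans with (2 := Rmax_Cmod z); apply Rmax_r. Qed.

Lemma Cmod_le_sum (z : C) : Cmod z <= Rabs (Re z) + Rabs (Im z).
Proof.
replace z with (RtoC (Re z) + Ci * RtoC (Im z))%C at 1
  by (apply C_ext; simpl; ring).
eapply Rle_trans; [apply Cmod_triangle|].
rewrite Cmod_mult, Cmod_Ci, !Cmod_R; lra.
Qed.

Lemma continuous_eps (f : R -> R) t : continuous f t <->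
  forall eps, 0 < eps -> exists d, 0 < d /\ forall u, Rabs (u - t) < d -> Rabs (f u - f t) < eps.
Proof.
split.
- intros h eps he.
  destruct (proj1 (filterlim_locally f (f t)) h (mkposreal eps he)) as [d hd].
  exists d; split; [apply d|]; intros u hu; now apply hd.
- intros h; apply filterlim_locally; intros [eps he].
  destruct (h eps he) as [d [hd h']]; exists (mkposreal d hd); intros u hu; now apply h'.
Qed.

Lemma RCc_eps phi t : RCc phi t <->
  forall eps, 0 < eps -> exists d, 0 < d /\ forall u, Rabs (u - t) < d -> Cmod (phi u - phi t)%C < eps.
Proof.
split.
- intros [h1 h2] eps he.
  destruct (proj1 (continuous_eps _ _) h1 (eps / 2)) as [d1 [p1 q1]]; [lra|].
  destruct (proj1 (continuous_eps _ _) h2 (eps / 2)) as [d2 [p2 q2]]; [lra|].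
  exists (Rmin d1 d2); split; [now apply Rmin_pos|]; intros u hu.
  specialize (q1 u (Rlt_le_trans _ _ _ hu (Rmin_l _ _))).
  specialize (q2 u (Rlt_le_trans _ _ _ hu (Rmin_r _ _))).
  eapply Rle_lt_trans; [apply Cmod_le_sum|]; unfold Re, Im, Rminus in *; simpl in *; lra.
- intros h; split; apply continuous_eps; intros eps he; destruct (h eps he) as [d [hd h']];
    exists d; split; auto; intros u hu; apply Rle_lt_trans with (2 := h' u hu).
  + apply Rle_trans with (2 := Cmod_Re _); unfold Re, Im, Rminus; simpl; lra.
  + apply Rle_trans with (2 := Cmod_Im _); unfold Re, Im, Rminus; simpl; lra.
Qed.

Lemma RCd_c phi t l : RCd phi t l -> RCc phi t.
Proof.
intros [h1 h2]; split.
- apply (ex_derive_continuous (K := R_AbsRing) (V := R_NormedModule)); eexists; apply h1.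
- apply (ex_derive_continuous (K := R_AbsRing) (V := R_NormedModule)); eexists; apply h2.
Qed.

Lemma RCd_ext phi psi t l l' : (forall u, phi u = psi u) -> l = l' -> RCd phi t l -> RCd psi t l'.
Proof.
intros e <- [h1 h2]; split.
- apply is_derive_ext with (2 := h1); intro; now rewrite e.
- apply is_derive_ext with (2 := h2); intro; now rewrite e.
Qed.

Lemma RCd_ext_loc phi psi t l : locally t (fun u => phi u = psi u) -> RCd phi t l -> RCd psi t l.
Proof.
intros e [h1 h2]; split.
- apply is_derive_ext_loc with (2 := h1); revert e; apply filter_imp; intros u e; now rewrite e.
- apply is_derive_ext_loc with (2 := h2); revert e; apply filter_imp; intros u e; now rewrite e.
Qed.

Lemma RCd_const c t : RCd (fun _ => c) t 0.
Proof. split; apply (is_derive_const (K := R_AbsRing) (V := R_NormedModule)). Qed.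

Lemma RCd_plus phi psi t a b : RCd phi t a -> RCd psi t b -> RCd (fun u => phi u + psi u)%C t (a + b)%C.
Proof.
intros [h1 h2] [h3 h4]; split; simpl.
- now apply (is_derive_plus (K := R_AbsRing) (V := R_NormedModule)).
- now apply (is_derive_plus (K := R_AbsRing) (V := R_NormedModule)).
Qed.

Lemma RCd_mult phi psi t a b : RCd phi t a -> RCd psi t b ->
  RCd (fun u => phi u * psi u)%C t (a * psi t + phi t * b)%C.
Proof.
intros [h1 h2] [h3 h4]; split.
- evar_last.
  { apply is_derive_ext with (fun u => minus (mult (Re (phi u)) (Re (psi u)))
      (mult (Im (phi u)) (Im (psi u)))); [easy|].
    apply (is_derive_minus (K := R_AbsRing) (V := R_NormedModule));
    apply (is_derive_mult (K := R_AbsRing)); eauto using Rmult_comm. }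
  unfold Re, Im, minus, plus, opp, mult; simpl; ring.
- evar_last.
  { apply is_derive_ext with (fun u => plus (mult (Re (phi u)) (Im (psi u)))
      (mult (Im (phi u)) (Re (psi u)))); [easy|].
    apply (is_derive_plus (K := R_AbsRing) (V := R_NormedModule));
    apply (is_derive_mult (K := R_AbsRing)); eauto using Rmult_comm. }
  unfold Re, Im, minus, plus, opp, mult; simpl; ring.
Qed.

Lemma RCd_scal c phi t l : RCd phi t l -> RCd (fun u => c * phi u)%C t (c * l)%C.
Proof.
intros h; eapply RCd_ext; [| |apply (RCd_mult _ _ _ _ _ (RCd_const c t) h)];
  [easy|simpl; ring].
Qed.

Lemma RCd_opp phi t a : RCd phi t a -> RCd (fun u => - phi u)%C t (- a)%C.
Proof.
intros h; eapply RCd_ext; [| |apply (RCd_scal (RtoC (-1)) _ _ _ h)]; [intro; simpl; ring|ring].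
Qed.

Lemma RCd_minus phi psi t a b : RCd phi t a -> RCd psi t b -> RCd (fun u => phi u - psi u)%C t (a - b)%C.
Proof. intros; apply RCd_plus; [easy|now apply RCd_opp]. Qed.

Lemma RCd_RtoC (f : R -> R) t l : is_derive f t l -> RCd (fun u => RtoC (f u)) t (RtoC l).
Proof. split; [easy|exact (is_derive_const (K := R_AbsRing) (V := R_NormedModule) 0 t)]. Qed.

Lemma RCd_comp (g : R -> R) phi t l dg : RCd phi (g t) l -> is_derive g t dg ->
  RCd (fun u => phi (g u)) t (RtoC dg * l)%C.
Proof.
intros [h1 h2] hg; split.
- evar_last; [apply (is_derive_comp (K := R_AbsRing) (V := R_NormedModule)
    (fun u => Re (phi u)) g t _ _ h1 hg)|unfold Re, Im, scal; simpl; unfold mult; simpl; ring].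
- evar_last; [apply (is_derive_comp (K := R_AbsRing) (V := R_NormedModule)
    (fun u => Im (phi u)) g t _ _ h2 hg)|unfold Re, Im, scal; simpl; unfold mult; simpl; ring].
Qed.

(** * Integrals of complex-valued functions *)

Definition CInt (phi : R -> C) (a b : R) : C :=
  (RInt (fun t => Re (phi t)) a b, RInt (fun t => Im (phi t)) a b).

Definition RCc_on (phi : R -> C) (a b : R) : Prop :=
  forall t, Rmin a b <= t <= Rmax a b -> RCc phi t.

Lemma RCc_on_ex phi a b : RCc_on phi a b ->
  ex_RInt (fun t => Re (phi t)) a b /\ ex_RInt (fun t => Im (phi t)) a b.
Proof.
intros h; split; apply (ex_RInt_continuous (V := R_CompleteNormedModule)); intros t ht; apply (h t ht).
Qed.

Lemma CInt_ext phi psi a b : (forall t, Rmin a b < t < Rmax a b -> phi t = psi t) ->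
  CInt phi a b = CInt psi a b.
Proof.
intros e; unfold CInt; f_equal; apply RInt_ext; intros t ht; now rewrite e.
Qed.

Lemma CInt_plus phi psi a b : RCc_on phi a b -> RCc_on psi a b ->
  CInt (fun t => phi t + psi t)%C a b = (CInt phi a b + CInt psi a b)%C.
Proof.
intros h1 h2; destruct (RCc_on_ex _ _ _ h1), (RCc_on_ex _ _ _ h2).
apply C_ext; simpl; now apply (RInt_plus (V := R_CompleteNormedModule)).
Qed.

Lemma CInt_scal c phi a b : RCc_on phi a b ->
  CInt (fun t => c * phi t)%C a b = (c * CInt phi a b)%C.
Proof.
intros h1; destruct (RCc_on_ex _ _ _ h1) as [h2 h3].
set (u := fun t => Re (phi t)) in *; set (v := fun t => Im (phi t)) in *.
apply C_ext.
- transitivity (minus (scal (Re c) (RInt u a b)) (scal (Im c) (RInt v a b))); [|easy].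
  rewrite <- (RInt_scal (V := R_CompleteNormedModule) u a b (Re c) h2).
  rewrite <- (RInt_scal (V := R_CompleteNormedModule) v a b (Im c) h3).
  apply (RInt_minus (V := R_CompleteNormedModule) (fun t => scal (Re c) (u t))
    (fun t => scal (Im c) (v t)));
  now apply (ex_RInt_scal (V := R_NormedModule)).
- transitivity (plus (scal (Re c) (RInt v a b)) (scal (Im c) (RInt u a b))); [|easy].
  rewrite <- (RInt_scal (V := R_CompleteNormedModule) v a b (Re c) h3).
  rewrite <- (RInt_scal (V := R_CompleteNormedModule) u a b (Im c) h2).
  apply (RInt_plus (V := R_CompleteNormedModule) (fun t => scal (Re c) (v t))
    (fun t => scal (Im c) (u t)));
  now apply (ex_RInt_scal (V := R_NormedModule)).
Qed.

Lemma CInt_minus phi psi a b : RCc_on phi a b -> RCc_on psi a b ->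
  CInt (fun t => phi t - psi t)%C a b = (CInt phi a b - CInt psi a b)%C.
Proof.
intros h1 h2.
rewrite (CInt_ext _ (fun t => phi t + RtoC (-1) * psi t)%C) by (intros; ring).
rewrite CInt_plus, CInt_scal; auto; [ring|].
intros t ht; apply RCc_mult; [apply RCc_const|auto].
Qed.

Lemma CInt_Chasles phi a b c : RCc_on phi a b -> RCc_on phi b c ->
  (CInt phi a b + CInt phi b c)%C = CInt phi a c.
Proof.
intros h1 h2; destruct (RCc_on_ex _ _ _ h1), (RCc_on_ex _ _ _ h2).
apply C_ext; simpl; now apply (RInt_Chasles (V := R_CompleteNormedModule)).
Qed.

Lemma CInt_const c a b : CInt (fun _ => c) a b = (RtoC (b - a) * c)%C.
Proof.
apply C_ext; simpl; rewrite RInt_const; unfold Re, Im, scal; simpl; unfold mult; simpl; ring.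
Qed.

(** The integral is taken in the product normed module, whose norm is [Cmod], so no constant is
    lost; adding the estimates of the two components would cost a factor. *)
Lemma CInt_le phi g a b : a <= b -> RCc_on phi a b ->
  (forall t, a <= t <= b -> continuous g t) ->
  (forall t, a <= t <= b -> Cmod (phi t) <= g t) -> Cmod (CInt phi a b) <= RInt g a b.
Proof.
intros hab h1 hg hle.
assert (hg' : ex_RInt g a b).
{ apply (ex_RInt_continuous (V := R_CompleteNormedModule)); intros t.
  rewrite Rmin_left, Rmax_right by easy; auto. }
destruct (RCc_on_ex _ _ _ h1) as [h2 h3].
rewrite Cmod_norm.
apply (norm_RInt_le (V := C_R_NormedModule) phi g a b); auto.
- intros t ht; specialize (hle t ht); now rewrite Cmod_norm in hle.
- apply (is_RInt_fct_extend_pair (U := R_NormedModule) (V := R_NormedModule)).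
  + now apply (RInt_correct (V := R_CompleteNormedModule)).
  + now apply (RInt_correct (V := R_CompleteNormedModule)).
- now apply (RInt_correct (V := R_CompleteNormedModule)).
Qed.

Lemma CInt_bound phi M a b : a <= b -> RCc_on phi a b ->
  (forall t, a <= t <= b -> Cmod (phi t) <= M) -> Cmod (CInt phi a b) <= (b - a) * M.
Proof.
intros hab h1 hle.
replace ((b - a) * M) with (RInt (fun _ => M) a b).
- apply CInt_le; auto; intros; apply continuous_const.
- rewrite RInt_const; unfold Re, Im, scal; simpl; unfold mult; simpl; ring.
Qed.

Lemma CInt_derive phi dphi a b : 
  (forall t, Rmin a b <= t <= Rmax a b -> RCd phi t (dphi t)) -> RCc_on dphi a b ->
  CInt dphi a b = (phi b - phi a)%C.
Proof.
intros h1 h2.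
apply C_ext; apply is_RInt_unique.
- apply (is_RInt_derive (V := R_CompleteNormedModule) (fun t => Re (phi t)) (fun t => Re (dphi t)));
    intros t ht; [apply h1|apply h2]; easy.
- apply (is_RInt_derive (V := R_CompleteNormedModule) (fun t => Im (phi t)) (fun t => Im (dphi t)));
    intros t ht; [apply h1|apply h2]; easy.
Qed.

Lemma CInt_comp_shift phi a b c : (forall t, RCc phi t) ->
  CInt (fun t => phi (t + c)) a b = CInt phi (a + c) (b + c).
Proof.
intros h; apply C_ext; simpl.
- rewrite <- (Rmult_1_l a), <- (Rmult_1_l b), <- (RInt_comp_lin (V := R_CompleteNormedModule)).
  + rewrite !Rmult_1_l; apply RInt_ext; intros; rewrite scal_one at 1; now rewrite Rmult_1_l.
  + apply (ex_RInt_continuous (V := R_CompleteNormedModule)); intros t ht; apply (h t).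
- rewrite <- (Rmult_1_l a), <- (Rmult_1_l b), <- (RInt_comp_lin (V := R_CompleteNormedModule)).
  + rewrite !Rmult_1_l; apply RInt_ext; intros; rewrite scal_one at 1; now rewrite Rmult_1_l.
  + apply (ex_RInt_continuous (V := R_CompleteNormedModule)); intros t ht; apply (h t).
Qed.

Lemma RInt_comp_opp_arg (f : R -> R) a b : (forall t, continuous f t) ->
  RInt (fun t => f (- t)) a b = RInt f (- b) (- a).
Proof.
intros h.
assert (hex : forall u v, ex_RInt f u v)
  by (intros; apply (ex_RInt_continuous (V := R_CompleteNormedModule)); auto).
rewrite <- (opp_RInt_swap (V := R_CompleteNormedModule) f (- a) (- b)) by apply hex.
replace (- a) with (-1 * a + 0) by ring; replace (- b) with (-1 * b + 0) by ring.
rewrite <- (RInt_comp_lin (V := R_CompleteNormedModule)) by easy.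
rewrite <- (RInt_opp (V := R_CompleteNormedModule)).
- apply RInt_ext; intros x _; unfold opp, scal; simpl; unfold mult; simpl.
  replace (-1 * x + 0) with (- x) by ring; ring.
- apply (ex_RInt_comp_lin (V := R_NormedModule)); easy.
Qed.

Lemma CInt_comp_opp phi a b : (forall t, RCc phi t) ->
  CInt (fun t => phi (- t)) a b = CInt phi (- b) (- a).
Proof.
intros h; apply C_ext.
- apply (RInt_comp_opp_arg (fun t => Re (phi t))); intro; apply h.
- apply (RInt_comp_opp_arg (fun t => Im (phi t))); intro; apply h.
Qed.

(** * Fourier coefficients *)

Definition eit (t : R) : C := (cos t, sin t).

Lemma eit_0 : eit 0 = 1%C.
Proof. unfold eit; now rewrite cos_0, sin_0. Qed.

Lemma eit_plus a b : eit (a + b) = (eit a * eit b)%C.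
Proof. apply C_ext; simpl; [apply cos_plus|rewrite sin_plus; ring]. Qed.

Lemma eit_mod t : Cmod (eit t) = 1.
Proof.
unfold Cmod, eit; simpl; rewrite !Rmult_1_r, Rplus_comm.
change (sqrt ((sin t)² + (cos t)²) = 1); now rewrite sin2_cos2, sqrt_1.
Qed.

Lemma eit_2PI (m : Z) : eit (IZR m * (2 * PI)) = 1%C.
Proof.
assert (h : forall n : nat, eit (INR n * (2 * PI)) = 1%C).
{ induction n as [|n ih]; [simpl; now rewrite Rmult_0_l, eit_0|].
  rewrite S_INR, Rmult_plus_distr_r, eit_plus, ih, Rmult_1_l.
  unfold eit; rewrite cos_2PI, sin_2PI; apply C_ext; simpl; ring. }
destruct m as [|p|p].
- now rewrite Rmult_0_l, eit_0.
- rewrite <- positive_nat_Z, <- INR_IZR_INZ; apply h.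
- assert (e : (eit (IZR (Z.neg p) * (2 * PI)) * eit (INR (Pos.to_nat p) * (2 * PI)))%C = 1%C).
  { rewrite <- eit_plus, INR_IZR_INZ, positive_nat_Z, <- Rmult_plus_distr_r, <- plus_IZR.
    rewrite Z.add_comm, Z.add_opp_diag_r; now rewrite Rmult_0_l, eit_0. }
  rewrite h in e; rewrite <- e; ring.
Qed.

Lemma RCd_eit t : RCd eit t (Ci * eit t)%C.
Proof.
split; simpl.
- unfold Re; simpl; auto_derive; [easy|ring].
- unfold Im; simpl; auto_derive; [easy|ring].
Qed.

Definition em (m : Z) (t : R) : C := eit (IZR m * t).

Lemma em_plus m n t : em (m + n) t = (em m t * em n t)%C.
Proof. unfold em; rewrite plus_IZR, Rmult_plus_distr_r; apply eit_plus. Qed.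

Lemma em_0 t : em 0 t = 1%C.
Proof. unfold em; rewrite Rmult_0_l; apply eit_0. Qed.

Lemma em_add m a b : em m (a + b) = (em m a * em m b)%C.
Proof. unfold em; rewrite Rmult_plus_distr_l; apply eit_plus. Qed.

Lemma em_opp m t : em m (- t) = em (- m) t.
Proof. unfold em; f_equal; rewrite opp_IZR; ring. Qed.

Lemma em_inv m t : (em m t * em (- m) t)%C = 1%C.
Proof. now rewrite <- em_plus, Z.add_opp_diag_r, em_0. Qed.

Lemma em_mod m t : Cmod (em m t) = 1.
Proof. apply eit_mod. Qed.

Lemma RCd_em m t : RCd (em m) t (Ci * RtoC (IZR m) * em m t)%C.
Proof.
eapply RCd_ext; [| |apply (RCd_comp (fun u => IZR m * u) eit t _ (IZR m) (RCd_eit _))].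
- easy.
- unfold em; ring.
- auto_derive; [easy|ring].
Qed.

Lemma RCc_em m t : RCc (em m) t.
Proof. eapply RCd_c, RCd_em. Qed.

Definition periodic (phi : R -> C) : Prop := forall t, phi (t + 2 * PI) = phi t.

Lemma periodic_em m : periodic (em m).
Proof. intros t; rewrite em_add; unfold em at 2; rewrite eit_2PI; ring. Qed.

Lemma periodic_mult phi psi : periodic phi -> periodic psi -> periodic (fun t => phi t * psi t)%C.
Proof. intros h1 h2 t; now rewrite h1, h2. Qed.

Definition RCcont (phi : R -> C) : Prop := forall t, RCc phi t.

Lemma RCcont_on phi a b : RCcont phi -> RCc_on phi a b.
Proof. now intros h t _. Qed.

Lemma RCcont_mult phi psi : RCcont phi -> RCcont psi -> RCcont (fun t => phi t * psi t)%C.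
Proof. intros h1 h2 t; now apply RCc_mult. Qed.

Lemma RCcont_em m : RCcont (em m).
Proof. intro; apply RCc_em. Qed.

Definition mean (phi : R -> C) : C := (RtoC (/ (2 * PI)) * CInt phi 0 (2 * PI))%C.

Lemma mean_ext phi psi : (forall t, phi t = psi t) -> mean phi = mean psi.
Proof. intros h; unfold mean; f_equal; apply CInt_ext; auto. Qed.

Lemma mean_plus phi psi : RCcont phi -> RCcont psi ->
  mean (fun t => phi t + psi t)%C = (mean phi + mean psi)%C.
Proof. intros; unfold mean; rewrite CInt_plus by now apply RCcont_on. ring. Qed.

Lemma mean_minus phi psi : RCcont phi -> RCcont psi ->
  mean (fun t => phi t - psi t)%C = (mean phi - mean psi)%C.
Proof. intros; unfold mean; rewrite CInt_minus by now apply RCcont_on. ring. Qed.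

Lemma mean_scal c phi : RCcont phi -> mean (fun t => c * phi t)%C = (c * mean phi)%C.
Proof. intros; unfold mean; rewrite CInt_scal by now apply RCcont_on. ring. Qed.

Lemma two_PI_pos : 0 < 2 * PI.
Proof. generalize PI_RGT_0; lra. Qed.

Lemma mean_bound phi M : RCcont phi -> (forall t, Cmod (phi t) <= M) -> Cmod (mean phi) <= M.
Proof.
intros h hM; unfold mean; generalize two_PI_pos; intro hp.
rewrite Cmod_mult, Cmod_R, Rabs_pos_eq by (left; now apply Rinv_0_lt_compat).
apply (Rmult_le_reg_l (2 * PI)); [easy|].
rewrite <- Rmult_assoc, Rinv_r, Rmult_1_l by lra.
replace (2 * PI * M) with ((2 * PI - 0) * M) by ring.
apply CInt_bound; auto; [lra|now apply RCcont_on].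
Qed.

Lemma mean_const c : mean (fun _ => c) = c.
Proof.
unfold mean; rewrite CInt_const, Cmult_assoc, <- RtoC_mult, Rminus_0_r, Rinv_l.
- ring.
- generalize two_PI_pos; lra.
Qed.

(** Periodicity cancels the boundary terms. Applied to [em m] this gives orthogonality, applied to a
    product it is integration by parts. *)
Lemma mean_derive phi dphi : periodic phi -> (forall t, RCd phi t (dphi t)) -> RCcont dphi ->
  mean dphi = 0%C.
Proof.
intros hp hd hc; unfold mean.
rewrite (CInt_derive phi) by (auto; now apply RCcont_on).
replace (2 * PI) with (0 + 2 * PI) at 2 by ring; rewrite hp; ring.
Qed.

Lemma CInt_period phi a : periodic phi -> RCcont phi ->
  CInt phi a (a + 2 * PI) = CInt phi 0 (2 * PI).
Proof.
intros hp hc.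
assert (e : CInt phi (2 * PI) (a + 2 * PI) = CInt phi 0 a).
{ replace (2 * PI) with (0 + 2 * PI) at 1 by ring; rewrite <- CInt_comp_shift by easy.
  apply CInt_ext; intros; apply hp. }
rewrite <- (CInt_Chasles phi a 0 (a + 2 * PI)) by now apply RCcont_on.
rewrite <- (CInt_Chasles phi 0 (2 * PI) (a + 2 * PI)) by now apply RCcont_on.
rewrite e, Cplus_comm, <- Cplus_assoc, CInt_Chasles by now apply RCcont_on.
unfold CInt; rewrite !RInt_point; apply C_ext; simpl; unfold zero; simpl; ring.
Qed.

Lemma mean_shift phi a : periodic phi -> RCcont phi -> mean (fun t => phi (t + a)) = mean phi.
Proof.
intros hp hc; unfold mean; f_equal; rewrite CInt_comp_shift by easy.
now rewrite Rplus_0_l, Rplus_comm, CInt_period.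
Qed.

Lemma mean_opp_arg phi : periodic phi -> RCcont phi -> mean (fun t => phi (- t)) = mean phi.
Proof.
intros hp hc; unfold mean; f_equal; rewrite CInt_comp_opp by easy.
rewrite <- (CInt_period phi (- (2 * PI))) by easy; do 2 f_equal; ring.
Qed.

Lemma mean_em m : m <> 0%Z -> mean (em m) = 0%C.
Proof.
intros hm.
assert (hm' : RtoC (IZR m) <> 0) by (intros e; apply RtoC_inj in e; now apply eq_IZR in e).
assert (h : mean (fun t => Ci * RtoC (IZR m) * em m t)%C = 0%C).
{ apply (mean_derive (em m)); [apply periodic_em|apply RCd_em|].
  intros t; apply RCc_mult; [apply RCc_const|apply RCc_em]. }
rewrite mean_scal in h by apply RCcont_em.
apply Cmult_integral in h; destruct h as [h|h]; [|easy].
apply Cmult_integral in h; destruct h as [h|h]; [|easy].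
injection h; lra.
Qed.

Definition fourier (phi : R -> C) (m : Z) : C := mean (fun t => phi t * em (- m) t)%C.

Lemma fourier_ext phi psi m : (forall t, phi t = psi t) -> fourier phi m = fourier psi m.
Proof. intros h; apply mean_ext; intro; now rewrite h. Qed.

Lemma fourier_plus phi psi m : RCcont phi -> RCcont psi ->
  fourier (fun t => phi t + psi t)%C m = (fourier phi m + fourier psi m)%C.
Proof.
intros; unfold fourier; rewrite <- mean_plus by (apply RCcont_mult; auto using RCcont_em).
apply mean_ext; intro; ring.
Qed.

Lemma fourier_minus phi psi m : RCcont phi -> RCcont psi ->
  fourier (fun t => phi t - psi t)%C m = (fourier phi m - fourier psi m)%C.
Proof.
intros; unfold fourier; rewrite <- mean_minus by (apply RCcont_mult; auto using RCcont_em).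
apply mean_ext; intro; ring.
Qed.

Lemma fourier_scal c phi m : RCcont phi -> fourier (fun t => c * phi t)%C m = (c * fourier phi m)%C.
Proof.
intros; unfold fourier; rewrite <- mean_scal by (apply RCcont_mult; auto using RCcont_em).
apply mean_ext; intro; ring.
Qed.

Lemma fourier_bound phi m M : RCcont phi -> (forall t, Cmod (phi t) <= M) ->
  Cmod (fourier phi m) <= M.
Proof.
intros h hM; apply mean_bound; [apply RCcont_mult; auto using RCcont_em|].
intros t; rewrite Cmod_mult, em_mod; specialize (hM t); lra.
Qed.

Lemma fourier_em_mult phi m n : fourier (fun t => em n t * phi t)%C m = fourier phi (m - n).
Proof.
apply mean_ext; intros t; replace (- (m - n))%Z with (n + - m)%Z by ring; rewrite em_plus; ring.
Qed.

Lemma fourier_em m n : fourier (em n) m = if Z.eq_dec m n then RtoC 1 else RtoC 0.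
Proof.
unfold fourier; rewrite (mean_ext _ (em (n - m))) by (intro; now rewrite <- em_plus).
destruct (Z.eq_dec m n) as [->|h].
- rewrite Z.sub_diag, <- (mean_const 1); apply mean_ext, em_0.
- apply mean_em; lia.
Qed.

Lemma fourier_derive phi dphi m : periodic phi -> (forall t, RCd phi t (dphi t)) -> RCcont dphi ->
  fourier dphi m = (Ci * RtoC (IZR m) * fourier phi m)%C.
Proof.
intros hp hd hc.
assert (hc0 : RCcont phi) by (intro; eapply RCd_c, hd).
assert (h : mean (fun t => dphi t * em (- m) t + phi t * (Ci * RtoC (IZR (- m)) * em (- m) t))%C = 0%C).
{ apply (mean_derive (fun t => phi t * em (- m) t)%C).
  - apply periodic_mult; auto using periodic_em.
  - intros t; apply RCd_mult; auto using RCd_em.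
  - intros t; apply RCc_plus; apply RCc_mult; auto using RCc_em.
    apply RCc_mult; auto using RCc_em, RCc_const. }
rewrite mean_plus in h.
- rewrite (mean_ext (fun t => phi t * _)%C (fun t => (Ci * RtoC (IZR (- m))) * (phi t * em (- m) t))%C) in h
    by (intro; ring).
  rewrite mean_scal in h by (apply RCcont_mult; auto using RCcont_em).
  unfold fourier; rewrite opp_IZR, RtoC_opp in h.
  replace (mean (fun t => dphi t * em (- m) t)%C) with
   ((mean (fun t => dphi t * em (- m) t) + Ci * - IZR m * mean (fun t => phi t * em (- m) t))
    + Ci * IZR m * mean (fun t => phi t * em (- m) t))%C by ring.
  rewrite h; ring.
- apply RCcont_mult; auto using RCcont_em.
- apply RCcont_mult; auto; intro; apply RCc_mult; auto using RCc_em, RCc_const.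
Qed.

Lemma fourier_shift phi m a : periodic phi -> RCcont phi ->
  fourier (fun t => phi (t + a)) m = (em m a * fourier phi m)%C.
Proof.
intros hp hc; unfold fourier.
rewrite <- (mean_shift (fun t => phi t * em (- m) t)%C a).
- rewrite <- mean_scal.
  + apply mean_ext; intro t; rewrite em_add.
    transitivity (phi (t + a)%R * em (- m) t * (em m a * em (- m) a))%C; [rewrite em_inv; ring|ring].
  + intros t; apply RCc_comp with (g := fun t => t + a) (phi := fun t => (phi t * em (- m) t)%C).
    * apply RCcont_mult; auto using RCcont_em.
    * apply (ex_derive_continuous (K := R_AbsRing) (V := R_NormedModule)); auto_derive; easy.
- apply periodic_mult; auto using periodic_em.
- apply RCcont_mult; auto using RCcont_em.
Qed.

Lemma fourier_opp_arg phi m : periodic phi -> RCcont phi ->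
  fourier (fun t => phi (- t)) m = fourier phi (- m).
Proof.
intros hp hc; unfold fourier.
rewrite <- (mean_opp_arg (fun t => phi t * em (- - m) t)%C).
- apply mean_ext; intro t; now rewrite em_opp, Z.opp_involutive.
- apply periodic_mult; auto using periodic_em.
- apply RCcont_mult; auto using RCcont_em.
Qed.

Lemma continuous_Cmod phi t : RCc phi t -> continuous (fun u => Cmod (phi u)) t.
Proof.
intros h; apply continuous_eps; intros eps he.
destruct (proj1 (RCc_eps _ _) h eps he) as [d [hd h']]; exists d; split; auto.
intros u hu; apply Rle_lt_trans with (2 := h' u hu).
apply Rabs_le; split.
- generalize (Cmod_triangle (phi u) (phi t - phi u)%C).
  replace (phi u + (phi t - phi u))%C with (phi t) by ring.
  rewrite <- (Cmod_opp (phi t - phi u)); replace (- (phi t - phi u))%C with (phi u - phi t)%C by ring; lra.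
- generalize (Cmod_triangle (phi t) (phi u - phi t)%C).
  replace (phi t + (phi u - phi t))%C with (phi u) by ring; lra.
Qed.

Lemma ex_RInt_cont (f : R -> R) a b : (forall t, continuous f t) -> ex_RInt f a b.
Proof. intros; apply (ex_RInt_continuous (V := R_CompleteNormedModule)); auto. Qed.

Lemma RInt_const_R (c a b : R) : RInt (fun _ => c) a b = (b - a) * c.
Proof. exact (RInt_const (V := R_CompleteNormedModule) a b c). Qed.

(** * Uniqueness of Fourier coefficients *)

(** This is sin(t/2)^2, a trigonometric polynomial with values in [0, 1] that reaches 1 on [0, 2 PI]
    only at [PI], the midpoint of the interval of integration. *)
Definition bump (t : R) : R := (1 - cos t) / 2.

Lemma continuous_bump_pow n t : continuous (fun u => bump u ^ n) t.
Proof.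
apply (ex_derive_continuous (K := R_AbsRing) (V := R_NormedModule)); unfold bump; auto_derive; easy.
Qed.

Lemma bump_range t : 0 <= bump t <= 1.
Proof. unfold bump; generalize (COS_bound t); lra. Qed.

Lemma bump_em t : RtoC (bump t) = (RtoC (1 / 2) - RtoC (1 / 4) * em 1 t - RtoC (1 / 4) * em (-1) t)%C.
Proof.
unfold em, eit, bump; replace (-1 * t) with (- t) by ring.
rewrite Rmult_1_l, cos_neg, sin_neg; apply C_ext; simpl; field.
Qed.

(** Multiplication by [bump] mixes the frequencies m - 1, m and m + 1, so the induction carries all
    coefficients together. *)
Lemma fourier_bump_pow psi : RCcont psi -> (forall m, fourier psi m = 0%C) ->
  forall n m, fourier (fun t => psi t * RtoC (bump t ^ n))%C m = 0%C.
Proof.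
intros hc h; assert (hcn : forall n, RCcont (fun t => psi t * RtoC (bump t ^ n))%C).
{ intros n; apply RCcont_mult; auto; intro; apply RCc_RtoC, continuous_bump_pow. }
induction n as [|n ih]; intros m.
- rewrite <- (h m); apply fourier_ext; intro; simpl; ring.
- set (chi := fun t => (psi t * RtoC (bump t ^ n))%C).
  assert (hchi := hcn n : RCcont chi).
  assert (hk : forall k c, RCcont (fun t => c * (em k t * chi t))%C).
  { intros k c t; apply RCc_mult; [apply RCc_const|]; apply RCc_mult; auto using RCc_em. }
  assert (hek : forall k, RCcont (fun t => em k t * chi t)%C)
    by (intro; apply RCcont_mult; auto using RCcont_em).
  rewrite (fourier_ext _ (fun t => RtoC (1 / 2) * (em 0 t * chi t) -
    (RtoC (1 / 4) * (em 1 t * chi t) + RtoC (1 / 4) * (em (-1) t * chi t)))%C).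
  + rewrite (fourier_minus (fun t => RtoC (1 / 2) * (em 0 t * chi t))%C); [|apply hk|].
    2: { intro; apply RCc_plus; apply hk. }
    rewrite (fourier_plus (fun t => RtoC (1 / 4) * (em 1 t * chi t))%C) by apply hk.
    rewrite (fourier_scal _ (fun t => em 0 t * chi t)%C) by apply hek.
    rewrite (fourier_scal _ (fun t => em 1 t * chi t)%C) by apply hek.
    rewrite (fourier_scal _ (fun t => em (-1) t * chi t)%C) by apply hek.
    rewrite !fourier_em_mult.
    unfold chi; rewrite !ih; ring.
  + intros t; unfold chi; rewrite em_0; simpl pow; rewrite RtoC_mult, bump_em; ring.
Qed.

(** On the window of width [d] centred at [PI], [bump] is at least its value at the ends, and
    elsewhere it is nonnegative. *)
Lemma RInt_bump_lower n d : 0 < d < PI -> d * bump (PI - d / 2) ^ n <= RInt (fun t => bump t ^ n) 0 (2 * PI).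
Proof.
intros hd; assert (hex : forall a b, ex_RInt (fun t => bump t ^ n) a b)
  by (intros; apply ex_RInt_cont, continuous_bump_pow).
assert (hpos : forall a b, a <= b -> 0 <= RInt (fun t => bump t ^ n) a b).
{ intros a b hab; apply RInt_ge_0; auto; intros; apply pow_le, bump_range. }
rewrite <- (RInt_Chasles (V := R_CompleteNormedModule) _ 0 (PI - d / 2) (2 * PI)) by apply hex.
rewrite <- (RInt_Chasles (V := R_CompleteNormedModule) _ (PI - d / 2) (PI + d / 2) (2 * PI)) by apply hex.
assert (h1 := hpos 0 (PI - d / 2)); assert (h2 := hpos (PI + d / 2) (2 * PI)).
assert (h3 : d * bump (PI - d / 2) ^ n <= RInt (fun t => bump t ^ n) (PI - d / 2) (PI + d / 2)).
{ assert (e : d * bump (PI - d / 2) ^ n = RInt (fun _ => bump (PI - d / 2) ^ n) (PI - d / 2) (PI + d / 2)).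
  { rewrite RInt_const_R; field. }
  rewrite e.
  apply RInt_le; auto; [lra|apply ex_RInt_const|]; intros t ht.
  apply pow_incr; split; [apply bump_range|].
  unfold bump; apply Rmult_le_compat_r; [lra|].
  apply Rplus_le_compat_l, Ropp_le_contravar.
  destruct (Rle_dec t PI).
  - apply cos_decr_1; lra.
  - replace t with (2 * PI - (2 * PI - t)) by ring.
    rewrite <- (cos_neg (2 * PI - (2 * PI - t))).
    replace (- (2 * PI - (2 * PI - t))) with ((2 * PI - t) - 2 * PI) by ring.
    replace (cos (2 * PI - t - 2 * PI)) with (cos (2 * PI - t)).
    2: { rewrite <- (cos_period (2 * PI - t - 2 * PI) 1); simpl INR; f_equal; ring. }
    apply cos_decr_1; lra. }
unfold plus; simpl; lra.
Qed.

Lemma bump_outside d t : 0 < d < PI -> 0 <= t <= 2 * PI -> d <= Rabs (t - PI) -> bump t <= bump (PI - d).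
Proof.
intros hd ht h; unfold bump; apply Rmult_le_compat_r; [lra|].
apply Rplus_le_compat_l, Ropp_le_contravar.
destruct (Rle_dec t PI) as [hl|hl].
- rewrite Rabs_left1 in h by lra; apply cos_decr_1; lra.
- rewrite Rabs_pos_eq in h by lra.
  replace (cos t) with (cos (2 * PI - t)).
  2: { rewrite <- (cos_neg t), <- (cos_period (- t) 1); simpl INR; f_equal; ring. }
  apply cos_decr_1; lra.
Qed.

(* [psi] is orthogonal to all powers of [bump], which concentrate at [PI]. *)
Lemma fourier_zero_at_PI psi : RCcont psi -> (forall m, fourier psi m = 0%C) -> psi PI = 0%C.
Proof.
intros hc hz; generalize PI_RGT_0 two_PI_pos; intros hpi h2pi.
destruct (Ceq_dec (psi PI) 0) as [|hne]; [easy|exfalso].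
set (c := psi PI) in *; apply Cmod_gt_0 in hne.
destruct (proj1 (RCc_eps _ _) (hc PI) (Cmod c / 2)) as [d0 [hd0 hd]]; [lra|].
(* The first bound keeps the window inside the neighbourhood where [psi] is close to [c], the second
   keeps it inside (0, 2 PI). *)
set (d := Rmin (d0 / 2) (PI / 2)).
assert (hd1 : 0 < d < PI) by (split; [apply Rmin_pos; lra|unfold d; generalize (Rmin_r (d0 / 2) (PI / 2)); lra]).
assert (hd2 : d < d0) by (unfold d; generalize (Rmin_l (d0 / 2) (PI / 2)); lra).
set (J n := RInt (fun t => bump t ^ n) 0 (2 * PI)).
set (M := RInt (fun t => Cmod (c - psi t)%C) 0 (2 * PI)).
(* [q] bounds [bump] from above outside the window of radius [d]; [q1] bounds it from below on the
   window of half that radius. The gap between them decides. *)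
set (q := bump (PI - d)); set (q1 := bump (PI - d / 2)).
assert (hc' : RCcont (fun t => c - psi t)%C) by (intro; apply RCc_minus; auto using RCc_const).
assert (hcm : forall t, continuous (fun t => Cmod (c - psi t)%C) t) by (intro; now apply continuous_Cmod).
assert (hq : 0 < q < q1).
{ unfold q, q1, bump; split.
  - assert (cos (PI - d) < 1); [|lra]. rewrite <- cos_0; apply cos_decreasing_1; lra.
  - assert (cos (PI - d / 2) < cos (PI - d)); [|lra]. apply cos_decreasing_1; lra. }
(* Orthogonality turns c J(n) into the integral of (c - psi) bump^n. Near [PI] the factor |c - psi|
   is below |c| / 2, which absorbs half of |c| J(n); elsewhere bump^n is at most q^n. The remaining
   half of |c| J(n) is bounded below through q1^n. *)
assert (key : forall n, Cmod c / 2 * (d * q1 ^ n) <= q ^ n * M).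
{ intros n.
  assert (e : CInt (fun t => (c - psi t) * RtoC (bump t ^ n))%C 0 (2 * PI) = (c * RtoC (J n))%C).
  { rewrite (CInt_ext _ (fun t => c * RtoC (bump t ^ n) - psi t * RtoC (bump t ^ n))%C) by (intros; ring).
    assert (hb : RCcont (fun t => RtoC (bump t ^ n))) by (intro; apply RCc_RtoC, continuous_bump_pow).
    rewrite CInt_minus, CInt_scal.
    - assert (h0 := fourier_bump_pow psi hc hz n 0).
      unfold fourier, mean in h0; apply Cmult_integral in h0; destruct h0 as [h0|h0].
      { apply RtoC_inj, Rinv_neq_0_compat in h0; [easy|lra]. }
      rewrite (CInt_ext (fun t => psi t * RtoC (bump t ^ n))%C (fun t => psi t * RtoC (bump t ^ n) * em (- 0) t)%C)
        by (intros; change (- 0)%Z with 0%Z; rewrite em_0; ring).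
      rewrite h0; replace (CInt (fun t => RtoC (bump t ^ n)) 0 (2 * PI)) with (RtoC (J n)); [ring|].
      apply C_ext; [easy|]. simpl; rewrite RInt_const_R; ring.
    - now apply RCcont_on.
    - apply RCcont_on, RCcont_mult; auto; intro; apply RCc_const.
    - now apply RCcont_on, RCcont_mult. }
  assert (hle : Cmod (c * RtoC (J n)) <= Cmod c / 2 * J n + q ^ n * M).
  { rewrite <- e.
    replace (Cmod c / 2 * J n + q ^ n * M) with
      (RInt (fun t => plus (scal (Cmod c / 2) (bump t ^ n)) (scal (q ^ n) (Cmod (c - psi t)%C))) 0 (2 * PI)).
    - apply CInt_le; [lra| | |].
      + apply RCcont_on, RCcont_mult; auto; intro; apply RCc_RtoC, continuous_bump_pow.
      + intros t _; apply (continuous_plus (V := R_NormedModule));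
          apply (continuous_scal_r (V := R_NormedModule)); auto using continuous_bump_pow.
      + intros t ht; unfold plus, scal; simpl; unfold mult; simpl.
        assert (hb := bump_range t); assert (hbn := pow_le _ n (proj1 hb)).
        assert (hqn := pow_le q n ltac:(lra)).
        rewrite Cmod_mult, Cmod_R, (Rabs_pos_eq (bump t ^ n)) by easy.
        assert (hm := Cmod_ge_0 (c - psi t)%C).
        destruct (Rlt_dec (Rabs (t - PI)) d) as [hl|hl].
        * specialize (hd t ltac:(lra)). fold c in hd.
          replace (Cmod (c - psi t)%C) with (Cmod (psi t - c)%C) in *
            by (rewrite <- Cmod_opp; f_equal; ring).
          nra.
        * assert (hbq := bump_outside d t hd1 ht ltac:(lra)).
          assert (bump t ^ n <= q ^ n) by (apply pow_incr; split; [apply hb|apply hbq]). nra.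
    - assert (x1 : ex_RInt (fun t => bump t ^ n) 0 (2 * PI)) by (apply ex_RInt_cont, continuous_bump_pow).
      assert (x2 : ex_RInt (fun t => Cmod (c - psi t)%C) 0 (2 * PI)) by now apply ex_RInt_cont.
      rewrite (RInt_plus (V := R_CompleteNormedModule) (fun t => scal (Cmod c / 2) (bump t ^ n))
        (fun t => scal (q ^ n) (Cmod (c - psi t)%C)))
        by (apply (ex_RInt_scal (V := R_NormedModule)); easy).
      now rewrite (RInt_scal (V := R_CompleteNormedModule) (fun t => bump t ^ n)),
        (RInt_scal (V := R_CompleteNormedModule) (fun t => Cmod (c - psi t)%C)). }
  rewrite Cmod_mult, Cmod_R in hle.
  assert (hJ := RInt_bump_lower n d hd1); fold q1 in hJ; fold (J n) in hJ.
  assert (0 < q1 ^ n) by (apply pow_lt; lra).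
  rewrite Rabs_pos_eq in hle by nra.
  nra. }
assert (hM : 0 < M) by (generalize (key 0%nat); simpl; nra).
(* [key] bounds (q1 / q)^n by M / (|c| d / 2) for all n, although q1 / q exceeds 1. *)
destruct (Pow_x_infinity (q1 / q)) with (b := (M + 1) / (Cmod c / 2 * d)) as [N hN].
- rewrite Rabs_pos_eq; [|apply Rlt_le, Rdiv_lt_0_compat; lra].
  apply (Rmult_lt_reg_r q); [lra|]; unfold Rdiv; rewrite Rmult_assoc, Rinv_l; lra.
- specialize (hN N ltac:(lia)); specialize (key N).
  assert (hqN : 0 < q ^ N) by (apply pow_lt; lra).
  assert (hQ : q1 ^ N = (q1 / q) ^ N * q ^ N) by (rewrite <- Rpow_mult_distr; f_equal; field; lra).
  assert (hp : 0 < (q1 / q) ^ N) by (apply pow_lt, Rdiv_lt_0_compat; lra).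
  rewrite Rabs_pos_eq in hN by lra.
  rewrite hQ in key.
  assert (hcd : 0 < Cmod c / 2 * d) by nra.
  assert (h5 : M + 1 <= (q1 / q) ^ N * (Cmod c / 2 * d)).
  { apply Rge_le in hN; apply (Rmult_le_compat_r (Cmod c / 2 * d)) in hN; [|lra].
    unfold Rdiv at 1 in hN; rewrite Rmult_assoc, Rinv_l in hN; lra. }
  assert (h6 : (M + 1) * q ^ N <= M * q ^ N) by nra.
  nra.
Qed.

(** A translation multiplies the coefficients by phases only, so vanishing at [PI] suffices. *)
Lemma fourier_unique phi : periodic phi -> RCcont phi -> (forall m, fourier phi m = 0%C) ->
  forall t, phi t = 0%C.
Proof.
intros hp hc hz t.
rewrite <- (fourier_zero_at_PI (fun u => phi (u + (t - PI)))).
- f_equal; ring.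
- intros u; apply RCc_comp with (g := fun u => u + (t - PI)); [apply hc|].
  apply (ex_derive_continuous (K := R_AbsRing) (V := R_NormedModule)); auto_derive; easy.
- intros m; rewrite fourier_shift, hz by easy; ring.
Qed.

(** * Geometrically bounded two-sided series *)

(** Symmetric partial sums: they are unchanged under m -> -m, which makes index reversal
    immediate. *)
Fixpoint Zpart (u : Z -> C) (N : nat) : C :=
  match N with
  | O => u 0%Z
  | S n => (Zpart u n + (u (Z.of_nat (S n)) + u (- Z.of_nat (S n))%Z))%C
  end.

Definition zgeo (u : Z -> C) (M q : R) : Prop := forall m, Cmod (u m) <= M * q ^ Z.abs_nat m.

Definition is_Zlim (u : Z -> C) (l : C) : Prop :=
  forall eps, 0 < eps -> exists N0, forall N, (N0 <= N)%nat -> Cmod (l - Zpart u N)%C < eps.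

(** Hilbert's epsilon makes the sum a total function of the sequence; its value has a meaning once a
    limit exists, for instance under [zgeo]. *)
Definition Zlim (u : Z -> C) : C := epsilon (inhabits (RtoC 0)) (is_Zlim u).

Lemma Zpart_ext u v N : (forall m, u m = v m) -> Zpart u N = Zpart v N.
Proof. intros h; induction N as [|n ih]; simpl; [|rewrite ih]; now rewrite !h. Qed.

Lemma Zpart_plus u v N : Zpart (fun m => u m + v m)%C N = (Zpart u N + Zpart v N)%C.
Proof. induction N as [|n ih]; simpl; [easy|rewrite ih; ring]. Qed.

Lemma Zpart_scal c u N : Zpart (fun m => c * u m)%C N = (c * Zpart u N)%C.
Proof. induction N as [|n ih]; simpl; [easy|rewrite ih; ring]. Qed.

Lemma Zpart_opp_arg u N : Zpart (fun m => u (- m)%Z) N = Zpart u N.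
Proof. induction N as [|n ih]; [easy|]. cbn [Zpart]; rewrite ih, Z.opp_involutive; ring. Qed.

Lemma Cmod_small (a : C) : (forall eps, 0 < eps -> Cmod a < eps) -> a = 0%C.
Proof.
intros h; destruct (Ceq_dec a 0) as [|ha]; [easy|].
apply Cmod_gt_0 in ha; specialize (h _ ha); lra.
Qed.

Lemma is_Zlim_unique u a b : is_Zlim u a -> is_Zlim u b -> a = b.
Proof.
intros h1 h2; assert (e : (a - b)%C = 0%C).
{ apply Cmod_small; intros eps he.
  destruct (h1 (eps / 2)) as [N1 k1]; [lra|]. destruct (h2 (eps / 2)) as [N2 k2]; [lra|].
  specialize (k1 (N1 + N2)%nat ltac:(lia)); specialize (k2 (N1 + N2)%nat ltac:(lia)).
  replace (a - b)%C with ((a - Zpart u (N1 + N2)) + - (b - Zpart u (N1 + N2)))%C by ring.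
  eapply Rle_lt_trans; [apply Cmod_triangle|]; rewrite Cmod_opp; lra. }
replace a with (a - b + b)%C by ring; rewrite e; ring.
Qed.

Lemma Zlim_eq u l : is_Zlim u l -> Zlim u = l.
Proof.
intros h; apply (is_Zlim_unique u); auto.
unfold Zlim; apply epsilon_spec; now exists l.
Qed.

(** The sum of M q^|m| over |m| > N, both signs of m together. *)
Definition ztail (M q : R) (N : nat) : R := 2 * M * q ^ S N / (1 - q).

Lemma ztail_small M q : 0 <= q < 1 -> forall eps, 0 < eps ->
  exists N0, forall N, (N0 <= N)%nat -> ztail M q N < eps.
Proof.
intros hq eps he.
set (A := 2 * Rabs M / (1 - q) + 1).
assert (hA : 0 < A).
{ unfold A; generalize (Rabs_pos M); intro. assert (0 <= 2 * Rabs M / (1 - q)); [|lra].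
  apply Rmult_le_pos; [lra|]; left; apply Rinv_0_lt_compat; lra. }
destruct (pow_lt_1_zero q) with (y := eps / A) as [N0 h].
{ rewrite Rabs_pos_eq; lra. }
{ now apply Rdiv_lt_0_compat. }
exists N0; intros N hN; specialize (h (S N) ltac:(lia)).
assert (hp : 0 <= q ^ S N) by (apply pow_le; lra).
rewrite Rabs_pos_eq in h by easy.
apply Rle_lt_trans with (A * q ^ S N).
- unfold ztail, Rdiv.
  replace (2 * M * q ^ S N * / (1 - q)) with ((2 * M * / (1 - q)) * q ^ S N) by ring.
  apply Rmult_le_compat_r; [easy|]; unfold A, Rdiv.
  assert (hi : 0 < / (1 - q)) by (apply Rinv_0_lt_compat; lra).
  generalize (Rle_abs M); intro. nra.
- apply (Rmult_lt_compat_l A) in h; [|easy].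
  replace (A * (eps / A)) with eps in h by (field; lra); easy.
Qed.

Lemma zgeo_M_pos u M q : zgeo u M q -> 0 <= M.
Proof. intros h; specialize (h 0%Z); simpl in h; generalize (Cmod_ge_0 (u 0%Z)); lra. Qed.

(** The factor 1 - q^p makes the bound an exact finite geometric sum, the form that induction on [p]
    preserves. *)
Lemma Zpart_diff u M q N p : 0 <= q < 1 -> zgeo u M q ->
  Cmod (Zpart u (N + p) - Zpart u N)%C <= 2 * M * q ^ S N * (1 - q ^ p) / (1 - q).
Proof.
intros hq h; induction p as [|p ih].
- rewrite Nat.add_0_r; replace (Zpart u N - Zpart u N)%C with (RtoC 0) by ring.
  rewrite Cmod_0; simpl; right; field; lra.
- rewrite Nat.add_succ_r; cbn [Zpart].
  set (k := S (N + p)).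
  replace (Zpart u (N + p) + (u (Z.of_nat k) + u (- Z.of_nat k)%Z) - Zpart u N)%C with
    ((Zpart u (N + p) - Zpart u N) + (u (Z.of_nat k) + u (- Z.of_nat k)%Z))%C by ring.
  eapply Rle_trans; [apply Cmod_triangle|].
  assert (h1 := Cmod_triangle (u (Z.of_nat k)) (u (- Z.of_nat k)%Z)).
  assert (h2 := h (Z.of_nat k)); assert (h3 := h (- Z.of_nat k)%Z).
  rewrite Zabs2Nat.id in h2; replace (Z.abs_nat (- Z.of_nat k)) with k in h3 by lia.
  replace (2 * M * q ^ S N * (1 - q ^ S p) / (1 - q)) with
    (2 * M * q ^ S N * (1 - q ^ p) / (1 - q) + 2 * (M * q ^ k)).
  + lra.
  + unfold k; replace (S (N + p)) with (S N + p)%nat by lia; rewrite pow_add; simpl; field; lra.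
Qed.

Lemma Zpart_diff_tail u M q N p : 0 <= q < 1 -> zgeo u M q ->
  Cmod (Zpart u (N + p) - Zpart u N)%C <= ztail M q N.
Proof.
intros hq h; eapply Rle_trans; [now apply Zpart_diff|].
assert (hM := zgeo_M_pos _ _ _ h).
assert (hp : 0 <= q ^ p) by (apply pow_le; lra).
assert (hN : 0 <= q ^ S N) by (apply pow_le; lra).
apply Rmult_le_compat_r; [left; apply Rinv_0_lt_compat; lra|].
assert (0 <= M * q ^ S N) by (now apply Rmult_le_pos). nra.
Qed.

Lemma ex_Zlim u M q : 0 <= q < 1 -> zgeo u M q -> exists l, is_Zlim u l.
Proof.
intros hq h.
assert (hc : forall eps : posreal, exists N0, forall n m, (N0 <= n)%nat -> (N0 <= m)%nat ->
  Cmod (Zpart u n - Zpart u m)%C < eps).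
{ intros [eps he]; simpl.
  destruct (ztail_small M q hq eps he) as [N0 hN]; exists N0.
  assert (hle : forall n m, (N0 <= n)%nat -> (n <= m)%nat -> Cmod (Zpart u m - Zpart u n)%C < eps).
  { intros n m hn hm; replace m with (n + (m - n))%nat by lia.
    eapply Rle_lt_trans; [eapply Zpart_diff_tail; eauto|auto]. }
  intros n m hn hm; destruct (Nat.le_ge_cases n m) as [hl|hl]; [|auto].
  rewrite <- Cmod_opp; replace (- (Zpart u n - Zpart u m))%C with (Zpart u m - Zpart u n)%C by ring; auto. }
assert (hre : ex_finite_lim_seq (fun n => Re (Zpart u n))).
{ apply ex_lim_seq_cauchy_corr; intros eps; destruct (hc eps) as [N0 hN]; exists N0; intros n m hn hm.
  eapply Rle_lt_trans; [|apply (hN n m hn hm)].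
  apply Rle_trans with (2 := Cmod_Re _); unfold Re; simpl; unfold Rminus; lra. }
assert (him : ex_finite_lim_seq (fun n => Im (Zpart u n))).
{ apply ex_lim_seq_cauchy_corr; intros eps; destruct (hc eps) as [N0 hN]; exists N0; intros n m hn hm.
  eapply Rle_lt_trans; [|apply (hN n m hn hm)].
  apply Rle_trans with (2 := Cmod_Im _); unfold Im; simpl; unfold Rminus; lra. }
destruct hre as [a ha], him as [b hb]; exists (a, b); intros eps he.
apply is_lim_seq_spec in ha, hb; simpl in ha, hb.
destruct (ha (mkposreal (eps / 2) ltac:(lra))) as [N1 h1].
destruct (hb (mkposreal (eps / 2) ltac:(lra))) as [N2 h2].
exists (N1 + N2)%nat; intros N hN.
specialize (h1 N ltac:(lia)); specialize (h2 N ltac:(lia)); simpl in h1, h2.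
eapply Rle_lt_trans; [apply Cmod_le_sum|].
unfold Re, Im in *; simpl; rewrite <- (Rabs_Ropp (_ + - fst _)), <- (Rabs_Ropp (b + - snd _)).
replace (- (a + - fst (Zpart u N))) with (fst (Zpart u N) - a) by ring.
replace (- (b + - snd (Zpart u N))) with (snd (Zpart u N) - b) by ring; lra.
Qed.

Lemma Zlim_correct u M q : 0 <= q < 1 -> zgeo u M q -> is_Zlim u (Zlim u).
Proof. intros hq h; unfold Zlim; apply epsilon_spec; eapply ex_Zlim; eauto. Qed.

Lemma Zlim_tail u M q N : 0 <= q < 1 -> zgeo u M q -> Cmod (Zlim u - Zpart u N)%C <= ztail M q N.
Proof.
intros hq h; apply Rnot_lt_le; intros hlt.
destruct (Zlim_correct u M q hq h (Cmod (Zlim u - Zpart u N)%C - ztail M q N)) as [N0 hN]; [lra|].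
specialize (hN (N + N0)%nat ltac:(lia)).
assert (h2 := Zpart_diff_tail u M q N N0 hq h).
assert (h3 := Cmod_triangle (Zlim u - Zpart u (N + N0))%C (Zpart u (N + N0) - Zpart u N)%C).
replace (Zlim u - Zpart u (N + N0) + (Zpart u (N + N0) - Zpart u N))%C with (Zlim u - Zpart u N)%C in h3 by ring.
lra.
Qed.

Lemma Zlim_ext u v : (forall m, u m = v m) -> Zlim u = Zlim v.
Proof.
intros h; assert (e : u = v).
{ apply functional_extensionality; easy. }
now rewrite e.
Qed.

Lemma Zlim_opp_arg u M q : 0 <= q < 1 -> zgeo u M q -> Zlim (fun m => u (- m)%Z) = Zlim u.
Proof.
intros hq h; apply Zlim_eq; intros eps he; destruct (Zlim_correct u M q hq h eps he) as [N0 h0].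
exists N0; intros N hN; rewrite Zpart_opp_arg; auto.
Qed.

Lemma Zlim_scal c u M q : 0 <= q < 1 -> zgeo u M q -> Zlim (fun m => c * u m)%C = (c * Zlim u)%C.
Proof.
intros hq h; apply Zlim_eq; intros eps he.
assert (hc := Cmod_ge_0 c).
destruct (Zlim_correct u M q hq h (eps / (Cmod c + 1))) as [N0 h0].
{ apply Rdiv_lt_0_compat; lra. }
exists N0; intros N hN; rewrite Zpart_scal; specialize (h0 N hN).
replace (c * Zlim u - c * Zpart u N)%C with (c * (Zlim u - Zpart u N))%C by ring.
rewrite Cmod_mult; apply (Rmult_lt_compat_l (Cmod c + 1)) in h0; [|lra].
replace ((Cmod c + 1) * (eps / (Cmod c + 1))) with eps in h0 by (field; lra).
generalize (Cmod_ge_0 (Zlim u - Zpart u N)%C); lra.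
Qed.

Lemma Zlim_plus u v M q M' q' : 0 <= q < 1 -> zgeo u M q -> 0 <= q' < 1 -> zgeo v M' q' ->
  Zlim (fun m => u m + v m)%C = (Zlim u + Zlim v)%C.
Proof.
intros hq h hq' h'; apply Zlim_eq; intros eps he.
destruct (Zlim_correct u M q hq h (eps / 2)) as [N1 h1]; [lra|].
destruct (Zlim_correct v M' q' hq' h' (eps / 2)) as [N2 h2]; [lra|].
exists (N1 + N2)%nat; intros N hN; rewrite Zpart_plus.
specialize (h1 N ltac:(lia)); specialize (h2 N ltac:(lia)).
replace (Zlim u + Zlim v - (Zpart u N + Zpart v N))%C with
  ((Zlim u - Zpart u N) + (Zlim v - Zpart v N))%C by ring.
eapply Rle_lt_trans; [apply Cmod_triangle|lra].
Qed.

Lemma Zlim_bound u M q : 0 <= q < 1 -> zgeo u M q -> Cmod (Zlim u) <= 3 * M / (1 - q).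
Proof.
intros hq h; assert (h1 := Zlim_tail u M q 0 hq h); assert (h2 := h 0%Z).
assert (hM := zgeo_M_pos _ _ _ h).
simpl in h1, h2; unfold ztail in h1; simpl in h1; rewrite Rmult_1_r in h1, h2.
replace (Zlim u) with ((Zlim u - u 0%Z) + u 0%Z)%C by ring.
eapply Rle_trans; [apply Cmod_triangle|].
apply Rle_trans with (2 * M * q / (1 - q) + M); [lra|].
apply (Rmult_le_reg_r (1 - q)); [lra|].
replace ((2 * M * q / (1 - q) + M) * (1 - q)) with (2 * M * q + M * (1 - q)) by (field; lra).
replace (3 * M / (1 - q) * (1 - q)) with (3 * M) by (field; lra). nra.
Qed.

Lemma zgeo_em u M q t : zgeo u M q -> zgeo (fun m => u m * em m t)%C M q.
Proof. intros h m; rewrite Cmod_mult, em_mod, Rmult_1_r; apply h. Qed.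

Lemma RCcont_Zpart u N : RCcont (fun t => Zpart (fun m => u m * em m t)%C N).
Proof.
assert (h : forall m t, RCc (fun t => u m * em m t)%C t)
  by (intros; apply RCc_mult; auto using RCc_const, RCc_em).
induction N as [|n ih]; intros t; simpl; auto.
apply RCc_plus; [apply ih|apply RCc_plus; apply h].
Qed.

Lemma fourier_Zpart u N m : fourier (fun t => Zpart (fun m => u m * em m t)%C N) m =
  if le_dec (Z.abs_nat m) N then u m else RtoC 0.
Proof.
assert (h : forall m, RCcont (fun t => u m * em m t)%C)
  by (intros k t; apply RCc_mult; auto using RCc_const, RCc_em).
assert (hf : forall k, fourier (fun t => u k * em k t)%C m = if Z.eq_dec m k then u m else RtoC 0).
{ intros k; rewrite fourier_scal, fourier_em by apply RCcont_em.
  destruct (Z.eq_dec m k) as [->|]; ring. }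
induction N as [|n ih].
- simpl Zpart; rewrite hf; destruct (Z.eq_dec m 0), (le_dec (Z.abs_nat m) 0); auto; lia.
- cbn [Zpart]; rewrite fourier_plus, fourier_plus, ih, !hf; auto.
  + destruct (le_dec (Z.abs_nat m) n), (Z.eq_dec m (Z.of_nat (S n))), (Z.eq_dec m (- Z.of_nat (S n))),
      (le_dec (Z.abs_nat m) (S n)); try lia; ring.
  + apply RCcont_Zpart.
  + intros t; apply RCc_plus; apply h.
Qed.

Lemma RCcont_Zlim u M q : 0 <= q < 1 -> zgeo u M q -> RCcont (fun t => Zlim (fun m => u m * em m t)%C).
Proof.
intros hq h t; apply RCc_eps; intros eps he.
destruct (ztail_small M q hq (eps / 3)) as [N0 hN]; [lra|]; specialize (hN N0 (le_n _)).
destruct (proj1 (RCc_eps _ _) (RCcont_Zpart u N0 t) (eps / 3)) as [d [hd h']]; [lra|].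
exists d; split; auto; intros s hs; specialize (h' s hs).
assert (h1 := Zlim_tail _ _ _ N0 hq (zgeo_em u M q s h)).
assert (h2 := Zlim_tail _ _ _ N0 hq (zgeo_em u M q t h)).
set (A := Zlim (fun m => u m * em m s)%C) in *; set (B := Zlim (fun m => u m * em m t)%C) in *.
set (a := Zpart (fun m => u m * em m s)%C N0) in *; set (b := Zpart (fun m => u m * em m t)%C N0) in *.
replace (A - B)%C with ((A - a) + ((a - b) + - (B - b)))%C by ring.
eapply Rle_lt_trans; [apply Cmod_triangle|].
assert (h3 := Cmod_triangle (a - b) (- (B - b))); rewrite Cmod_opp in h3; lra.
Qed.

Lemma periodic_Zlim u : periodic (fun t => Zlim (fun m => u m * em m t)%C).
Proof. intros t; apply Zlim_ext; intros m; now rewrite periodic_em. Qed.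

(** A partial sum with N >= |m| already has [u m] as its coefficient, and the coefficients of the
    remainder are bounded by its supremum. *)
Lemma fourier_Zlim u M q m : 0 <= q < 1 -> zgeo u M q ->
  fourier (fun t => Zlim (fun m => u m * em m t)%C) m = u m.
Proof.
intros hq h.
assert (e : (fourier (fun t => Zlim (fun m => u m * em m t)%C) m - u m)%C = 0%C).
{ apply Cmod_small; intros eps he.
  destruct (ztail_small M q hq eps he) as [N0 hN].
  specialize (hN (N0 + Z.abs_nat m)%nat ltac:(lia)).
  set (N := (N0 + Z.abs_nat m)%nat) in *.
  assert (hz := fourier_Zpart u N m).
  destruct (le_dec (Z.abs_nat m) N) as [_|hn]; [|unfold N in hn; lia].
  rewrite <- hz, <- fourier_minus.
  - eapply Rle_lt_trans; [apply fourier_bound|apply hN].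
    + intros t; apply RCc_minus; [eapply RCcont_Zlim; eauto|apply RCcont_Zpart].
    + intros t; apply Zlim_tail; auto using zgeo_em.
  - eapply RCcont_Zlim; eauto.
  - apply RCcont_Zpart. }
replace (u m) with (u m + 0)%C by ring; rewrite <- e; ring.
Qed.

(** Geometric decay makes the series a continuous function with the same coefficients as [phi];
    uniqueness identifies the two. *)
Lemma fourier_inversion phi M q : periodic phi -> RCcont phi -> 0 <= q < 1 -> zgeo (fourier phi) M q ->
  forall t, phi t = Zlim (fun m => fourier phi m * em m t)%C.
Proof.
intros hp hc hq h t.
assert (e : (phi t - Zlim (fun m => fourier phi m * em m t))%C = 0%C).
{ apply (fourier_unique (fun t => phi t - Zlim (fun m => fourier phi m * em m t))%C).
  - intros s; rewrite hp; f_equal; apply (periodic_Zlim (fourier phi) s).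
  - intros s; apply RCc_minus; auto; eapply RCcont_Zlim; eauto.
  - intros m; rewrite fourier_minus; auto.
    + erewrite (fourier_Zlim (fourier phi)); eauto; ring.
    + eapply RCcont_Zlim; eauto. }
replace (phi t) with (phi t - Zlim (fun m => fourier phi m * em m t) + Zlim (fun m => fourier phi m * em m t))%C by ring.
rewrite e; ring.
Qed.

(** * Goursat's theorem on rectangles *)

Lemma nested_intervals (u v : nat -> R) :
  (forall n, u n <= u (S n)) -> (forall n, v (S n) <= v n) -> (forall n, u n <= v n) ->
  exists c, forall n, u n <= c <= v n.
Proof.
intros hu hv huv.
assert (hu' : forall n k, u n <= u (n + k)%nat).
{ intros n k; induction k as [|k ih]; [rewrite Nat.add_0_r; lra|].
  rewrite Nat.add_succ_r; specialize (hu (n + k)%nat); lra. }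
assert (hv' : forall n k, v (n + k)%nat <= v n).
{ intros n k; induction k as [|k ih]; [rewrite Nat.add_0_r; lra|].
  rewrite Nat.add_succ_r; specialize (hv (n + k)%nat); lra. }
assert (h : forall n m, u n <= v m).
{ intros n m; specialize (hu' n m); specialize (hv' m n); specialize (huv (n + m)%nat).
  rewrite (Nat.add_comm m n) in hv'; lra. }
destruct (completeness (fun x => exists n, x = u n)) as [c [h1 h2]].
- exists (v 0%nat); intros x [n ->]; apply h.
- now exists (u 0%nat), 0%nat.
- exists c; intros n; split.
  + apply h1; now exists n.
  + apply h2; intros x [m ->]; apply h.
Qed.

(** Complex differentiability in real coordinates. The increment is measured by the sum of the
    coordinates, which on a rectangle is at most the sum of the sides. *)
Definition has_Cderiv (G : R -> R -> C) (x y : R) : Prop :=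
  exists l : C, forall eps, 0 < eps -> exists d, 0 < d /\ forall s t,
    Rabs (s - x) < d -> Rabs (t - y) < d ->
    Cmod (G s t - G x y - l * (s - x, t - y)%R)%C <= eps * (Rabs (s - x) + Rabs (t - y)).

(** Boundary integral over the rectangle with lower left corner [(x, y)] and sides [h], [k]. *)
Definition RI (G : R -> R -> C) (x y h k : R) : C :=
  (CInt (fun s => G s y) x (x + h) - CInt (fun s => G s (y + k)%R) x (x + h)
   + Ci * (CInt (fun t => G (x + h)%R t) y (y + k) - CInt (fun t => G x t) y (y + k)))%C.

Lemma has_Cderiv_c1 G x y : has_Cderiv G x y -> RCc (fun s => G s y) x.
Proof.
intros [l hl]; apply RCc_eps; intros eps he.
destruct (hl 1 ltac:(lra)) as [d [hd h]].
assert (hl0 := Cmod_ge_0 l).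
exists (Rmin d (eps / (Cmod l + 2))); split.
{ apply Rmin_pos; [easy|apply Rdiv_lt_0_compat; lra]. }
intros s hs.
assert (h1 := Rlt_le_trans _ _ _ hs (Rmin_l _ _)); assert (h2 := Rlt_le_trans _ _ _ hs (Rmin_r _ _)).
specialize (h s y h1); rewrite Rminus_diag, Rabs_R0 in h; specialize (h hd).
replace (G s y - G x y)%C with ((G s y - G x y - l * (s - x, 0)%R) + l * RtoC (s - x))%C
  by (unfold RtoC; ring).
eapply Rle_lt_trans; [apply Cmod_triangle|]; rewrite Cmod_mult, Cmod_R.
apply (Rmult_lt_compat_l (Cmod l + 2)) in h2; [|lra].
replace ((Cmod l + 2) * (eps / (Cmod l + 2))) with eps in h2 by (field; lra).
generalize (Rabs_pos (s - x)); nra.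
Qed.

Lemma has_Cderiv_c2 G x y : has_Cderiv G x y -> RCc (fun t => G x t) y.
Proof.
intros [l hl]; apply RCc_eps; intros eps he.
destruct (hl 1 ltac:(lra)) as [d [hd h]].
assert (hl0 := Cmod_ge_0 l).
exists (Rmin d (eps / (Cmod l + 2))); split.
{ apply Rmin_pos; [easy|apply Rdiv_lt_0_compat; lra]. }
intros t ht.
assert (h1 := Rlt_le_trans _ _ _ ht (Rmin_l _ _)); assert (h2 := Rlt_le_trans _ _ _ ht (Rmin_r _ _)).
specialize (h x t); rewrite Rminus_diag, Rabs_R0 in h; specialize (h hd h1).
replace (G x t - G x y)%C with ((G x t - G x y - l * (0, t - y)%R) + l * (Ci * RtoC (t - y)))%C.
2: { replace ((0, t - y)%R : C) with (Ci * RtoC (t - y))%C by (apply C_ext; simpl; ring); ring. }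
eapply Rle_lt_trans; [apply Cmod_triangle|]; rewrite !Cmod_mult, Cmod_Ci, Cmod_R.
apply (Rmult_lt_compat_l (Cmod l + 2)) in h2; [|lra].
replace ((Cmod l + 2) * (eps / (Cmod l + 2))) with eps in h2 by (field; lra).
generalize (Rabs_pos (t - y)); nra.
Qed.

Definition Cderiv_rect (G : R -> R -> C) (X Y H K : R) : Prop :=
  forall x y, X <= x <= X + H -> Y <= y <= Y + K -> has_Cderiv G x y.

Lemma Cderiv_rect_c1 G X Y H K y a b : Cderiv_rect G X Y H K -> Y <= y <= Y + K -> X <= a <= X + H -> X <= b <= X + H -> RCc_on (fun s => G s y) a b.
Proof.
intros hG hy ha hb t ht; apply has_Cderiv_c1, hG; auto.
revert ht; unfold Rmin, Rmax; destruct (Rle_dec a b); lra.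
Qed.

Lemma Cderiv_rect_c2 G X Y H K x a b : Cderiv_rect G X Y H K -> X <= x <= X + H -> Y <= a <= Y + K -> Y <= b <= Y + K -> RCc_on (fun t => G x t) a b.
Proof.
intros hG hy ha hb t ht; apply has_Cderiv_c2, hG; auto.
revert ht; unfold Rmin, Rmax; destruct (Rle_dec a b); lra.
Qed.

Lemma RI_split G x y h k : 0 < h -> 0 < k -> Cderiv_rect G x y (2 * h) (2 * k) ->
  RI G x y (2 * h) (2 * k) =
   (RI G x y h k + RI G (x + h) y h k + RI G x (y + k) h k + RI G (x + h) (y + k) h k)%C.
Proof.
intros h1 h2 hG; unfold RI.
replace (x + h + h) with (x + 2 * h) by ring; replace (y + k + k) with (y + 2 * k) by ring.
rewrite <- (CInt_Chasles (fun s => G s y) x (x + h)) by (apply (Cderiv_rect_c1 _ _ _ _ _ _ _ _ hG); lra).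
rewrite <- (CInt_Chasles (fun s => G s (y + 2 * k)) x (x + h)) by (apply (Cderiv_rect_c1 _ _ _ _ _ _ _ _ hG); lra).
rewrite <- (CInt_Chasles (fun t => G x t) y (y + k)) by (apply (Cderiv_rect_c2 _ _ _ _ _ _ _ _ hG); lra).
rewrite <- (CInt_Chasles (fun t => G (x + 2 * h) t) y (y + k)) by (apply (Cderiv_rect_c2 _ _ _ _ _ _ _ _ hG); lra).
ring.
Qed.

(** [h] and [k] are the sides of the quarters. If the first three quarters carry less than a quarter
    of the integral, the triangle inequality leaves the fourth. *)
Definition goursat_step (G : R -> R -> C) (p : R * R) (h k : R) : R * R :=
  let (x, y) := p in
  let T := Cmod (RI G x y (2 * h) (2 * k)) / 4 in
  if Rle_dec T (Cmod (RI G x y h k)) then (x, y) else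
  if Rle_dec T (Cmod (RI G (x + h) y h k)) then (x + h, y) else
  if Rle_dec T (Cmod (RI G x (y + k) h k)) then (x, y + k) else (x + h, y + k).

Lemma goursat_step_spec G x y h k : 0 < h -> 0 < k -> Cderiv_rect G x y (2 * h) (2 * k) ->
  let p := goursat_step G (x, y) h k in
  x <= fst p <= x + h /\ y <= snd p <= y + k /\
  Cmod (RI G x y (2 * h) (2 * k)) / 4 <= Cmod (RI G (fst p) (snd p) h k).
Proof.
intros h1 h2 hG; assert (e := RI_split G x y h k h1 h2 hG); unfold goursat_step.
set (T := Cmod (RI G x y (2 * h) (2 * k)) / 4).
assert (ht : 4 * T <= Cmod (RI G x y h k) + Cmod (RI G (x + h) y h k) + Cmod (RI G x (y + k) h k)
   + Cmod (RI G (x + h) (y + k) h k)).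
{ unfold T; rewrite e.
  generalize (RI G x y h k) (RI G (x + h) y h k) (RI G x (y + k) h k) (RI G (x + h) (y + k) h k).
  intros a b c d.
  generalize (Cmod_triangle (a + b + c) d) (Cmod_triangle (a + b) c) (Cmod_triangle a b); lra. }
repeat destruct (Rle_dec _ _); simpl; repeat split; try lra.
Qed.

Lemma CInt_affine (p l : C) a b :
  CInt (fun t => p + l * RtoC t)%C a b = (p * RtoC (b - a) + l * RtoC ((b * b - a * a) / 2))%C.
Proof.
rewrite (CInt_derive (fun t => p * RtoC t + l * RtoC (t * t / 2))%C).
- apply C_ext; simpl; field.
- intros t _; apply RCd_plus.
  + eapply RCd_ext; [| |apply (RCd_scal p (fun t => RtoC t) t 1)]; [easy|ring|].
    apply RCd_RtoC; auto_derive; easy.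
  + apply RCd_scal, RCd_RtoC; auto_derive; [easy|field].
- intros t _; apply RCc_plus; [apply RCc_const|]; apply RCc_mult; [apply RCc_const|].
  apply RCc_RtoC; apply continuous_id.
Qed.

(** Affine functions of z have quadratic primitives, so the four sides cancel. *)
Lemma RI_affine (p l : C) x0 y0 x y h k : RI (fun s t => p + l * (s - x0, t - y0)%R)%C x y h k = 0%C.
Proof.
unfold RI.
assert (e1 : forall v a b, CInt (fun s => p + l * (s - x0, v - y0)%R)%C a b =
  CInt (fun s => (p + l * (- x0, v - y0)%R) + l * RtoC s)%C a b).
{ intros; apply CInt_ext; intros; apply C_ext; simpl; ring. }
assert (e2 : forall u a b, CInt (fun t => p + l * (u - x0, t - y0)%R)%C a b =
  CInt (fun t => (p + l * (u - x0, - y0)%R) + (l * Ci) * RtoC t)%C a b).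
{ intros; apply CInt_ext; intros; apply C_ext; simpl; ring. }
rewrite !e1, !e2, !CInt_affine; apply C_ext; simpl; field.
Qed.

Lemma RI_minus G F x y h k : Cderiv_rect G x y h k -> Cderiv_rect F x y h k -> 0 < h -> 0 < k ->
  RI (fun s t => G s t - F s t)%C x y h k = (RI G x y h k - RI F x y h k)%C.
Proof.
intros hG hF hh hk; unfold RI.
rewrite (CInt_minus (fun s => G s y)), (CInt_minus (fun s => G s (y + k))),
  (CInt_minus (fun t => G (x + h) t) (fun t => F (x + h) t)), (CInt_minus (fun t => G x t) (fun t => F x t)); [ring| | | | | | | |];
  first [apply (Cderiv_rect_c1 _ _ _ _ _ _ _ _ hG); lra | apply (Cderiv_rect_c2 _ _ _ _ _ _ _ _ hG); lra |
         apply (Cderiv_rect_c1 _ _ _ _ _ _ _ _ hF); lra | apply (Cderiv_rect_c2 _ _ _ _ _ _ _ _ hF); lra].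
Qed.

Lemma has_Cderiv_affine (p l : C) x0 y0 x y : has_Cderiv (fun s t => p + l * (s - x0, t - y0)%R)%C x y.
Proof.
exists l; intros eps he; exists 1; split; [lra|]; intros s t _ _.
match goal with |- Cmod ?a <= _ => replace a with (RtoC 0) end.
- rewrite Cmod_0; apply Rmult_le_pos; [lra|].
  generalize (Rabs_pos (s - x)) (Rabs_pos (t - y)); lra.
- apply C_ext; simpl; ring.
Qed.

Lemma has_Cderiv_minus G F x y : has_Cderiv G x y -> has_Cderiv F x y ->
  has_Cderiv (fun s t => G s t - F s t)%C x y.
Proof.
intros [a ha] [b hb]; exists (a - b)%C; intros eps he.
destruct (ha (eps / 2)) as [d1 [p1 q1]]; [lra|]; destruct (hb (eps / 2)) as [d2 [p2 q2]]; [lra|].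
exists (Rmin d1 d2); split; [now apply Rmin_pos|]; intros s t hs ht.
specialize (q1 s t (Rlt_le_trans _ _ _ hs (Rmin_l _ _)) (Rlt_le_trans _ _ _ ht (Rmin_l _ _))).
specialize (q2 s t (Rlt_le_trans _ _ _ hs (Rmin_r _ _)) (Rlt_le_trans _ _ _ ht (Rmin_r _ _))).
set (v := (s - x, t - y)%R : C) in *.
replace (G s t - F s t - (G x y - F x y) - (a - b) * v)%C with
  ((G s t - G x y - a * v) + - (F s t - F x y - b * v))%C by ring.
eapply Rle_trans; [apply Cmod_triangle|]; rewrite Cmod_opp; lra.
Qed.

Lemma RI_bound G x y h k M : Cderiv_rect G x y h k -> 0 < h -> 0 < k ->
  (forall s t, x <= s <= x + h -> y <= t <= y + k -> Cmod (G s t) <= M) ->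
  Cmod (RI G x y h k) <= 2 * (h + k) * M.
Proof.
intros hG hh hk hM; unfold RI.
assert (b1 : forall v, y <= v <= y + k -> Cmod (CInt (fun s => G s v) x (x + h)) <= h * M).
{ intros v hv; replace (h * M) with ((x + h - x) * M) by ring; apply CInt_bound; [lra| |].
  - apply (Cderiv_rect_c1 _ _ _ _ _ _ _ _ hG); lra.
  - intros; apply hM; lra. }
assert (b2 : forall u, x <= u <= x + h -> Cmod (CInt (fun t => G u t) y (y + k)) <= k * M).
{ intros u hu; replace (k * M) with ((y + k - y) * M) by ring; apply CInt_bound; [lra| |].
  - apply (Cderiv_rect_c2 _ _ _ _ _ _ _ _ hG); lra.
  - intros; apply hM; lra. }
generalize (b1 y ltac:(lra)) (b1 (y + k) ltac:(lra)) (b2 x ltac:(lra)) (b2 (x + h) ltac:(lra)).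
generalize (CInt (fun s => G s y) x (x + h)) (CInt (fun s => G s (y + k)) x (x + h))
  (CInt (fun t => G (x + h) t) y (y + k)) (CInt (fun t => G x t) y (y + k)).
intros a b c d h1 h2 h3 h4.
eapply Rle_trans; [apply Cmod_triangle|]; rewrite Cmod_mult, Cmod_Ci, Rmult_1_l.
generalize (Cmod_triangle a (- b)) (Cmod_triangle c (- d)); rewrite !Cmod_opp; unfold Cminus; lra.
Qed.

(** Subtracting the affine approximation does not change the boundary integral. The perimeter is 2
    (h + k) and the error is at most eps (h + k). *)
Lemma goursat_local G x y h k x0 y0 l eps : Cderiv_rect G x y h k -> 0 < h -> 0 < k -> 0 < eps ->
  x <= x0 <= x + h -> y <= y0 <= y + k ->
  (forall s t, x <= s <= x + h -> y <= t <= y + k ->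
    Cmod (G s t - G x0 y0 - l * (s - x0, t - y0)%R)%C <= eps * (Rabs (s - x0) + Rabs (t - y0))) ->
  Cmod (RI G x y h k) <= 2 * (h + k) * (eps * (h + k)).
Proof.
intros hG hh hk he hx hy hb.
assert (hF : Cderiv_rect (fun s t => G x0 y0 + l * (s - x0, t - y0)%R)%C x y h k)
  by (intros u v _ _; apply has_Cderiv_affine).
replace (RI G x y h k) with (RI (fun s t => G s t - (G x0 y0 + l * (s - x0, t - y0)%R))%C x y h k).
2: { rewrite RI_minus, RI_affine by easy; ring. }
apply RI_bound; auto.
- intros u v hu hv; apply has_Cderiv_minus; auto.
- intros s t hs ht.
  replace (G s t - (G x0 y0 + l * (s - x0, t - y0)%R))%C with
    (G s t - G x0 y0 - l * (s - x0, t - y0)%R)%C by ring.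
  eapply Rle_trans; [now apply hb|]; apply Rmult_le_compat_l; [lra|].
  apply Rplus_le_compat; apply Rabs_le; lra.
Qed.

Fixpoint goursat_seq (G : R -> R -> C) (X Y H K : R) (n : nat) : R * R :=
  match n with
  | O => (X, Y)
  | S n => goursat_step G (goursat_seq G X Y H K n) (H / 2 ^ S n) (K / 2 ^ S n)
  end.

Lemma goursat G X Y H K : 0 < H -> 0 < K -> Cderiv_rect G X Y H K -> RI G X Y H K = 0%C.
Proof.
intros hH hK hG; apply Cmod_small; intros eps' he'.
assert (h2 : forall n, 0 < 2 ^ n) by (intro; apply pow_lt; lra).
assert (hHn : forall n, 0 < H / 2 ^ n) by (intro; apply Rdiv_lt_0_compat; auto).
assert (hKn : forall n, 0 < K / 2 ^ n) by (intro; apply Rdiv_lt_0_compat; auto).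
assert (eH : forall n, H / 2 ^ n = 2 * (H / 2 ^ S n)) by (intro n; simpl; field; specialize (h2 n); lra).
assert (eK : forall n, K / 2 ^ n = 2 * (K / 2 ^ S n)) by (intro n; simpl; field; specialize (h2 n); lra).
set (x n := fst (goursat_seq G X Y H K n)); set (y n := snd (goursat_seq G X Y H K n)).
set (T := Cmod (RI G X Y H K)).
(* The rectangles stay inside the original one, keep at least the fraction 4^(-n) of the integral,
   and are nested; the clauses on both ends feed [nested_intervals]. *)
assert (inv : forall n, (X <= x n /\ x n + H / 2 ^ n <= X + H) /\ (Y <= y n /\ y n + K / 2 ^ n <= Y + K) /\
  T / 4 ^ n <= Cmod (RI G (x n) (y n) (H / 2 ^ n) (K / 2 ^ n)) /\
  (x n <= x (S n) /\ x (S n) + H / 2 ^ S n <= x n + H / 2 ^ n) /\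
  (y n <= y (S n) /\ y (S n) + K / 2 ^ S n <= y n + K / 2 ^ n)).
{ assert (st : forall n, X <= x n -> x n + H / 2 ^ n <= X + H -> Y <= y n -> y n + K / 2 ^ n <= Y + K ->
    x n <= x (S n) <= x n + H / 2 ^ S n /\ y n <= y (S n) <= y n + K / 2 ^ S n /\
    Cmod (RI G (x n) (y n) (H / 2 ^ n) (K / 2 ^ n)) / 4 <=
      Cmod (RI G (x (S n)) (y (S n)) (H / 2 ^ S n) (K / 2 ^ S n))).
  { intros n k1 k2 k3 k4.
    assert (sp := goursat_step_spec G (x n) (y n) (H / 2 ^ S n) (K / 2 ^ S n) (hHn _) (hKn _)).
    rewrite <- eH, <- eK in sp.
    assert (es : goursat_step G (x n, y n) (H / 2 ^ S n) (K / 2 ^ S n) = goursat_seq G X Y H K (S n)).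
    { unfold x, y; rewrite <- surjective_pairing; reflexivity. }
    rewrite es in sp; apply sp.
    intros u v hu hv; apply hG; lra. }
  induction n as [|n ih].
  - assert (e0 : H / 2 ^ 0 = H) by (simpl; field); assert (e1 : K / 2 ^ 0 = K) by (simpl; field).
    assert (i1 : X <= x 0%nat) by (unfold x; simpl; lra).
    assert (i2 : x 0%nat + H / 2 ^ 0 <= X + H) by (rewrite e0; unfold x; simpl; lra).
    assert (i3 : Y <= y 0%nat) by (unfold y; simpl; lra).
    assert (i4 : y 0%nat + K / 2 ^ 0 <= Y + K) by (rewrite e1; unfold y; simpl; lra).
    destruct (st 0%nat i1 i2 i3 i4) as (s1 & s2 & s3).
    assert (i5 : T / 4 ^ 0 <= Cmod (RI G (x 0%nat) (y 0%nat) (H / 2 ^ 0) (K / 2 ^ 0))).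
    { rewrite e0, e1; unfold x, y, T; simpl; lra. }
    assert (eH0 := eH 0%nat); assert (eK0 := eK 0%nat).
    repeat split; auto; lra.
  - destruct ih as ((i1 & i2) & (i3 & i4) & i5 & (i6 & i7) & (i8 & i9)).
    destruct (st n i1 i2 i3 i4) as (s1 & s2 & s3).
    destruct (st (S n)) as (t1 & t2 & t3); try lra.
    assert (j5 : T / 4 ^ S n <= Cmod (RI G (x (S n)) (y (S n)) (H / 2 ^ S n) (K / 2 ^ S n))).
    { eapply Rle_trans; [|apply s3].
      replace (T / 4 ^ S n) with (T / 4 ^ n / 4) by (simpl; field; apply pow_nonzero; lra); lra. }
    assert (eH0 := eH (S n)); assert (eK0 := eK (S n)).
    repeat split; auto; lra. }
destruct (nested_intervals x (fun n => x n + H / 2 ^ n)) as [x0 hx0];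
  [intro n; apply (inv n)|intro n; apply (inv n)|intro n; specialize (hHn n); lra|].
destruct (nested_intervals y (fun n => y n + K / 2 ^ n)) as [y0 hy0];
  [intro n; apply (inv n)|intro n; apply (inv n)|intro n; specialize (hKn n); lra|].
destruct (hG x0 y0) as [l hl].
{ specialize (hx0 0%nat); destruct (inv 0%nat) as ((i1 & i2) & _); lra. }
{ specialize (hy0 0%nat); destruct (inv 0%nat) as (_ & (i1 & i2) & _); lra. }
apply Rnot_le_lt; intros hT; fold T in hT.
(* With this value the local estimate at stage N is T / 4^N / 2, half of the lower bound in
   [inv]. *)
set (eps := T / (4 * (H + K) * (H + K))).
assert (he : 0 < eps) by (apply Rdiv_lt_0_compat; nra).
destruct (hl eps he) as [d [hd hb]].
destruct (pow_lt_1_zero (/ 2)) with (y := d / (H + K)) as [N hN].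
{ rewrite Rabs_pos_eq; lra. }
{ apply Rdiv_lt_0_compat; lra. }
specialize (hN N (le_n _)); rewrite Rabs_pos_eq in hN by (apply pow_le; lra).
rewrite pow_inv in hN.
apply (Rmult_lt_compat_l (H + K)) in hN; [|lra].
replace ((H + K) * (d / (H + K))) with d in hN by (field; lra).
assert (hs : H / 2 ^ N + K / 2 ^ N < d) by (unfold Rdiv; lra).
assert (hHN := hHn N); assert (hKN := hKn N).
destruct (inv N) as ((i1 & i2) & (i3 & i4) & i5 & _).
specialize (hx0 N); specialize (hy0 N).
assert (hloc := goursat_local G (x N) (y N) (H / 2 ^ N) (K / 2 ^ N) x0 y0 l eps).
assert (hRI : Cmod (RI G (x N) (y N) (H / 2 ^ N) (K / 2 ^ N)) <=
  2 * (H / 2 ^ N + K / 2 ^ N) * (eps * (H / 2 ^ N + K / 2 ^ N))).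
{ apply hloc; auto.
  - intros u v hu hv; apply hG; lra.
  - intros s t hs' ht'; apply hb; apply Rabs_def1; lra. }
replace (2 * (H / 2 ^ N + K / 2 ^ N) * (eps * (H / 2 ^ N + K / 2 ^ N))) with (T / 4 ^ N / 2) in hRI.
- assert (0 < T / 4 ^ N); [|lra]. apply Rdiv_lt_0_compat; [lra|apply pow_lt; lra].
- unfold eps; replace (4 ^ N) with (2 ^ N * 2 ^ N).
  + specialize (h2 N); field; repeat split; lra.
  + rewrite <- Rpow_mult_distr; f_equal; ring.
Qed.

(** * Fourier coefficients of holomorphic functions on an annulus *)

Definition Cdiff (f : C -> C) (z : C) : Prop :=
  ex_derive (K := C_AbsRing) (V := C_NormedModule) f z.

Lemma Cdiff_eps f z : Cdiff f z -> exists l, forall eps, 0 < eps -> exists d, 0 < d /\ forall z',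
  Cmod (z' - z)%C < d -> Cmod (f z' - f z - l * (z' - z))%C <= eps * Cmod (z' - z)%C.
Proof.
intros [l [_ h]]; exists l; intros eps he.
destruct (h z (fun P hP => hP) (mkposreal eps he)) as [d hd].
exists d; split; [apply d|]; intros z' hz'.
specialize (hd z' hz').
change (Cmod (f z' - f z - (z' - z) * l)%C <= eps * Cmod (z' - z)%C) in hd.
now rewrite (Cmult_comm l).
Qed.

Lemma Cdiff_has_Cderiv f x y : Cdiff f (x, y) -> has_Cderiv (fun s t => f (s, t)) x y.
Proof.
intros h; destruct (Cdiff_eps _ _ h) as [l hl]; exists l; intros eps he.
destruct (hl eps he) as [d [hd h']]; exists (d / 2); split; [lra|]; intros s t hs ht.
assert (e : ((s, t) - (x, y))%C = (s - x, t - y)) by (apply C_ext; simpl; ring).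
assert (hle := Cmod_le_sum (s - x, t - y)); unfold Re, Im in hle; simpl in hle.
specialize (h' (s, t)); rewrite e in h'; eapply Rle_trans; [apply h'; lra|].
apply Rmult_le_compat_l; lra.
Qed.

Definition circ (F : C -> C) (rho t : R) : C := F (RtoC rho * eit t)%C.

Lemma Cexp_pair s t : Cexp (s, t) = (RtoC (exp s) * eit t)%C.
Proof. unfold Cexp, eit; apply C_ext; simpl; ring. Qed.

Lemma Cmod_polar rho t : 0 <= rho -> Cmod (RtoC rho * eit t)%C = rho.
Proof. intros h; rewrite Cmod_mult, eit_mod, Cmod_R, Rabs_pos_eq by easy; ring. Qed.

Lemma Cdiff_Cexp_lin c z : Cdiff (fun z => Cexp (c * z)%C) z.
Proof.
apply (ex_derive_Ccomp Cexp (fun z => c * z)%C).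
- eexists; apply is_derive_Cexp.
- apply (ex_derive_Cmult (fun _ => c) (fun z => z)).
  + apply (ex_derive_const (K := C_AbsRing) (V := C_NormedModule)).
  + apply ex_derive_Cid.
Qed.

(** In the coordinate s + it = log z the annulus is a strip and circles are vertical segments. The
    second exponential is z^(-m), so integrating over a segment gives a Fourier coefficient. *)
Lemma has_Cderiv_strip F delta m s t : holomorphic_annulus delta F -> annulus delta (RtoC (exp s)) ->
  has_Cderiv (fun s t => F (Cexp (s, t)) * Cexp (RtoC (- IZR m) * (s, t)))%C s t.
Proof.
intros hF hs; apply (Cdiff_has_Cderiv (fun z => F (Cexp z) * Cexp (RtoC (- IZR m) * z))%C).
apply (ex_derive_Cmult (fun z => F (Cexp z))).
- apply (ex_derive_Ccomp F Cexp).
  + apply hF; unfold annulus in *; rewrite Cexp_pair, Cmod_polar.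
    * rewrite Cmod_R, Rabs_pos_eq in hs; [easy|left; apply exp_pos].
    * left; apply exp_pos.
  + eexists; apply is_derive_Cexp.
- apply Cdiff_Cexp_lin.
Qed.

Lemma strip_factor F m s t : (F (Cexp (s, t)) * Cexp (RtoC (- IZR m) * (s, t)))%C =
  (RtoC (exp (- IZR m * s)) * (circ F (exp s) t * em (- m) t))%C.
Proof.
replace (RtoC (- IZR m) * (s, t))%C with ((- IZR m * s, - IZR m * t) : C) by (apply C_ext; simpl; ring).
rewrite !Cexp_pair; unfold circ, em; rewrite opp_IZR; ring.
Qed.

Lemma RCc_circ F delta rho t : holomorphic_annulus delta F -> 0 < rho -> 1 - delta < rho < 1 + delta ->
  RCc (circ F rho) t.
Proof.
intros hF hr h.
assert (h1 : has_Cderiv (fun s t => F (Cexp (s, t)) * Cexp (RtoC (- IZR 0) * (s, t)))%C (ln rho) t).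
{ apply has_Cderiv_strip with delta; auto; unfold annulus.
  rewrite Cmod_R, exp_ln, Rabs_pos_eq; lra. }
apply has_Cderiv_c2 in h1; apply RCc_ext with (2 := h1); intros u.
rewrite strip_factor, exp_ln by easy; simpl; rewrite em_0.
replace (- 0 * ln rho) with 0 by ring; rewrite exp_0; ring.
Qed.

Lemma periodic_circ F rho : periodic (circ F rho).
Proof.
intros t; unfold circ; rewrite eit_plus; f_equal.
replace (eit (2 * PI)) with (RtoC 1); [ring|].
rewrite <- (eit_2PI 1); f_equal; ring.
Qed.

(** Goursat on the rectangle from [a] to [b] with height 2 PI: the horizontal sides cancel by
    periodicity, and the vertical ones are the two coefficients. *)
Lemma fourier_circ_exp F delta a b m : holomorphic_annulus delta F -> a < b ->
  1 - delta < exp a -> exp b < 1 + delta ->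
  (RtoC (exp (- IZR m * a)) * fourier (circ F (exp a)) m)%C =
  (RtoC (exp (- IZR m * b)) * fourier (circ F (exp b)) m)%C.
Proof.
intros hF hab ha hb.
set (G := fun s t => (F (Cexp (s, t)) * Cexp (RtoC (- IZR m) * (s, t)))%C).
assert (hr : forall s, a <= s <= b -> 1 - delta < exp s < 1 + delta).
{ intros s hs; split.
  - apply Rlt_le_trans with (1 := ha); destruct (Req_dec a s) as [->|]; [lra|left; apply exp_increasing; lra].
  - apply Rle_lt_trans with (2 := hb); destruct (Req_dec s b) as [->|]; [lra|left; apply exp_increasing; lra]. }
assert (hG : Cderiv_rect G a 0 (b - a) (2 * PI)).
{ intros s t hs _; apply has_Cderiv_strip with delta; auto; unfold annulus.
  rewrite Cmod_R, Rabs_pos_eq by (left; apply exp_pos); apply hr; lra. }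
assert (hz := goursat G a 0 (b - a) (2 * PI) ltac:(lra) two_PI_pos hG).
unfold RI in hz; rewrite Rplus_0_l in hz; replace (a + (b - a)) with b in hz by ring.
rewrite (CInt_ext (fun s => G s (2 * PI)) (fun s => G s 0)) in hz.
2: { intros s _; unfold G; rewrite !strip_factor.
     replace (2 * PI) with (0 + 2 * PI) by ring; now rewrite periodic_circ, periodic_em. }
assert (e : forall s, a <= s <= b ->
  mean (fun t => G s t) = (RtoC (exp (- IZR m * s)) * fourier (circ F (exp s)) m)%C).
{ intros s hs; unfold fourier; rewrite <- mean_scal.
  - apply mean_ext; intro t; apply strip_factor.
  - apply RCcont_mult; [|apply RCcont_em].
    intros t; apply RCc_circ with delta; auto. apply exp_pos. }
rewrite <- !e by lra; unfold mean; f_equal.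
set (A := CInt (fun t => G a t) 0 (2 * PI)) in *; set (B := CInt (fun t => G b t) 0 (2 * PI)) in *.
set (X := CInt (fun s => G s 0) a b) in *.
assert (h0 : (Ci * (B - A))%C = 0%C) by (rewrite <- hz; ring).
apply Cmult_integral in h0; destruct h0 as [h0|h0]; [injection h0; lra|].
replace B with (B - A + A)%C by ring; rewrite h0; ring.
Qed.

Lemma exp_IZR_pow (m : Z) (x : R) : (0 <= m)%Z -> exp (IZR m * x) = exp x ^ Z.abs_nat m.
Proof.
intros hm; rewrite <- (Z2Nat.id m) at 1 by easy; rewrite <- INR_IZR_INZ.
replace (Z.abs_nat m) with (Z.to_nat m) by lia.
induction (Z.to_nat m) as [|n ih]; [now rewrite Rmult_0_l, exp_0|].
rewrite S_INR, Rmult_plus_distr_r, exp_plus, ih, Rmult_1_l; simpl; ring.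
Qed.

Lemma fourier_circ_radius F delta r1 r2 m : holomorphic_annulus delta F ->
  0 < r1 -> 0 < r2 -> 1 - delta < r1 < 1 + delta -> 1 - delta < r2 < 1 + delta ->
  fourier (circ F r1) m = (RtoC (exp (IZR m * (ln r1 - ln r2))) * fourier (circ F r2) m)%C.
Proof.
intros hF h1 h2 k1 k2.
assert (e : (RtoC (exp (- IZR m * ln r1)) * fourier (circ F r1) m)%C =
  (RtoC (exp (- IZR m * ln r2)) * fourier (circ F r2) m)%C).
{ rewrite <- (exp_ln r1) at 2 by easy; rewrite <- (exp_ln r2) at 2 by easy.
  destruct (Rtotal_order r1 r2) as [h|[->|h]].
  - apply fourier_circ_exp with delta; try rewrite exp_ln; auto; try lra. now apply ln_increasing.
  - easy.
  - symmetry; apply fourier_circ_exp with delta; try rewrite exp_ln; auto; try lra.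
    now apply ln_increasing. }
replace (IZR m * (ln r1 - ln r2)) with (IZR m * ln r1 + - IZR m * ln r2) by ring.
rewrite exp_plus, RtoC_mult, <- Cmult_assoc, <- e, Cmult_assoc, <- RtoC_mult, <- exp_plus.
replace (IZR m * ln r1 + - IZR m * ln r1) with 0 by ring; rewrite exp_0; ring.
Qed.

(** Cauchy estimates: compare with the outer circle for m >= 0 and with the inner one for m < 0. The
    common ratio [q] gives decay in |m|. *)
Lemma fourier_circ_bound F delta r1 r2 r M q : holomorphic_annulus delta F ->
  0 < r1 -> 1 - delta < r1 -> r1 <= q * r -> r <= q * r2 -> r2 < 1 + delta -> 0 < q < 1 ->
  (forall m, Cmod (fourier (circ F r1) m) <= M) -> (forall m, Cmod (fourier (circ F r2) m) <= M) ->
  zgeo (fourier (circ F r)) M q.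
Proof.
intros hF h1 h2 h3 h4 h5 hq b1 b2 m.
assert (hr : r1 < r) by nra. assert (hr' : r < r2) by nra.
assert (key : forall x, 0 <= x -> x <= q -> x ^ Z.abs_nat m <= q ^ Z.abs_nat m)
  by (intros; apply pow_incr; lra).
assert (hM : 0 <= M) by (generalize (b1 0%Z) (Cmod_ge_0 (fourier (circ F r1) 0)); lra).
destruct (Z_le_dec 0 m) as [hm|hm].
- rewrite (fourier_circ_radius F delta r r2 m hF) by lra.
  rewrite Cmod_mult, Cmod_R, Rabs_pos_eq by (left; apply exp_pos).
  rewrite exp_IZR_pow by easy; rewrite Rmult_comm; apply Rmult_le_compat; auto using Cmod_ge_0.
  + apply pow_le; left; apply exp_pos.
  + apply key; [left; apply exp_pos|].
    unfold Rminus; rewrite exp_plus, exp_Ropp, !exp_ln by lra.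
    apply (Rmult_le_reg_r r2); [lra|]; rewrite Rmult_assoc, Rinv_l; lra.
- rewrite (fourier_circ_radius F delta r r1 m hF) by lra.
  rewrite Cmod_mult, Cmod_R, Rabs_pos_eq by (left; apply exp_pos).
  replace (IZR m * (ln r - ln r1)) with (IZR (- m) * (ln r1 - ln r)) by (rewrite opp_IZR; ring).
  rewrite exp_IZR_pow by lia; replace (Z.abs_nat (- m)) with (Z.abs_nat m) by lia.
  rewrite Rmult_comm; apply Rmult_le_compat; auto using Cmod_ge_0.
  + apply pow_le; left; apply exp_pos.
  + apply key; [left; apply exp_pos|].
    unfold Rminus; rewrite exp_plus, exp_Ropp, !exp_ln by lra.
    apply (Rmult_le_reg_r r); [lra|]; rewrite Rmult_assoc, Rinv_l; lra.
Qed.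

Lemma fourier_bounded phi : RCcont phi -> exists M, 0 <= M /\ forall m, Cmod (fourier phi m) <= M.
Proof.
intros h; assert (hp := two_PI_pos); assert (hi := Rinv_0_lt_compat _ hp).
assert (hb : forall m, Cmod (fourier phi m) <= / (2 * PI) * RInt (fun t => Cmod (phi t)) 0 (2 * PI)).
{ intros m; unfold fourier, mean; rewrite Cmod_mult, Cmod_R, Rabs_pos_eq by lra.
  apply Rmult_le_compat_l; [lra|]; apply CInt_le; [lra| | |].
  - apply RCcont_on, RCcont_mult; auto using RCcont_em.
  - intros; now apply continuous_Cmod.
  - intros; rewrite Cmod_mult, em_mod; lra. }
eexists; split; [|exact hb].
eapply Rle_trans; [apply Cmod_ge_0|apply (hb 0%Z)].
Qed.

(** * Compact sets of the plane *)

Lemma Cmod_ball (z w : C) d : ball z d w -> Cmod (w - z)%C < 2 * d.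
Proof.
intros [h1 h2]; eapply Rle_lt_trans; [apply Cmod_le_sum|].
change (Rabs (Re w - Re z) < d) in h1; change (Rabs (Im w - Im z) < d) in h2.
unfold Re, Im, Rminus in *; simpl; lra.
Qed.

Lemma ball_Cmod (z w : C) d : Cmod (w - z)%C < d -> ball z d w.
Proof.
intros h; split.
- change (Rabs (Re w - Re z) < d); apply Rle_lt_trans with (2 := h), Rle_trans with (2 := Cmod_Re _).
  unfold Re, Rminus; simpl; lra.
- change (Rabs (Im w - Im z) < d); apply Rle_lt_trans with (2 := h), Rle_trans with (2 := Cmod_Im _).
  unfold Im, Rminus; simpl; lra.
Qed.

Lemma open_C (U : C -> Prop) : (forall z, U z -> exists d, 0 < d /\ forall w, Cmod (w - z)%C < d -> U w) -> open U.
Proof.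
intros h z hz; destruct (h z hz) as [d [hd h']].
assert (hd2 : 0 < d / 2) by lra.
exists (mkposreal _ hd2); intros w hw; apply h'; apply Cmod_ball in hw; simpl in hw; lra.
Qed.

Lemma open_C_inv (U : C -> Prop) z : open U -> U z -> exists d, 0 < d /\ forall w, Cmod (w - z)%C < d -> U w.
Proof.
intros h hz; destruct (h z hz) as [d hd]; exists d; split; [apply d|].
intros w hw; apply hd, ball_Cmod, hw.
Qed.

Lemma Cmod_diff_bound (z w : C) : Rabs (Cmod w - Cmod z) <= Cmod (w - z)%C.
Proof.
apply Rabs_le; split.
- generalize (Cmod_triangle w (z - w)%C); replace (w + (z - w))%C with z by ring.
  rewrite <- (Cmod_opp (z - w)); replace (- (z - w))%C with (w - z)%C by ring; lra.
- generalize (Cmod_triangle z (w - z)%C); replace (z + (w - z))%C with w by ring; lra.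
Qed.

(** Heine-Borel through the supremum of the points up to which finitely many members suffice. The
    cover is local around every real t, as the parametrisation of a circle supplies it. *)
Lemma interval_compact (a b : R) (I : Type) (U : I -> R -> Prop) : a <= b ->
  (forall t, exists i d, 0 < d /\ forall u, Rabs (u - t) < d -> U i u) ->
  exists l : list I, forall t, a <= t <= b -> exists i, In i l /\ U i t.
Proof.
intros hab hc.
set (E x := a <= x <= b /\ exists l : list I, forall t, a <= t <= x -> exists i, In i l /\ U i t).
assert (ha : E a).
{ split; [lra|]. destruct (hc a) as (i & d & hd & h); exists (i :: nil); intros t ht; exists i; split; [now left|].
  apply h; replace (t - a) with 0 by lra; rewrite Rabs_R0; easy. }
destruct (completeness E) as [c [h1 h2]].
{ exists b; intros x [hx _]; lra. }
{ now exists a. }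
assert (hac : a <= c) by now apply h1.
assert (hcb : c <= b) by (apply h2; intros x [hx _]; lra).
destruct (hc c) as (i & d & hd & h).
assert (hx : exists x, E x /\ c - d < x).
{ apply NNPP; intros hn; assert (c <= c - d); [|lra]. apply h2; intros x hx.
  apply Rnot_lt_le; intros hl; apply hn; now exists x. }
destruct hx as (x & [hx [l hl]] & hxd).
assert (hE : E (Rmin b (c + d / 2))).
{ split.
  - split; [apply Rmin_glb; lra|apply Rmin_l].
  - exists (i :: l); intros t ht; assert (hr := Rmin_r b (c + d / 2)).
    destruct (Rle_dec t x) as [htx|htx].
    + destruct (hl t ltac:(lra)) as [j [hj1 hj2]]; exists j; split; [now right|easy].
    + exists i; split; [now left|]; apply h, Rabs_def1; lra. }
assert (hle := h1 _ hE).
destruct hE as [_ [l' hl']]; exists l'; intros t ht; apply hl'; split; [lra|].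
revert hle; unfold Rmin; destruct (Rle_dec b (c + d / 2)); lra.
Qed.

Lemma polar_form z : exists t, - PI <= t <= PI /\ z = (RtoC (Cmod z) * eit t)%C.
Proof.
exists (Carg z); split; [generalize (Carg_bounds z); lra|].
rewrite (Carg_polar z) at 1; now rewrite Cexp_Ci.
Qed.

Lemma eit_lip s t : Cmod (eit s - eit t)%C <= 2 * Rabs (s - t).
Proof.
assert (hr : forall f df : R -> R, (forall x, is_derive f x (df x)) -> (forall x, Rabs (df x) <= 1) ->
  Rabs (f s - f t) <= Rabs (s - t)).
{ intros f df hd hb.
  destruct (MVT_gen f t s df) as [c [_ hc]].
  - intros; apply hd.
  - intros x _; apply derivable_continuous_pt; exists (df x); apply is_derive_Reals, hd.
  - rewrite hc, Rabs_mult; generalize (hb c) (Rabs_pos (s - t)); nra. }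
eapply Rle_trans; [apply Cmod_le_sum|].
assert (h1 := hr cos (fun x => - sin x)); assert (h2 := hr sin cos).
unfold Re, Im, eit, Rminus in *; simpl.
assert (Rabs (cos s + - cos t) <= Rabs (s + - t)).
{ apply h1; intros x; [auto_derive; [easy|ring]|]. rewrite Rabs_Ropp; apply Rabs_le; generalize (SIN_bound x); lra. }
assert (Rabs (sin s + - sin t) <= Rabs (s + - t)).
{ apply h2; intros x; [auto_derive; [easy|ring]|]. apply Rabs_le; generalize (COS_bound x); lra. }
lra.
Qed.

Lemma compact_circle rho : 0 <= rho -> compact_C (fun z => Cmod z = rho).
Proof.
intros hr I U hU hc.
destruct (interval_compact (- PI) PI I (fun i t => U i (RtoC rho * eit t)%C)) as [l hl].
- generalize PI_RGT_0; lra.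
- intros t; destruct (hc (RtoC rho * eit t)%C) as [i hi]; [now apply Cmod_polar|].
  destruct (open_C_inv _ _ (hU i) hi) as [d [hd h]]; exists i, (d / (2 * rho + 1)); split.
  { apply Rdiv_lt_0_compat; lra. }
  intros u hu; apply h.
  replace (rho * eit u - rho * eit t)%C with (rho * (eit u - eit t))%C by ring.
  rewrite Cmod_mult, Cmod_R, Rabs_pos_eq by easy.
  assert (hl := eit_lip u t).
  apply (Rmult_lt_compat_l (2 * rho + 1)) in hu; [|lra].
  replace ((2 * rho + 1) * (d / (2 * rho + 1))) with d in hu by (field; lra).
  generalize (Rabs_pos (u - t)); nra.
- exists l; intros z hz; destruct (polar_form z) as [t [ht e]]; rewrite hz in e; rewrite e; auto.
Qed.

Lemma compact_union K1 K2 : compact_C K1 -> compact_C K2 -> compact_C (fun z => K1 z \/ K2 z).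
Proof.
intros h1 h2 I U hU hc.
destruct (h1 I U hU) as [l1 k1]; [auto|]; destruct (h2 I U hU) as [l2 k2]; [auto|].
exists (l1 ++ l2); intros z [hz|hz]; [destruct (k1 z hz) as [i hi]|destruct (k2 z hz) as [i hi]];
  exists i; rewrite in_app_iff; tauto.
Qed.

(** The cover is indexed by the radii: the member for [d] is the interior of the set where [P d]
    holds, and a finite subcover has a least radius. It turns pointwise-local estimates into
    estimates uniform on [K]. *)
Lemma compact_unif (K : C -> Prop) (P : R -> C -> Prop) : compact_C K ->
  (forall d d' z, d' <= d -> P d z -> P d' z) ->
  (forall z, K z -> exists d e, 0 < d /\ 0 < e /\ forall w, Cmod (w - z)%C < e -> P d w) ->
  exists d, 0 < d /\ forall z, K z -> P d z.
Proof.
intros hK hmono hloc.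
destruct (hK {d : R | 0 < d} (fun d z => exists e, 0 < e /\ forall w, Cmod (w - z)%C < e -> P (proj1_sig d) w)) as [l hl].
- intros d; apply open_C; intros z [e [he h]]; exists (e / 2); split; [lra|]; intros w hw.
  exists (e / 2); split; [lra|]; intros v hv; apply h.
  replace (v - z)%C with ((v - w) + (w - z))%C by ring.
  eapply Rle_lt_trans; [apply Cmod_triangle|lra].
- intros z hz; destruct (hloc z hz) as (d & e & hd & he & h); exists (exist _ d hd), e; auto.
- assert (hmin : exists d, 0 < d /\ forall x, In x l -> d <= proj1_sig x).
  { clear; induction l as [|[x hx] l [d [hd h]]].
    - exists 1; split; [lra|intros x []].
    - exists (Rmin x d); split; [now apply Rmin_pos|]; intros y [<-|hy]; [apply Rmin_l|].
      eapply Rle_trans; [apply Rmin_r|auto]. }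
  destruct hmin as [d [hd h]]; exists d; split; auto; intros z hz.
  destruct (hl z hz) as [i [hi [e [he hP]]]]; apply hmono with (proj1_sig i); auto.
  apply hP; replace (z - z)%C with (RtoC 0) by ring; now rewrite Cmod_0.
Qed.

Lemma compact_annulus_margin K delta : compact_C K -> (forall z, K z -> annulus delta z) ->
  exists eta, 0 < eta /\ forall z, K z -> 1 - delta + eta < Cmod z < 1 + delta - eta.
Proof.
intros hK hA; apply (compact_unif K (fun eta z => 1 - delta + eta < Cmod z < 1 + delta - eta)); auto.
- intros; lra.
- intros z hz; specialize (hA z hz); unfold annulus in hA.
  set (g := Rmin (Cmod z - (1 - delta)) (1 + delta - Cmod z)).
  assert (hg : 0 < g) by (apply Rmin_pos; lra).
  assert (g1 := Rmin_l (Cmod z - (1 - delta)) (1 + delta - Cmod z)); fold g in g1.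
  assert (g2 := Rmin_r (Cmod z - (1 - delta)) (1 + delta - Cmod z)); fold g in g2.
  exists (g / 2), (g / 2); repeat split; try lra.
  + assert (h := Cmod_diff_bound z w); generalize (Rabs_maj2 (Cmod w - Cmod z)); lra.
  + assert (h := Cmod_diff_bound z w); generalize (Rle_abs (Cmod w - Cmod z)); lra.
Qed.

(** * Analytic functionals and their moments *)

Lemma Cdiff_const c z : Cdiff (fun _ => c) z.
Proof. apply (ex_derive_const (K := C_AbsRing) (V := C_NormedModule)). Qed.

Lemma Cdiff_plus f g z : Cdiff f z -> Cdiff g z -> Cdiff (fun w => f w + g w)%C z.
Proof. apply (ex_derive_plus (K := C_AbsRing) (V := C_NormedModule)). Qed.

Lemma Cdiff_mult f g z : Cdiff f z -> Cdiff g z -> Cdiff (fun w => f w * g w)%C z.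
Proof. apply ex_derive_Cmult. Qed.

Lemma Cdiff_scal c f z : Cdiff f z -> Cdiff (fun w => c * f w)%C z.
Proof. intros; apply Cdiff_mult; [apply Cdiff_const|easy]. Qed.

Lemma Cdiff_ext f g z : (forall w, f w = g w) -> Cdiff f z -> Cdiff g z.
Proof. intros e h; rewrite <- (functional_extensionality _ _ e); exact h. Qed.

Lemma Cdiff_lincomb a b f g z : Cdiff f z -> Cdiff g z -> Cdiff (fun w => a * f w + b * g w)%C z.
Proof. intros; apply Cdiff_plus; now apply Cdiff_scal. Qed.

Lemma holo_restrict d d' F : d' <= d -> holomorphic_annulus d F -> holomorphic_annulus d' F.
Proof. intros h hF z hz; apply hF; unfold annulus in *; lra. Qed.

Definition powz (z : C) (m : Z) : C :=
  if Z_le_dec 0 m then (z ^ Z.abs_nat m)%C else ((/ z) ^ Z.abs_nat m)%C.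

Lemma pow_polar rho t n : ((RtoC rho * eit t) ^ n)%C = (RtoC (rho ^ n) * eit (INR n * t))%C.
Proof.
induction n as [|n ih].
- simpl; rewrite Rmult_0_l, eit_0; ring.
- rewrite S_INR, Rmult_plus_distr_r, Rmult_1_l, eit_plus, Cpow_S, ih; simpl pow; rewrite RtoC_mult; ring.
Qed.

Lemma eit_neq_0 t : eit t <> 0%C.
Proof. intros e; assert (h := eit_mod t); rewrite e, Cmod_0 in h; lra. Qed.

Lemma inv_polar rho t : 0 < rho -> (/ (RtoC rho * eit t))%C = (RtoC (/ rho) * eit (- t))%C.
Proof.
intros h; assert (h1 := eit_neq_0 t); assert (h2 : RtoC rho <> 0) by (intros e; apply RtoC_inj in e; lra).
assert (e : (eit t * eit (- t))%C = 1%C) by (rewrite <- eit_plus, Rplus_opp_r; apply eit_0).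
assert (e' : eit (- t) = (/ eit t)%C).
{ replace (eit (- t)) with (/ eit t * (eit t * eit (- t)))%C by (field; easy). rewrite e; ring. }
rewrite e', RtoC_inv by lra; field; auto.
Qed.

Lemma powz_polar rho t m : 0 < rho ->
  powz (RtoC rho * eit t) m = (RtoC (exp (IZR m * ln rho)) * em m t)%C.
Proof.
intros h; unfold powz, em; destruct (Z_le_dec 0 m) as [hm|hm].
- rewrite pow_polar, exp_IZR_pow, exp_ln by easy; do 2 f_equal; f_equal.
  rewrite INR_IZR_INZ; f_equal; lia.
- rewrite inv_polar, pow_polar by easy.
  replace (IZR m * ln rho) with (IZR (- m) * ln (/ rho)) by (rewrite opp_IZR, ln_Rinv by easy; ring).
  rewrite exp_IZR_pow, exp_ln by (try lia; now apply Rinv_0_lt_compat).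
  replace (Z.abs_nat (- m)) with (Z.abs_nat m) by lia; do 2 f_equal.
  replace (INR (Z.abs_nat m)) with (- IZR m); [ring|].
  rewrite INR_IZR_INZ, <- opp_IZR; f_equal; lia.
Qed.

Lemma powz_mod z m q : 0 < q < 1 -> q <= Cmod z <= / q -> Cmod (powz z m) <= (/ q) ^ Z.abs_nat m.
Proof.
intros hq hz; unfold powz; assert (hz0 : z <> 0) by (apply Cmod_gt_0; lra).
destruct (Z_le_dec 0 m); rewrite Cmod_pow; apply pow_incr; split; try apply Cmod_ge_0; try easy.
rewrite Cmod_inv by easy; apply Rinv_le_contravar; lra.
Qed.

Lemma powz_Cdiff (z : C) m : z <> RtoC 0 -> Cdiff (fun z => powz z m) z.
Proof.
intros hz; unfold powz; destruct (Z_le_dec 0 m).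
- apply (ex_derive_Cpow (fun z => z)), ex_derive_Cid.
- apply (ex_derive_Cpow Cinv); exact (ex_derive_Cinv z hz).
Qed.

Definition mkH (F : C -> C) (d : R) (hd : 0 < d) (hF : holomorphic_annulus d F) : Hcircle :=
  exist _ (fun xi : circle => F xi)
    (ex_intro _ d (conj hd (ex_intro _ F (conj hF (fun xi => eq_refl))))).

(** The cap 1/2 keeps the annulus away from 0, so that all powers of z are holomorphic on it. *)
Lemma Hcircle_ext (g : Hcircle) : exists d F, 0 < d <= 1 / 2 /\ holomorphic_annulus d F /\
  forall xi : circle, F xi = g xi.
Proof.
destruct g as [g (d & hd & F & hF & e)].
exists (Rmin d (1 / 2)), F; split; [|split; [|easy]].
- split; [apply Rmin_pos; lra|apply Rmin_r].
- apply holo_restrict with (2 := hF), Rmin_l.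
Qed.

Definition circle_pt (t : R) : circle := exist _ (eit t) (eit_mod t).

Lemma af_ext (nu : analytic_functional) (g h : Hcircle) : (forall xi, g xi = h xi) -> nu g = nu h.
Proof.
intros e; rewrite (af_linear nu 1 0 h h g); [ring|]. intros xi; rewrite e; ring.
Qed.

Lemma holo_0 : holomorphic_annulus 1 (fun _ => RtoC 0).
Proof. intros z _; apply Cdiff_const. Qed.

Definition Hcircle_zero : Hcircle := mkH _ 1 Rlt_0_1 holo_0.

Lemma af_0 (nu : analytic_functional) (g : Hcircle) : (forall xi, g xi = 0%C) -> nu g = 0%C.
Proof.
intros h; rewrite (af_linear nu 0 0 g g g); [ring|]. intros xi; rewrite h; ring.
Qed.

(** Continuity at 0, unfolded for one annulus. The topology enters the estimates of a given
    functional through this compact set and this tolerance. *)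
Lemma af_bound (nu : analytic_functional) d eps : 0 < d -> 0 < eps ->
  exists K e, compact_C K /\ (forall z, K z -> annulus d z) /\ 0 < e /\
  forall F (g : Hcircle), holomorphic_annulus d F -> (forall xi : circle, F xi = g xi) ->
    (forall z, K z -> Cmod (F z) < e) -> Cmod (nu g) < eps.
Proof.
intros hd he; destruct (af_continuous nu Hcircle_zero eps he) as (W & _ & hW & hU).
destruct (hW d hd) as (K & e & hK & hA & he' & h); exists K, e; split; [easy|split; [easy|split; [easy|]]].
intros F g hF hg hF0; assert (h3 := hU g (h F hF hF0 g hg) g).
rewrite (af_0 nu Hcircle_zero) in h3 by easy.
replace (nu g) with (nu g - 0)%C by ring; apply h3; intros xi; simpl; ring.
Qed.

Lemma annulus_pos d z : d <= 1 / 2 -> annulus d z -> 0 < Cmod z /\ z <> RtoC 0.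
Proof. intros h [h1 h2]; split; [lra|]; apply Cmod_gt_0; lra. Qed.

Lemma holo_powz m : holomorphic_annulus (1 / 2) (fun z => powz z m).
Proof. intros z hz; apply powz_Cdiff; apply (annulus_pos (1 / 2)); [lra|easy]. Qed.

Lemma half_pos : 0 < 1 / 2.
Proof. lra. Qed.

Definition mono (m : Z) : Hcircle := mkH _ (1 / 2) half_pos (holo_powz m).

(** The Laurent coefficients of a holomorphic extension, read off on the unit circle and hence
    independent of the extension. *)
Definition gcoef (g : Hcircle) (m : Z) : C := fourier (fun t => g (circle_pt t)) m.

Lemma gcoef_circ (F : C -> C) (g : Hcircle) m : (forall xi : circle, F xi = g xi) -> gcoef g m = fourier (circ F 1) m.
Proof.
intros h; apply fourier_ext; intros t; rewrite <- h; unfold circ; simpl; f_equal; ring.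
Qed.

Lemma RCcont_circ F d r : holomorphic_annulus d F -> 0 < r -> 1 - d < r < 1 + d -> RCcont (circ F r).
Proof. intros hF h1 h2 t; now apply RCc_circ with d. Qed.

Lemma RCcont_H (g : Hcircle) : RCcont (fun t => g (circle_pt t)).
Proof.
destruct (Hcircle_ext g) as (d & F & hd & hF & e); intros t.
apply RCc_ext with (circ F 1).
- intros u; rewrite <- e; unfold circ; simpl; f_equal; ring.
- apply RCcont_circ with d; auto; lra.
Qed.

(** One ratio serves both circles because (1 - d/2) (1 + d/2) <= 1. *)
Lemma circ_radii d : 0 < d <= 1 / 2 -> let q := / (1 + d / 2) in
  0 < q < 1 /\ 1 - d < 1 - d / 2 <= q * 1 /\ 1 <= q * (1 + d / 2) /\ 1 + d / 2 < 1 + d /\ 0 < 1 - d / 2.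
Proof.
intros hd q; unfold q.
assert (h : / (1 + d / 2) * (1 + d / 2) = 1) by (field; lra).
assert (h0 : 0 < / (1 + d / 2)) by (apply Rinv_0_lt_compat; lra).
repeat split; try nra.
Qed.

Lemma gcoef_geo (g : Hcircle) : exists M q, 0 < q < 1 /\ zgeo (gcoef g) M q.
Proof.
destruct (Hcircle_ext g) as (d & F & hd & hF & e).
destruct (circ_radii d hd) as (h1 & h2 & h3 & h4 & h5); set (q := / (1 + d / 2)) in *.
destruct (fourier_bounded (circ F (1 - d / 2))) as [M1 [p1 b1]].
{ apply RCcont_circ with d; auto; lra. }
destruct (fourier_bounded (circ F (1 + d / 2))) as [M2 [p2 b2]].
{ apply RCcont_circ with d; auto; lra. }
exists (M1 + M2), q; split; [easy|].
intros m; rewrite (gcoef_circ F) by easy.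
apply (fourier_circ_bound F d (1 - d / 2) (1 + d / 2) 1); auto; try lra.
- intros k; specialize (b1 k); lra.
- intros k; specialize (b2 k); lra.
Qed.

(** Subexponential growth: the two-sided sequences that occur as moments of analytic functionals. *)
Definition zsub (c : Z -> C) : Prop :=
  forall q, 0 < q < 1 -> exists M, forall m, Cmod (c m) * q ^ Z.abs_nat m <= M.

(** Write q^|m| as the square of sqrt(q)^|m|: one factor absorbs the growth of [c], the other
    remains as decay. *)
Lemma zgeo_zsub u c M q : 0 < q < 1 -> zgeo u M q -> zsub c ->
  exists M', zgeo (fun m => u m * c m)%C M' (sqrt q) /\ 0 < sqrt q < 1.
Proof.
intros hq hu hc.
assert (hs : 0 < sqrt q < 1).
{ split; [apply sqrt_lt_R0; lra|]. rewrite <- sqrt_1; apply sqrt_lt_1; lra. }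
destruct (hc (sqrt q) hs) as [B hB]; exists (M * B); split; [|easy].
intros m; rewrite Cmod_mult; specialize (hu m); specialize (hB m).
assert (e : q ^ Z.abs_nat m = sqrt q ^ Z.abs_nat m * sqrt q ^ Z.abs_nat m).
{ rewrite <- Rpow_mult_distr, sqrt_sqrt; lra. }
assert (hp : 0 < sqrt q ^ Z.abs_nat m) by (apply pow_lt; lra).
set (x := sqrt q ^ Z.abs_nat m) in *; rewrite e in hu.
assert (h1 := Cmod_ge_0 (u m)); assert (h2 := Cmod_ge_0 (c m)).
apply Rle_trans with (M * (x * x) * Cmod (c m)); [now apply Rmult_le_compat_r|].
replace (M * (x * x) * Cmod (c m)) with ((M * x) * (Cmod (c m) * x)) by ring.
replace (M * B * x) with ((M * x) * B) by ring.
apply Rmult_le_compat_l; [|easy].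
assert (0 <= M * x * x) by (generalize (Rle_trans _ _ _ h1 hu); lra). nra.
Qed.

(** On the annulus of width (1 - q) / 2 one has |z^m| <= q^(-|m|), so a suitable multiple of q^|m|
    z^m stays within the tolerance of [nu]. *)
Lemma af_moments_sub (nu : analytic_functional) : zsub (fun m => nu (mono m)).
Proof.
intros q hq.
assert (hd : 0 < (1 - q) / 2 <= 1 / 2) by lra.
destruct (af_bound nu ((1 - q) / 2) 1) as (K & e & hK & hA & he & h); try lra.
exists (2 / e); intros m.
set (p := q ^ Z.abs_nat m).
assert (hp : 0 < p) by (apply pow_lt; lra).
(* The factor [p] normalises the monomial; the half makes the bound by [e] strict. *)
set (c := RtoC (e / 2 * p)).
assert (hF : holomorphic_annulus ((1 - q) / 2) (fun z => c * powz z m)%C).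
{ intros z hz; apply Cdiff_scal, powz_Cdiff; apply (annulus_pos ((1 - q) / 2)); [lra|easy]. }
set (g := mkH _ _ (proj1 hd) hF).
assert (hg : Cmod (nu g) < 1).
{ apply (h (fun z => c * powz z m)%C g); auto.
  intros z hz; specialize (hA z hz); unfold annulus in hA.
  rewrite Cmod_mult; unfold c; rewrite Cmod_R, Rabs_pos_eq by nra.
  assert (hz2 : Cmod (powz z m) <= (/ q) ^ Z.abs_nat m).
  { apply powz_mod; auto; split; [lra|].
    apply (Rmult_le_reg_l q); [lra|]; rewrite Rinv_r by lra. nra. }
  rewrite pow_inv in hz2; fold p in hz2.
  apply Rle_lt_trans with (e / 2 * p * / p).
  - apply Rmult_le_compat_l; [nra|easy].
  - rewrite Rmult_assoc, Rinv_r; lra. }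
assert (e1 : nu g = (c * nu (mono m))%C).
{ rewrite (af_linear nu c 0 (mono m) (mono m) g); [ring|]. intros xi; simpl; ring. }
rewrite e1, Cmod_mult in hg; unfold c in hg; rewrite Cmod_R, Rabs_pos_eq in hg by nra.
apply (Rmult_le_reg_l (e / 2)); [lra|].
replace (e / 2 * (2 / e)) with 1 by (field; lra). fold p; nra.
Qed.

Lemma holo_Zpart (c : Z -> C) d N : d <= 1 / 2 ->
  holomorphic_annulus d (fun z => Zpart (fun m => c m * powz z m)%C N).
Proof.
intros hd z hz.
assert (h : forall m, Cdiff (fun z => c m * powz z m)%C z).
{ intros m; apply Cdiff_scal, powz_Cdiff, (annulus_pos d); auto. }
induction N as [|N ih]; cbn [Zpart].
- apply h.
- apply Cdiff_plus; [apply ih|apply Cdiff_plus; apply h].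
Qed.

Lemma af_Zpart (nu : analytic_functional) c N (g : Hcircle) :
  (forall xi : circle, g xi = Zpart (fun m => c m * powz xi m)%C N) ->
  nu g = Zpart (fun m => c m * nu (mono m))%C N.
Proof.
revert g; induction N as [|N ih]; intros g hg.
- rewrite (af_linear nu (c 0%Z) 0 (mono 0) (mono 0)); [simpl; ring|].
  intros xi; rewrite hg; simpl; ring.
- set (g1 := mkH _ _ half_pos (holo_Zpart c (1 / 2) N (Rle_refl _))).
  set (k := Z.of_nat (S N)).
  assert (hF : holomorphic_annulus (1 / 2) (fun z => c k * powz z k + c (- k)%Z * powz z (- k))%C).
  { intros z hz; apply Cdiff_lincomb; apply powz_Cdiff; apply (annulus_pos (1 / 2)); auto; lra. }
  set (g2 := mkH _ _ half_pos hF).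
  rewrite (af_linear nu 1 1 g1 g2 g), (ih g1), (af_linear nu (c k) (c (- k)%Z) (mono k) (mono (- k)) g2).
  + cbn [Zpart]; fold k; ring.
  + intros xi; reflexivity.
  + intros xi; reflexivity.
  + intros xi; rewrite hg; cbn [Zpart]; fold k; simpl; ring.
Qed.

(** [K] keeps a positive distance from the boundary of the annulus, so the Cauchy estimates on all
    circles that meet [K] use the same two radii and the same ratio. *)
Lemma laurent_tail F d K : 0 < d <= 1 / 2 -> holomorphic_annulus d F -> compact_C K ->
  (forall z, K z -> annulus d z) -> exists M q, 0 < q < 1 /\ forall N z, K z ->
  Cmod (F z - Zpart (fun m => fourier (circ F 1) m * powz z m) N)%C <= ztail M q N.
Proof.
intros hd hF hK hA; destruct (compact_annulus_margin K d hK hA) as [eta0 [heta0 hmar0]].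
set (eta := Rmin eta0 (d / 2)).
assert (heta : 0 < eta) by (apply Rmin_pos; lra).
assert (heta1 := Rmin_r eta0 (d / 2)); assert (heta2 := Rmin_l eta0 (d / 2)); fold eta in heta1, heta2.
set (r1 := 1 - d + eta / 2); set (r2 := 1 + d - eta / 2).
destruct (fourier_bounded (circ F r1)) as [M1 [p1 b1]].
{ apply RCcont_circ with d; auto; unfold r1; lra. }
destruct (fourier_bounded (circ F r2)) as [M2 [p2 b2]].
{ apply RCcont_circ with d; auto; unfold r2; lra. }
(* Points of [K] are at distance at least eta / 2 from both radii, while multiplying a radius below
   2 by [q] moves it by less than eta / 2. *)
set (q := 1 - eta / 4).
exists (M1 + M2), q; split; [unfold q; lra|].
intros N z hz; specialize (hmar0 z hz).
destruct (polar_form z) as [t [_ ez]]; set (r := Cmod z) in *.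
assert (hgeo : zgeo (fourier (circ F r)) (M1 + M2) q).
{ apply (fourier_circ_bound F d r1 r2 r); auto; unfold r1, r2, q in *; try lra; try nra.
  - intros k; specialize (b1 k); unfold r1 in b1; lra.
  - intros k; specialize (b2 k); unfold r2 in b2; lra. }
assert (hq : 0 <= q < 1) by (unfold q; lra).
assert (hi := fourier_inversion (circ F r) (M1 + M2) q (periodic_circ F r)
  (RCcont_circ F d r hF ltac:(lra) ltac:(lra)) hq hgeo t).
rewrite ez; change (F (RtoC r * eit t)%C) with (circ F r t); rewrite hi.
rewrite (Zpart_ext _ (fun m => fourier (circ F r) m * em m t)%C).
- apply Zlim_tail; auto using zgeo_em.
- intros m; rewrite powz_polar by lra.
  rewrite (fourier_circ_radius F d r 1 m hF) by lra.
  rewrite ln_1, Rminus_0_r; ring.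
Qed.

(** Laurent partial sums converge uniformly on the compact set that controls [nu], so [nu] may be
    applied term by term. In particular the moments determine [nu]. *)
Lemma af_expand (nu : analytic_functional) (g : Hcircle) :
  nu g = Zlim (fun m => gcoef g m * nu (mono m))%C.
Proof.
symmetry; apply Zlim_eq; intros eps he.
destruct (Hcircle_ext g) as (d & F & hd & hF & e).
destruct (af_bound nu d eps) as (K & e0 & hK & hA & he0 & h); try lra.
destruct (laurent_tail F d K hd hF hK hA) as (M & q & hq & htl).
destruct (ztail_small M q ltac:(lra) e0 he0) as [N0 hN0].
exists N0; intros N hN; specialize (hN0 N hN).
set (c := fourier (circ F 1)).
set (FN := fun z => Zpart (fun m => c m * powz z m)%C N).
assert (hFN : holomorphic_annulus d FN) by (apply holo_Zpart; lra).
assert (hD : holomorphic_annulus d (fun z => 1 * F z + (-1) * FN z)%C).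
{ intros z hz; apply Cdiff_lincomb; [now apply hF|now apply hFN]. }
set (gN := mkH FN d (proj1 hd) hFN); set (gD := mkH _ d (proj1 hd) hD).
assert (e1 : nu gD = (nu g - nu gN)%C).
{ rewrite (af_linear nu 1 (-1) g gN gD); [ring|]. intros xi; simpl; now rewrite e. }
assert (e2 : nu gN = Zpart (fun m => gcoef g m * nu (mono m))%C N).
{ rewrite (af_Zpart nu c N gN) by easy; apply Zpart_ext; intros m; unfold c; now rewrite (gcoef_circ F). }
rewrite <- e2, <- e1; apply (h _ gD hD); [easy|].
intros z hz; eapply Rle_lt_trans; [|exact hN0].
replace (1 * F z + -1 * FN z)%C with (F z - FN z)%C by ring; apply htl, hz.
Qed.

Lemma gcoef_lincomb a b g1 g2 h m : lincomb a b g1 g2 h -> gcoef h m = (a * gcoef g1 m + b * gcoef g2 m)%C.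
Proof.
intros hl; unfold gcoef; assert (h1 := RCcont_H g1); assert (h2 := RCcont_H g2).
rewrite <- !fourier_scal, <- fourier_plus; auto.
- apply fourier_ext; intro t; apply hl.
- apply RCcont_mult; auto; intro; apply RCc_const.
- apply RCcont_mult; auto; intro; apply RCc_const.
Qed.

(** * Functionals with prescribed moments *)

Definition af_sum (c : Z -> C) (g : Hcircle) : C := Zlim (fun m => gcoef g m * c m)%C.

Lemma zgeo_scal k u M q : zgeo u M q -> zgeo (fun m => k * u m)%C (Cmod k * M) q.
Proof.
intros h m; rewrite Cmod_mult, Rmult_assoc; apply Rmult_le_compat_l; [apply Cmod_ge_0|apply h].
Qed.

Lemma af_sum_linear c : zsub c -> forall a b g1 g2 h, lincomb a b g1 g2 h ->
  af_sum c h = (a * af_sum c g1 + b * af_sum c g2)%C.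
Proof.
intros hc a b g1 g2 h hl; unfold af_sum.
destruct (gcoef_geo g1) as (M1 & q1 & hq1 & h1); destruct (gcoef_geo g2) as (M2 & q2 & hq2 & h2).
destruct (zgeo_zsub _ _ _ _ hq1 h1 hc) as (M1' & k1 & hs1).
destruct (zgeo_zsub _ _ _ _ hq2 h2 hc) as (M2' & k2 & hs2).
assert (hs1' : 0 <= sqrt q1 < 1) by lra; assert (hs2' : 0 <= sqrt q2 < 1) by lra.
rewrite <- (Zlim_scal a _ _ _ hs1' k1), <- (Zlim_scal b _ _ _ hs2' k2).
rewrite <- (Zlim_plus _ _ _ _ _ _ hs1' (zgeo_scal a _ _ _ k1) hs2' (zgeo_scal b _ _ _ k2)).
apply Zlim_ext; intros m; rewrite (gcoef_lincomb a b g1 g2 h m hl); ring.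
Qed.

(** Smallness on the two circles of radii 1 - d/2 and 1 + d/2 already bounds every Laurent
    coefficient geometrically, and subexponential growth of [c] leaves a convergent series. *)
Lemma af_sum_bound c d eps : zsub c -> 0 < d <= 1 / 2 -> 0 < eps -> 
  exists e, 0 < e /\ forall F (g : Hcircle), holomorphic_annulus d F -> (forall xi : circle, F xi = g xi) ->
   (forall z, Cmod z = 1 - d / 2 \/ Cmod z = 1 + d / 2 -> Cmod (F z) < e) -> Cmod (af_sum c g) < eps.
Proof.
intros hc hd he.
destruct (circ_radii d hd) as (h1 & h2 & h3 & h4 & h5); set (q := / (1 + d / 2)) in *.
assert (hs : 0 < sqrt q < 1).
{ split; [apply sqrt_lt_R0; lra|]. rewrite <- sqrt_1; apply sqrt_lt_1; lra. }
destruct (hc (sqrt q) hs) as [B hB].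
assert (hB0 : 0 <= B).
{ specialize (hB 0%Z); simpl in hB; generalize (Cmod_ge_0 (c 0%Z)); lra. }
(* The fraction is the constant of [Zlim_bound]; the added 1 makes the final inequality strict and
   [A] positive. *)
set (A := 3 * B / (1 - sqrt q) + 1).
assert (hA : 0 < A).
{ unfold A; assert (0 <= 3 * B / (1 - sqrt q)); [|lra].
  apply Rmult_le_pos; [lra|left; apply Rinv_0_lt_compat; lra]. }
set (e := eps / A).
assert (he0 : 0 < e) by now apply Rdiv_lt_0_compat.
exists e; split; [easy|].
intros F g hF hg hK; unfold af_sum.
assert (hgeo : zgeo (gcoef g) e q).
{ intros m; rewrite (gcoef_circ F) by easy.
  apply (fourier_circ_bound F d (1 - d / 2) (1 + d / 2) 1); auto; try lra.
  - intros k; apply fourier_bound; [apply RCcont_circ with d; auto; lra|].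
    intros t; left; apply hK; left; apply Cmod_polar; lra.
  - intros k; apply fourier_bound; [apply RCcont_circ with d; auto; lra|].
    intros t; left; apply hK; right; apply Cmod_polar; lra. }
assert (hgeo' : zgeo (fun m => gcoef g m * c m)%C (e * B) (sqrt q)).
{ intros m; rewrite Cmod_mult; specialize (hgeo m); specialize (hB m).
  assert (e' : q ^ Z.abs_nat m = sqrt q ^ Z.abs_nat m * sqrt q ^ Z.abs_nat m).
  { rewrite <- Rpow_mult_distr, sqrt_sqrt; lra. }
  assert (hp : 0 < sqrt q ^ Z.abs_nat m) by (apply pow_lt; lra).
  set (x := sqrt q ^ Z.abs_nat m) in *; rewrite e' in hgeo.
  apply Rle_trans with (e * (x * x) * Cmod (c m)).
  - apply Rmult_le_compat_r; [apply Cmod_ge_0|easy].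
  - assert (0 < e * x) by nra. nra. }
assert (hs2 : 0 <= sqrt q < 1) by lra.
eapply Rle_lt_trans; [apply (Zlim_bound _ _ _ hs2 hgeo')|].
replace (3 * (e * B) / (1 - sqrt q)) with (e * (A - 1)) by (unfold A; field; lra).
replace eps with (e * A) by (unfold e; field; lra). nra.
Qed.

Lemma af_sum_continuous c : zsub c -> forall (g : Hcircle) (eps : R), 0 < eps ->
  nbhs0_circle (fun u => forall h, lincomb 1 1 g u h -> Cmod (af_sum c h - af_sum c g)%C < eps).
Proof.
intros hc g eps he; exists (fun u => Cmod (af_sum c u) < eps); split; [|split].
- intros a b g1 g2 h hab h1 h2 hl; rewrite (af_sum_linear c hc a b g1 g2 h hl).
  eapply Rle_lt_trans; [apply Cmod_triangle|]; rewrite !Cmod_mult.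
  assert (p1 := Cmod_ge_0 a); assert (p2 := Cmod_ge_0 b).
  assert (p3 := Cmod_ge_0 (af_sum c g1)); assert (p4 := Cmod_ge_0 (af_sum c g2)).
  set (m := Rmax (Cmod (af_sum c g1)) (Cmod (af_sum c g2))).
  assert (m1 : Cmod (af_sum c g1) <= m) by apply Rmax_l.
  assert (m2 : Cmod (af_sum c g2) <= m) by apply Rmax_r.
  assert (m3 : m < eps) by (now apply Rmax_lub_lt). nra.
- intros d hd.
  (* A neighbourhood for a narrower annulus gives one for the wider annulus by restriction, so the
     width may be capped. *)
  set (d' := Rmin d (1 / 2)).
  assert (hd' : 0 < d' <= 1 / 2) by (split; [apply Rmin_pos; lra|apply Rmin_r]).
  assert (hdd : d' <= d) by apply Rmin_l.
  destruct (af_sum_bound c d' eps hc hd' he) as (e & he0 & h).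
  exists (fun z => Cmod z = 1 - d' / 2 \/ Cmod z = 1 + d' / 2), e; repeat split; auto.
  + apply compact_union; apply compact_circle; revert hd'; clear; intro; lra.
  + revert H hd' hdd; clear; intros [H|H]; lra.
  + revert H hd' hdd; clear; intros [H|H]; lra.
  + intros F hF hK u hu; apply (h F u); auto; now apply holo_restrict with d.
- intros u hu h hl; rewrite (af_sum_linear c hc 1 1 g u h hl).
  replace (1 * af_sum c g + 1 * af_sum c u - af_sum c g)%C with (af_sum c u) by ring; easy.
Qed.

Definition af_of (c : Z -> C) (hc : zsub c) : analytic_functional :=
  {| af_fun := af_sum c; af_linear := af_sum_linear c hc; af_continuous := af_sum_continuous c hc |}.

(** * A three-term recurrence *)

(** The recurrence satisfied by the Fourier coefficients of [t |-> ((1 - r^2) / |1 - r e^(it)|^2)^w].  Its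
    characteristic roots are [r] and [1 / r]; boundedness singles out the root [r]. *)
Definition kernel_recurrence (r : R) (w : C) (k : nat -> C) : Prop := forall m,
  (RtoC ((1 + r ^ 2) * INR (S m)) * k (S m) =
   RtoC r * (RtoC (INR m) + w) * k m + RtoC r * (RtoC (INR (S m) + 1) - w) * k (S (S m)))%C.

Lemma INR_plus_w_neq m w : 0 < Re w -> 0 < Cmod (RtoC (INR m) + w).
Proof.
intros hw; apply Rlt_le_trans with (2 := Cmod_Re _).
unfold Re in *; simpl; generalize (pos_INR m); intro.
rewrite Rabs_pos_eq; lra.
Qed.

Lemma kernel_recurrence_mod r w k : 0 < r -> kernel_recurrence r w k -> forall m,
  (1 + r ^ 2) * INR (S m) * Cmod (k (S m)) <=
  r * Cmod (RtoC (INR m) + w) * Cmod (k m) + r * (INR (S m) + (1 + Cmod w)) * Cmod (k (S (S m))).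
Proof.
intros hr h m; specialize (h m); apply (f_equal Cmod) in h.
assert (hS : 0 <= INR (S m)) by apply pos_INR.
rewrite Cmod_mult, Cmod_R, Rabs_pos_eq in h by (apply Rmult_le_pos; [simpl; nra|easy]).
rewrite h; eapply Rle_trans; [apply Cmod_triangle|]; apply Rplus_le_compat; rewrite !Cmod_mult, Cmod_R, Rabs_pos_eq by lra.
- lra.
- apply Rmult_le_compat_r; [apply Cmod_ge_0|]; apply Rmult_le_compat_l; [lra|].
  eapply Rle_trans; [apply Cmod_triangle|]; rewrite Cmod_opp, Cmod_R, Rabs_pos_eq; lra.
Qed.

(** The bracket equals (kap - r) (1 - r kap), the characteristic polynomial up to sign, positive
    between the roots r and 1 / r. Multiplied by m + 1 it outweighs the terms that involve [w], so a
    ratio bound passes from m + 1 to m. *)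
Lemma kernel_recurrence_backward r w k kap m : 0 < r -> 0 < Re w -> 0 < kap -> kernel_recurrence r w k ->
  (1 + Cmod w) * r * (1 + kap ^ 2) <= INR (S m) * (kap * (1 + r ^ 2) - r - r * kap ^ 2) ->
  Cmod (k (S (S m))) <= kap * Cmod (k (S m)) -> Cmod (k (S m)) <= kap * Cmod (k m).
Proof.
intros hr hw hk h hN hle.
assert (hm := kernel_recurrence_mod r w k hr h m).
assert (hS : 0 <= INR m) by apply pos_INR.
set (W := Cmod (RtoC (INR m) + w)) in *.
assert (hW : 0 < W) by now apply INR_plus_w_neq.
assert (hW2 : W <= INR (S m) + (1 + Cmod w)).
{ unfold W; eapply Rle_trans; [apply Cmod_triangle|]; rewrite Cmod_R, Rabs_pos_eq by easy.
  rewrite S_INR; lra. }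
set (c := 1 + Cmod w) in *; set (n := INR (S m)) in *.
set (X := (1 + r ^ 2) * n - r * kap * (n + c)).
assert (hX : r * W <= kap * X) by (unfold X; nra).
assert (hXp : 0 < X) by (assert (0 < r * W) by nra; nra).
assert (hc : 0 <= n + c) by lra.
assert (h1 : X * Cmod (k (S m)) <= r * W * Cmod (k m)).
{ assert (r * (n + c) * Cmod (k (S (S m))) <= r * (n + c) * (kap * Cmod (k (S m)))).
  { apply Rmult_le_compat_l; [nra|easy]. }
  unfold X; nra. }
apply (Rmult_le_reg_l X); [easy|].
generalize (Cmod_ge_0 (k m)); nra.
Qed.

(** Otherwise the sequence would eventually grow by the factor [kap] at every step. This provides
    starting points, arbitrarily far out, for the downward propagation. *)
Lemma bounded_often_slow (k : nat -> C) B kap : 1 < kap -> (forall m, Cmod (k m) <= B) ->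
  forall M, exists m, (M <= m)%nat /\ Cmod (k (S m)) <= kap * Cmod (k m).
Proof.
intros hk hB M; apply NNPP; intros hn.
assert (h : forall m, (M <= m)%nat -> kap * Cmod (k m) < Cmod (k (S m))).
{ intros m hm; apply Rnot_le_lt; intros hl; apply hn; now exists m. }
assert (hp : 0 < Cmod (k (S M))).
{ apply Rle_lt_trans with (2 := h M (le_n _)); generalize (Cmod_ge_0 (k M)); nra. }
assert (hg : forall j, kap ^ j * Cmod (k (S M)) <= Cmod (k (S M + j)%nat)).
{ induction j as [|j ih]; [rewrite Nat.add_0_r; simpl; lra|].
  rewrite Nat.add_succ_r; specialize (h (S M + j)%nat ltac:(lia)); simpl pow; nra. }
destruct (Pow_x_infinity kap) with (b := (B + 1) / Cmod (k (S M))) as [j hj].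
{ rewrite Rabs_pos_eq; lra. }
specialize (hj j (le_n _)); specialize (hg j); specialize (hB (S M + j)%nat).
rewrite Rabs_pos_eq in hj by (apply pow_le; lra).
apply Rge_le in hj; apply (Rmult_le_compat_r (Cmod (k (S M)))) in hj; [|lra].
unfold Rdiv in hj; rewrite Rmult_assoc, Rinv_l in hj; lra.
Qed.

(** Boundedness gives a good ratio at some index beyond m, and [kernel_recurrence_backward] carries
    it down to m. *)
Lemma kernel_recurrence_ratio r w k B kap N : 0 < r -> 0 < Re w -> 1 < kap -> kernel_recurrence r w k ->
  (forall m, Cmod (k m) <= B) ->
  (1 + Cmod w) * r * (1 + kap ^ 2) <= INR (S N) * (kap * (1 + r ^ 2) - r - r * kap ^ 2) ->
  forall m, (N <= m)%nat -> Cmod (k (S m)) <= kap * Cmod (k m).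
Proof.
intros hr hw hk h hB hN m hm.
destruct (bounded_often_slow k B kap hk hB m) as (M & hM & hle).
assert (hg : 0 < kap * (1 + r ^ 2) - r - r * kap ^ 2).
{ assert (0 < (1 + Cmod w) * r * (1 + kap ^ 2)).
  { generalize (Cmod_ge_0 w); intro. apply Rmult_lt_0_compat; [nra|simpl; nra]. }
  assert (0 <= INR (S N)) by apply pos_INR. nra. }
revert hle; replace M with (m + (M - m))%nat by lia; generalize (M - m)%nat; clear M hM.
intros j; induction j as [|j ih]; [now rewrite Nat.add_0_r|].
rewrite Nat.add_succ_r; intros hle; apply ih.
apply (kernel_recurrence_backward r w k); auto; [lra|].
eapply Rle_trans; [apply hN|]; apply Rmult_le_compat_r; [lra|]; apply le_INR; lia.
Qed.

(** A zero would spread upwards by the ratio bound, and then downwards by the recurrence, whose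
    coefficient m + w does not vanish. *)
Lemma kernel_recurrence_nonzero r w k kap N : 0 < r -> 0 < Re w -> kernel_recurrence r w k ->
  (forall m, (N <= m)%nat -> Cmod (k (S m)) <= kap * Cmod (k m)) ->
  (exists m, k m <> 0%C) -> forall m, (N <= m)%nat -> k m <> 0%C.
Proof.
intros hr hw h hk [m0 h0] m hm e; apply h0.
assert (up : forall j, k (m + j)%nat = 0%C).
{ induction j as [|j ih]; [now rewrite Nat.add_0_r|].
  rewrite Nat.add_succ_r; apply Cmod_eq_0; specialize (hk (m + j)%nat ltac:(lia)).
  rewrite ih, Cmod_0 in hk; generalize (Cmod_ge_0 (k (S (m + j)))); lra. }
assert (down : forall n, k (S n) = 0%C -> k (S (S n)) = 0%C -> k n = 0%C).
{ intros n e1 e2; specialize (h n); rewrite e1, e2 in h.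
  assert (e3 : (RtoC r * (RtoC (INR n) + w) * k n)%C = 0%C).
  { transitivity (RtoC ((1 + r ^ 2) * INR (S n)) * 0 - r * (RtoC (INR (S n) + 1) - w) * 0)%C; [rewrite h|]; ring. }
  apply Cmult_integral in e3; destruct e3 as [e3|e3]; [|easy].
  apply Cmult_integral in e3; destruct e3 as [e3|e3].
  - apply RtoC_inj in e3; lra.
  - generalize (INR_plus_w_neq n w hw); rewrite e3, Cmod_0; lra. }
assert (all : forall j n, (n + j = m)%nat -> k n = 0%C /\ k (S n) = 0%C).
{ induction j as [|j ih]; intros n hn.
  - replace n with m by lia; split; [easy|]. specialize (up 1%nat); now rewrite Nat.add_1_r in up.
  - destruct (ih (S n)) as [e1 e2]; [lia|]; split; auto. }
destruct (Nat.le_ge_cases m0 m) as [hl|hl].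
- apply (all (m - m0)%nat); lia.
- replace m0 with (m + (m0 - m))%nat by lia; apply up.
Qed.

(* The differences [k (m+1) - r k m] satisfy a first-order recurrence that contracts for decreasing [m],
   with an error of relative size [1 / m]. *)
Lemma kernel_recurrence_asymp r w k kap N : 0 < r -> 0 < kap -> r * kap < 1 -> kernel_recurrence r w k ->
  (forall m, (N <= m)%nat -> Cmod (k (S m)) <= kap * Cmod (k m)) ->
  forall eta, 0 < eta -> exists N', (N <= N')%nat /\
    forall m, (N' <= m)%nat -> Cmod (k (S m) - r * k m)%C <= eta * Cmod (k m).
Proof.
intros hr hk hrk h hN eta heta.
set (q := r * kap) in *; set (E := r * Cmod (w - 1)%C * (1 + kap ^ 2)).
assert (hq : 0 < q) by (unfold q; nra).
assert (hE : 0 <= E).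
{ unfold E; apply Rmult_le_pos; [apply Rmult_le_pos; [lra|apply Cmod_ge_0]|simpl; nra]. }
destruct (INR_unbounded (E / ((1 - q) * (eta / 2)))) as [N1 hN1].
exists (N + N1)%nat; split; [lia|].
assert (hden : 0 < (1 - q) * (eta / 2)) by nra.
assert (step : forall m, (N + N1 <= m)%nat ->
  Cmod (k (S m) - r * k m)%C <= r * Cmod (k (S (S m)) - r * k (S m))%C + (1 - q) * (eta / 2) * Cmod (k m)).
{ intros m hm.
  assert (hS : 0 < INR (S m)) by (apply lt_0_INR; lia).
  (* The recurrence divided by m + 1, with m + w written as (m + 1) + (w - 1) and m + 2 - w as (m +
     1) - (w - 1). *)
  assert (e : (k (S m) - r * k m)%C = (r * (k (S (S m)) - r * k (S m)) +
    RtoC (r / INR (S m)) * (w - 1) * (k m - k (S (S m))))%C).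
  { specialize (h m).
    assert (hS' : RtoC (INR (S m)) <> 0) by (intros e; apply RtoC_inj in e; lra).
    transitivity ((RtoC ((1 + r ^ 2) * INR (S m)) * k (S m)) / INR (S m) - r * r * k (S m) - r * k m)%C.
    - rewrite RtoC_mult, RtoC_plus, RtoC_pow; field; easy.
    - rewrite h, RtoC_plus, RtoC_div by lra.
      replace (RtoC (INR m)) with (RtoC (INR (S m)) - 1)%C by (rewrite S_INR, RtoC_plus; ring).
      field; easy. }
  rewrite e; eapply Rle_trans; [apply Cmod_triangle|]; rewrite !Cmod_mult, !Cmod_R.
  rewrite !(Rabs_pos_eq) by (try lra; left; apply Rdiv_lt_0_compat; lra).
  apply Rplus_le_compat_l.
  assert (b1 := hN m ltac:(lia)); assert (b2 := hN (S m) ltac:(lia)).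
  assert (b3 : Cmod (k m - k (S (S m)))%C <= (1 + kap ^ 2) * Cmod (k m)).
  { eapply Rle_trans; [apply Cmod_triangle|]; rewrite Cmod_opp; simpl; nra. }
  apply Rle_trans with (E / INR (S m) * Cmod (k m)).
  - unfold E; replace (r * Cmod (w - 1) * (1 + kap ^ 2) / INR (S m) * Cmod (k m)) with
      (r / INR (S m) * Cmod (w - 1) * ((1 + kap ^ 2) * Cmod (k m))) by (field; lra).
    apply Rmult_le_compat_l; [|easy].
    apply Rmult_le_pos; [left; apply Rdiv_lt_0_compat; lra|apply Cmod_ge_0].
  - apply Rmult_le_compat_r; [apply Cmod_ge_0|].
    apply (Rmult_le_reg_r (INR (S m))); [easy|].
    unfold Rdiv at 1; rewrite Rmult_assoc, Rinv_l, Rmult_1_r by lra.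
    assert (INR N1 <= INR (S m)) by (apply le_INR; lia).
    apply (Rmult_lt_compat_r ((1 - q) * (eta / 2))) in hN1; [|easy].
    unfold Rdiv at 1 in hN1; rewrite Rmult_assoc, Rinv_l in hN1 by lra. nra. }
(* Looking j steps ahead contracts the crude initial bound kap + r by q^j, while the accumulated
   errors stay within eta / 2 thanks to the factor 1 - q in [step]. *)
assert (ind : forall j m, (N + N1 <= m)%nat ->
  Cmod (k (S m) - r * k m)%C <= (q ^ j * (kap + r) + eta / 2) * Cmod (k m)).
{ induction j as [|j ih]; intros m hm; assert (p0 := Cmod_ge_0 (k m)).
  - eapply Rle_trans; [apply Cmod_triangle|]; rewrite Cmod_opp, Cmod_mult, Cmod_R, Rabs_pos_eq by lra.
    specialize (hN m ltac:(lia)); simpl; nra.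
  - eapply Rle_trans; [apply step, hm|]. specialize (ih (S m) ltac:(lia)).
    specialize (hN m ltac:(lia)).
    assert (hqj : 0 <= q ^ j) by (apply pow_le; lra).
    assert (hA : 0 <= q ^ j * (kap + r) + eta / 2) by nra.
    set (A := q ^ j * (kap + r) + eta / 2) in *.
    assert (r * Cmod (k (S (S m)) - r * k (S m))%C <= q * A * Cmod (k m)).
    { apply Rle_trans with (r * (A * (kap * Cmod (k m)))).
      - apply Rmult_le_compat_l; [lra|]. eapply Rle_trans; [apply ih|].
        apply Rmult_le_compat_l; lra.
      - unfold q; right; ring. }
    replace (q ^ S j * (kap + r) + eta / 2) with (q * A + (1 - q) * (eta / 2)) by (unfold A; simpl; ring).
    lra. }
intros m hm.
destruct (pow_lt_1_zero q) with (y := eta / 2 / (kap + r)) as [j hj].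
{ rewrite Rabs_pos_eq; lra. }
{ apply Rdiv_lt_0_compat; lra. }
specialize (hj j (le_n _)); rewrite Rabs_pos_eq in hj by (apply pow_le; lra).
eapply Rle_trans; [apply (ind j m hm)|]; apply Rmult_le_compat_r; [apply Cmod_ge_0|].
apply (Rmult_lt_compat_r (kap + r)) in hj; [|lra].
unfold Rdiv in hj; rewrite (Rmult_assoc _ (/ (kap + r))), Rinv_l in hj; lra.
Qed.

Lemma kernel_recurrence_lower r w k B rho : 0 < r < 1 -> 0 < Re w -> kernel_recurrence r w k -> (forall m, Cmod (k m) <= B) ->
  (exists m, k m <> 0%C) -> 0 < rho < r ->
  exists N c, 0 < c /\ forall m, (N <= m)%nat -> c * rho ^ m <= Cmod (k m).
Proof.
intros hr hw h hB hnz hrho.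
(* The midpoint of 1 and 1 / r: above 1 for [bounded_often_slow], below 1 / r for the
   contraction. *)
set (kap := (1 + / r) / 2).
assert (hri : r * / r = 1) by (field; lra).
assert (hi : 1 < / r) by (apply (Rmult_lt_reg_l r); lra).
assert (hkap : 1 < kap) by (unfold kap; lra).
assert (hrk : r * kap < 1) by (unfold kap; nra).
assert (hg : 0 < kap * (1 + r ^ 2) - r - r * kap ^ 2).
{ replace (kap * (1 + r ^ 2) - r - r * kap ^ 2) with ((kap - r) * (1 - r * kap)) by ring. nra. }
set (g := kap * (1 + r ^ 2) - r - r * kap ^ 2) in *.
destruct (INR_unbounded ((1 + Cmod w) * r * (1 + kap ^ 2) / g)) as [N hN].
assert (hratio := kernel_recurrence_ratio r w k B kap N ltac:(lra) hw hkap h hB).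
assert (hr' : forall m, (N <= m)%nat -> Cmod (k (S m)) <= kap * Cmod (k m)).
{ apply hratio; fold g; apply (Rmult_lt_compat_r g) in hN; [|easy].
  unfold Rdiv in hN; rewrite Rmult_assoc, Rinv_l, Rmult_1_r in hN by lra. rewrite S_INR; nra. }
(* With the tolerance r - rho the asymptotic ratio gives |k (m+1)| >= rho |k m|, and iterating this
   yields the geometric lower bound. *)
destruct (kernel_recurrence_asymp r w k kap N ltac:(lra) ltac:(lra) hrk h hr' (r - rho)) as (N' & hNN & hD); [lra|].
exists N', (Cmod (k N') * / rho ^ N').
assert (hp : forall n, 0 < rho ^ n) by (intro; apply pow_lt; lra).
split.
- apply Rmult_lt_0_compat; [|now apply Rinv_0_lt_compat].
  apply Cmod_gt_0, (kernel_recurrence_nonzero r w k kap N); auto; lra.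
- intros m hm; replace m with (N' + (m - N'))%nat by lia; generalize (m - N')%nat; clear m hm.
  induction n as [|n ih].
  + rewrite Nat.add_0_r, Rmult_assoc, Rinv_l; [lra|]. apply Rgt_not_eq, hp.
  + rewrite Nat.add_succ_r; specialize (hD (N' + n)%nat ltac:(lia)).
    set (a := k (N' + n)%nat) in *; set (b := k (S (N' + n))) in *.
    assert (ht := Cmod_triangle b (- (b - r * a))%C); rewrite Cmod_opp in ht.
    replace (b + - (b - r * a))%C with (r * a)%C in ht by ring.
    rewrite Cmod_mult, Cmod_R, Rabs_pos_eq in ht by lra. simpl pow. nra.
Qed.

(** With [kap = 2] the smallness of r makes the ratio bound hold from index 0 on, so no exceptional
    indices remain. *)
Lemma kernel_recurrence_small_nonzero r w k B : 0 < r -> 0 < Re w -> 5 * (2 + Cmod w) * r <= 2 -> kernel_recurrence r w k ->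
  (forall m, Cmod (k m) <= B) -> (exists m, k m <> 0%C) -> forall m, k m <> 0%C.
Proof.
intros hr hw hs h hB hnz m.
apply (kernel_recurrence_nonzero r w k 2 0); auto; [|lia].
apply (kernel_recurrence_ratio r w k B 2 0); auto; [lra|]. simpl INR; nra.
Qed.

(** * Fourier coefficients of the kernel *)

Lemma RCd_Cexp phi t l : RCd phi t l -> RCd (fun u => Cexp (phi u)) t (l * Cexp (phi t))%C.
Proof.
intros [h1 h2]; split.
- apply is_derive_ext with (fun u => exp (Re (phi u)) * cos (Im (phi u))); [easy|].
  evar_last.
  + apply (is_derive_mult (K := R_AbsRing)).
    * apply (is_derive_comp (K := R_AbsRing) (V := R_NormedModule) exp (fun u => Re (phi u)) t _ _
        (is_derive_exp _) h1).
    * apply (is_derive_comp (K := R_AbsRing) (V := R_NormedModule) cos (fun u => Im (phi u)) t _ _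
        (is_derive_cos _) h2).
    * intros; apply Rmult_comm.
  + unfold Cexp, Re, Im, plus, scal, mult; simpl; unfold mult; simpl; ring.
- apply is_derive_ext with (fun u => exp (Re (phi u)) * sin (Im (phi u))); [easy|].
  evar_last.
  + apply (is_derive_mult (K := R_AbsRing)).
    * apply (is_derive_comp (K := R_AbsRing) (V := R_NormedModule) exp (fun u => Re (phi u)) t _ _
        (is_derive_exp _) h1).
    * apply (is_derive_comp (K := R_AbsRing) (V := R_NormedModule) sin (fun u => Im (phi u)) t _ _
        (is_derive_sin _) h2).
    * intros; apply Rmult_comm.
  + unfold Cexp, Re, Im, plus, scal, mult; simpl; unfold mult; simpl; ring.
Qed.

Definition poisson_circle (r t : R) : R := (1 - r ^ 2) / (1 + r ^ 2 - 2 * r * cos t).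

Lemma poisson_circle_den r t : 0 <= r < 1 -> 0 < 1 + r ^ 2 - 2 * r * cos t.
Proof. intros h; generalize (COS_bound t); intros; simpl; nra. Qed.

Lemma poisson_circle_pos r t : 0 <= r < 1 -> 0 < poisson_circle r t.
Proof. intros h; apply Rdiv_lt_0_compat; [simpl; nra|now apply poisson_circle_den]. Qed.

Definition kernel_circle (w : C) (r t : R) : C := Rcpow (poisson_circle r t) w.

Lemma RCd_kernel_circle w r t : 0 <= r < 1 ->
  RCd (kernel_circle w r) t (w * RtoC (- (2 * r * sin t) / (1 + r ^ 2 - 2 * r * cos t)) * kernel_circle w r t)%C.
Proof.
intros h; unfold kernel_circle, Rcpow; apply RCd_Cexp, RCd_scal, RCd_RtoC.
assert (h1 := poisson_circle_den r t h); assert (h2 := poisson_circle_pos r t h); unfold poisson_circle in *.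
auto_derive.
- repeat split; [simpl in h1; lra|exact h2].
- simpl in *; field; repeat split; nra.
Qed.

Lemma RCcont_kernel_circle w r : 0 <= r < 1 -> RCcont (kernel_circle w r).
Proof. intros h t; eapply RCd_c, RCd_kernel_circle, h. Qed.

Lemma periodic_kernel_circle w r : periodic (kernel_circle w r).
Proof. 
intros t; unfold kernel_circle, poisson_circle; replace (t + 2 * PI) with (t + 2 * INR 1 * PI) by (simpl; ring).
now rewrite cos_period.
Qed.

Lemma kernel_circle_even w r t : kernel_circle w r (- t) = kernel_circle w r t.
Proof. unfold kernel_circle, poisson_circle; now rewrite cos_neg. Qed.

Definition kernel_coef (w : C) (r : R) (m : Z) : C := fourier (kernel_circle w r) m.

Lemma kernel_coef_opp w r m : 0 <= r < 1 -> kernel_coef w r (- m) = kernel_coef w r m.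
Proof.
intros h; unfold kernel_coef; rewrite <- fourier_opp_arg.
- apply fourier_ext, kernel_circle_even.
- apply periodic_kernel_circle.
- now apply RCcont_kernel_circle.
Qed.

Lemma Cexp_neq_0 z : Cexp z <> 0%C.
Proof.
intros e; unfold Cexp in e; injection e; intros e2 e1.
assert (h := exp_pos (Re z)).
apply Rmult_integral in e1, e2.
assert (cos (Im z) = 0) by (destruct e1; lra); assert (sin (Im z) = 0) by (destruct e2; lra).
generalize (sin2_cos2 (Im z)); unfold Rsqr; nra.
Qed.

Lemma em_cos t : (RtoC (2 * cos t) = em 1 t + em (-1) t)%C.
Proof.
unfold em, eit; replace (-1 * t) with (- t) by ring; rewrite Rmult_1_l, cos_neg, sin_neg.
apply C_ext; simpl; ring.
Qed.

Lemma em_sin t : (RtoC (- (2 * sin t)) = Ci * (em 1 t - em (-1) t))%C.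
Proof.
unfold em, eit; replace (-1 * t) with (- t) by ring; rewrite Rmult_1_l, cos_neg, sin_neg.
apply C_ext; simpl; ring.
Qed.

(** Logarithmic differentiation of the kernel in t, after clearing the denominator, is a linear
    relation with trigonometric coefficients of degree one. Its coefficient of index m + 1 involves
    only m, m + 1 and m + 2. *)
Lemma kernel_coef_recur w r : 0 <= r < 1 -> kernel_recurrence r w (fun m => kernel_coef w r (Z.of_nat m)).
Proof.
intros hr m.
set (D := fun t => (w * RtoC (- (2 * r * sin t) / (1 + r ^ 2 - 2 * r * cos t)) * kernel_circle w r t)%C).
assert (hD : RCcont D).
{ intros t; apply RCc_mult; [apply RCc_mult; [apply RCc_const|]|now apply RCcont_kernel_circle].
  apply RCc_RtoC, (ex_derive_continuous (K := R_AbsRing) (V := R_NormedModule)).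
  assert (h1 := poisson_circle_den r t hr); auto_derive; simpl in h1; lra. }
assert (hK := RCcont_kernel_circle w r hr).
assert (hf : forall n, fourier D n = (Ci * RtoC (IZR n) * kernel_coef w r n)%C).
{ intros n; apply fourier_derive; auto using periodic_kernel_circle; intros; now apply RCd_kernel_circle. }
assert (hid : forall t, (RtoC (1 + r ^ 2) * D t - (r * (em 1 t * D t) + r * (em (-1) t * D t)) =
  Ci * r * w * (em 1 t * kernel_circle w r t) - Ci * r * w * (em (-1) t * kernel_circle w r t))%C).
{ intros t; assert (h1 := poisson_circle_den r t hr).
  transitivity (RtoC (1 + r ^ 2 - 2 * r * cos t) * D t)%C.
  - replace (RtoC (1 + r ^ 2 - 2 * r * cos t)) with (RtoC (1 + r ^ 2) - r * RtoC (2 * cos t))%C.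
    + rewrite em_cos; ring.
    + rewrite <- RtoC_mult, <- RtoC_minus; f_equal; ring.
  - transitivity (r * w * RtoC (- (2 * sin t)) * kernel_circle w r t)%C; [|rewrite em_sin; ring].
    unfold D; replace (- (2 * r * sin t) / (1 + r ^ 2 - 2 * r * cos t)) with
      (r * (- (2 * sin t)) * / (1 + r ^ 2 - 2 * r * cos t)) by (field; lra).
    rewrite !RtoC_mult, RtoC_inv by lra; field. intros e; apply RtoC_inj in e; lra. }
assert (hc : forall n c f, RCcont f -> RCcont (fun t => c * (em n t * f t))%C).
{ intros n c f hf' t; apply RCc_mult; [apply RCc_const|]; apply RCc_mult; auto using RCc_em. }
assert (he : forall n f, RCcont f -> RCcont (fun t => em n t * f t)%C).
{ intros n f hf' t; apply RCc_mult; auto using RCc_em. }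
assert (hfid := fourier_ext _ _ (Z.of_nat (S m)) hid).
rewrite (fourier_minus (fun t => RtoC (1 + r ^ 2) * D t)%C) in hfid.
2: { intros t; apply RCc_mult; [apply RCc_const|apply hD]. }
2: { intros t; apply RCc_plus; now apply hc. }
rewrite (fourier_plus (fun t => r * (em 1 t * D t))%C) in hfid by now apply hc.
rewrite (fourier_minus (fun t => Ci * r * w * (em 1 t * kernel_circle w r t))%C) in hfid by now apply hc.
rewrite (fourier_scal _ D) in hfid by easy.
rewrite (fourier_scal _ (fun t => em 1 t * D t)%C) in hfid by now apply he.
rewrite (fourier_scal _ (fun t => em (-1) t * D t)%C) in hfid by now apply he.
rewrite (fourier_scal _ (fun t => em 1 t * kernel_circle w r t)%C) in hfid by now apply he.
rewrite (fourier_scal _ (fun t => em (-1) t * kernel_circle w r t)%C) in hfid by now apply he.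
rewrite !fourier_em_mult, !hf in hfid.
replace (Z.of_nat (S m) - 1)%Z with (Z.of_nat m) in hfid by lia.
replace (Z.of_nat (S m) - -1)%Z with (Z.of_nat (S (S m))) in hfid by lia.
fold (kernel_coef w r (Z.of_nat m)) (kernel_coef w r (Z.of_nat (S (S m)))) in hfid.
rewrite <- !INR_IZR_INZ in hfid.
set (k0 := kernel_coef w r (Z.of_nat m)) in *; set (k1 := kernel_coef w r (Z.of_nat (S m))) in *.
set (k2 := kernel_coef w r (Z.of_nat (S (S m)))) in *.
rewrite (S_INR (S m)) in hfid.
rewrite RtoC_mult.
transitivity ((RtoC (1 + r ^ 2) * (Ci * INR (S m) * k1) -
   (r * (Ci * INR m * k0) + r * (Ci * RtoC (INR (S m) + 1) * k2))) * / Ci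
   + r * INR m * k0 + r * RtoC (INR (S m) + 1) * k2)%C.
- field. intros e; injection e; lra.
- rewrite hfid; field. intros e; injection e; lra.
Qed.

Lemma kernel_coef_bounded w r : 0 <= r < 1 -> exists B, forall m, Cmod (kernel_coef w r m) <= B.
Proof. intros h; destruct (fourier_bounded (kernel_circle w r) (RCcont_kernel_circle w r h)) as [M [_ hM]]; now exists M. Qed.

(** The kernel is an exponential, hence not zero, and evenness moves a nonzero coefficient to a
    nonnegative index. *)
Lemma kernel_coef_nontrivial w r : 0 <= r < 1 -> exists m, kernel_coef w r (Z.of_nat m) <> 0%C.
Proof.
intros h; apply NNPP; intros hn.
apply (Cexp_neq_0 (w * RtoC (ln (poisson_circle r 0)))%C); change (kernel_circle w r 0 = 0%C).
apply fourier_unique; [apply periodic_kernel_circle|now apply RCcont_kernel_circle|].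
intros m; change (kernel_coef w r m = 0%C); apply NNPP; intros hm; apply hn.
exists (Z.abs_nat m); destruct (Z_le_dec 0 m).
- now replace (Z.of_nat (Z.abs_nat m)) with m by lia.
- replace (Z.of_nat (Z.abs_nat m)) with (- m)%Z by lia; now rewrite kernel_coef_opp.
Qed.

Lemma kernel_coef_abs w r m : 0 <= r < 1 -> kernel_coef w r (Z.of_nat (Z.abs_nat m)) = kernel_coef w r m.
Proof.
intros h; destruct (Z_le_dec 0 m).
- now replace (Z.of_nat (Z.abs_nat m)) with m by lia.
- replace (Z.of_nat (Z.abs_nat m)) with (- m)%Z by lia; now rewrite kernel_coef_opp.
Qed.

(** One radius good for all m at once: radial solutions are normalised there, and functionals are
    compared on that circle. *)
Lemma kernel_coef_somewhere_nonzero w : 0 < Re w -> exists r, 0 < r < 1 /\ forall m, kernel_coef w r m <> 0%C.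
Proof.
intros hw; assert (hw0 := Cmod_ge_0 w).
set (r := 2 / (5 * (2 + Cmod w))).
assert (hr : 0 < r) by (apply Rdiv_lt_0_compat; lra).
assert (hs : 5 * (2 + Cmod w) * r = 2) by (unfold r; field; lra).
assert (hr1 : r < 1) by nra.
exists r; split; [easy|]; intros m.
rewrite <- kernel_coef_abs by lra.
destruct (kernel_coef_bounded w r) as [B hB]; [lra|].
apply (kernel_recurrence_small_nonzero r w (fun m => kernel_coef w r (Z.of_nat m)) B); auto; try lra.
- apply kernel_coef_recur; lra.
- apply kernel_coef_nontrivial; lra.
Qed.

Lemma kernel_coef_lower w r rho : 0 < Re w -> 0 < rho < r -> r < 1 ->
  exists N c, 0 < c /\ forall m, (N <= Z.abs_nat m)%nat -> c * rho ^ Z.abs_nat m <= Cmod (kernel_coef w r m).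
Proof.
intros hw hrho hr.
destruct (kernel_coef_bounded w r) as [B hB]; [lra|].
destruct (kernel_recurrence_lower r w (fun m => kernel_coef w r (Z.of_nat m)) B rho) as (N & c & hc & h); auto; try lra.
- apply kernel_coef_recur; lra.
- apply kernel_coef_nontrivial; lra.
- exists N, c; split; [easy|]; intros m hm; rewrite <- (kernel_coef_abs w r m) by lra; auto.
Qed.

Lemma fun_choice {A B : Type} (P : A -> B -> Prop) :
  (forall x, exists y, P x y) -> exists f, forall x, P x (f x).
Proof.
intros h; exists (fun x => proj1_sig (constructive_indefinite_description _ (h x))).
intros x; apply proj2_sig.
Qed.

Lemma Cmult_reg_l (a x y : C) : a <> 0%C -> (a * x)%C = (a * y)%C -> x = y.
Proof.
intros ha h; replace x with (/ a * (a * x))%C by (field; easy); rewrite h; field; easy.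
Qed.

(** * The radial differential equation *)

Definition radial_coef (lambda : C) (m : Z) (r : R) : C :=
  (RtoC (IZR m ^ 2) + lambda * RtoC (4 * r ^ 2 / (1 - r ^ 2) ^ 2))%C.

(** The eigenvalue equation separated in polar coordinates, with the derivative [a1] carried along.
    The last clause is regularity at the origin, which excludes the second, singular solution. *)
Definition radial (lambda : C) (m : Z) (a a1 : R -> C) : Prop :=
  (forall r, 0 < r < 1 -> RCd a r (a1 r)) /\
  (forall r, 0 < r < 1 -> exists l, RCd a1 r l /\
     (RtoC (r ^ 2) * l + RtoC r * a1 r)%C = (radial_coef lambda m r * a r)%C) /\
  exists eta B, 0 < eta < 1 /\ forall r, 0 < r < eta -> Cmod (a r) <= B /\ Cmod (a1 r) <= B.

Lemma is_derive_zero_const (f : R -> R) : (forall r, 0 < r < 1 -> is_derive f r 0) ->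
  forall r s, 0 < r < 1 -> 0 < s < 1 -> f r = f s.
Proof.
intros h r s hr hs.
assert (hin : forall x, Rmin r s <= x <= Rmax r s -> 0 < x < 1).
{ intros x; unfold Rmin, Rmax; destruct (Rle_dec r s); lra. }
destruct (MVT_gen f r s (fun _ => 0)) as [c [_ hc]].
- intros x hx; apply h, hin; lra.
- intros x hx; apply derivable_continuous_pt; exists 0; apply is_derive_Reals, h, hin, hx.
- lra.
Qed.

Lemma RCd_zero_const phi : (forall r, 0 < r < 1 -> RCd phi r 0) ->
  forall r s, 0 < r < 1 -> 0 < s < 1 -> phi r = phi s.
Proof.
intros h r s hr hs; apply C_ext.
- apply (is_derive_zero_const (fun u => Re (phi u))); auto; intros; now apply h.
- apply (is_derive_zero_const (fun u => Im (phi u))); auto; intros; now apply h.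
Qed.

(* [r (a b' - a' b)] is constant by the equation and tends to 0 at the origin, because both solutions are
   bounded there together with their derivatives. *)
Lemma wronskian_zero lambda m a a1 b b1 : radial lambda m a a1 -> radial lambda m b b1 ->
  forall r, 0 < r < 1 -> (a r * b1 r)%C = (a1 r * b r)%C.
Proof.
intros (ha & hA & ea & Ba & hea & hba) (hb & hB & eb & Bb & heb & hbb).
set (W := fun r => (RtoC r * (a r * b1 r - a1 r * b r))%C).
assert (hW : forall r, 0 < r < 1 -> RCd W r 0).
{ intros r hr; destruct (hA r hr) as (la & hla & eqa); destruct (hB r hr) as (lb & hlb & eqb).
  eapply RCd_ext; [intro; reflexivity| |].
  2: { apply RCd_mult; [apply (RCd_RtoC (fun u => u) r 1); auto_derive; easy|].
    apply RCd_minus; apply RCd_mult; eauto. }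
  apply (f_equal (fun x => a r * x)%C) in eqb; apply (f_equal (fun x => b r * x)%C) in eqa.
  assert (hr0 : RtoC r <> 0) by (intros e; apply RtoC_inj in e; lra).
  apply (Cmult_reg_l (RtoC r)); [easy|].
  transitivity (a r * (r ^ 2 * lb + r * b1 r) - b r * (r ^ 2 * la + r * a1 r))%C.
  - simpl; ring.
  - rewrite !RtoC_pow in *; rewrite eqa, eqb; ring. }
assert (hsmall : forall r, 0 < r < Rmin ea eb -> Cmod (W r) <= r * (2 * (Ba * Bb))).
{ intros r hr; assert (h1 := Rmin_l ea eb); assert (h2 := Rmin_r ea eb).
  destruct (hba r ltac:(lra)) as [p1 p2]; destruct (hbb r ltac:(lra)) as [p3 p4].
  unfold W; rewrite Cmod_mult, Cmod_R, Rabs_pos_eq by lra; apply Rmult_le_compat_l; [lra|].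
  eapply Rle_trans; [apply Cmod_triangle|]; rewrite Cmod_opp, !Cmod_mult.
  assert (q1 := Cmod_ge_0 (a r)); assert (q2 := Cmod_ge_0 (a1 r)).
  assert (q3 := Cmod_ge_0 (b r)); assert (q4 := Cmod_ge_0 (b1 r)).
  assert (Cmod (a r) * Cmod (b1 r) <= Ba * Bb) by (apply Rmult_le_compat; auto).
  assert (Cmod (a1 r) * Cmod (b r) <= Ba * Bb) by (apply Rmult_le_compat; auto). lra. }
assert (hz : forall r, 0 < r < 1 -> W r = 0%C).
{ intros r hr; apply Cmod_small; intros eps he.
  assert (hm : 0 < Rmin ea eb) by (apply Rmin_pos; lra).
  set (A := 2 * (Ba * Bb)) in *.
  set (s := Rmin (Rmin ea eb / 2) (eps / (2 * (Rabs A + 1)))).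
  assert (hA0 := Rabs_pos A).
  assert (hs : 0 < s) by (apply Rmin_pos; [lra|apply Rdiv_lt_0_compat; lra]).
  assert (s1 := Rmin_l (Rmin ea eb / 2) (eps / (2 * (Rabs A + 1)))); fold s in s1.
  assert (s2 := Rmin_r (Rmin ea eb / 2) (eps / (2 * (Rabs A + 1)))); fold s in s2.
  assert (h1 := Rmin_l ea eb).
  rewrite (RCd_zero_const W hW r s) by lra.
  eapply Rle_lt_trans; [apply hsmall; lra|].
  apply Rle_lt_trans with (eps / (2 * (Rabs A + 1)) * (Rabs A + 1)).
  - generalize (Rle_abs A); intro. nra.
  - replace (eps / (2 * (Rabs A + 1)) * (Rabs A + 1)) with (eps / 2) by (field; lra); lra. }
intros r hr; specialize (hz r hr); unfold W in hz; apply Cmult_integral in hz; destruct hz as [e|e].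
- apply RtoC_inj in e; lra.
- replace (a r * b1 r)%C with (a r * b1 r - a1 r * b r + a1 r * b r)%C by ring; rewrite e; ring.
Qed.

(** To the right of r0 the function E exp(- M r) does not increase; to the left E exp(M r) does not
    decrease. The mean value theorem makes both comparisons with r0. *)
Lemma gronwall_zero (E dE : R -> R) M alpha beta r0 : alpha <= r0 <= beta ->
  (forall r, alpha <= r <= beta -> is_derive E r (dE r)) ->
  (forall r, alpha <= r <= beta -> 0 <= E r) ->
  (forall r, alpha <= r <= beta -> Rabs (dE r) <= M * E r) ->
  E r0 = 0 -> forall r, alpha <= r <= beta -> E r = 0.
Proof.
intros h0 hd hp hb hz r hr.
assert (hpm : forall k r, alpha <= r <= beta ->
  is_derive (fun r => E r * exp (k * r)) r ((dE r + k * E r) * exp (k * r))).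
{ intros k s hs; evar_last.
  - apply (is_derive_mult (K := R_AbsRing)); [now apply hd| |intros; apply Rmult_comm].
    apply (is_derive_comp (K := R_AbsRing) (V := R_NormedModule) exp (fun r => k * r) s _ k (is_derive_exp _)).
    auto_derive; [easy|ring].
  - unfold plus, mult, scal; simpl; unfold mult; simpl; ring. }
assert (hin : forall x, Rmin r0 r <= x <= Rmax r0 r -> alpha <= x <= beta).
{ intros x; unfold Rmin, Rmax; destruct (Rle_dec r0 r); lra. }
assert (hmvt : forall k, exists c, alpha <= c <= beta /\
   E r * exp (k * r) - E r0 * exp (k * r0) = (dE c + k * E c) * exp (k * c) * (r - r0)).
{ intros k; destruct (MVT_gen (fun r => E r * exp (k * r)) r0 r (fun r => (dE r + k * E r) * exp (k * r)))
    as [c [hc e]].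
  - intros x hx; apply hpm, hin; lra.
  - intros x hx; apply derivable_continuous_pt; eexists; apply is_derive_Reals, hpm, hin, hx.
  - exists c; split; [now apply hin|easy]. }
assert (hle : exists k, E r * exp (k * r) <= 0).
{ destruct (Rle_dec r0 r) as [hl|hl].
  - exists (- M); destruct (hmvt (- M)) as (c & hc & e); rewrite hz in e.
    specialize (hb c hc); apply Rabs_le_between in hb.
    assert (hx := exp_pos (- M * c)).
    assert ((dE c + - M * E c) * exp (- M * c) <= 0) by nra. nra.
  - exists M; destruct (hmvt M) as (c & hc & e); rewrite hz in e.
    specialize (hb c hc); apply Rabs_le_between in hb.
    assert (hx := exp_pos (M * c)).
    assert (0 <= (dE c + M * E c) * exp (M * c)) by nra. nra. }
destruct hle as [k hk]; specialize (hp r hr); assert (hx := exp_pos (k * r)). nra.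
Qed.

Lemma Re_conj_bound (a b : C) : Rabs (Re a * Re b + Im a * Im b) <= Cmod a * Cmod b.
Proof.
rewrite <- (Cmod_conj b), <- Cmod_mult.
apply Rle_trans with (2 := Cmod_Re _); right; f_equal; unfold Re, Im; simpl; ring.
Qed.

(** Uniqueness for the initial value problem: Gronwall applied to |v|^2 + |v1|^2 on the compact
    interval between r0 and r, where the coefficients of the equation are bounded. *)
Lemma radial_zero lambda m v v1 r0 : radial lambda m v v1 -> 0 < r0 < 1 ->
  v r0 = 0%C -> v1 r0 = 0%C -> forall r, 0 < r < 1 -> v r = 0%C.
Proof.
intros (hv & hV & _) h0 e0 e1 r hr.
set (alpha := Rmin r0 r); set (beta := Rmax r0 r).
assert (ha : 0 < alpha) by (apply Rmin_pos; lra).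
assert (hb : beta < 1) by (apply Rmax_lub_lt; lra).
assert (hl0 : alpha <= r0 <= beta) by (split; [apply Rmin_l|apply Rmax_l]).
assert (hlr : alpha <= r <= beta) by (split; [apply Rmin_r|apply Rmax_r]).
(* The second derivative is only known to exist pointwise; choice turns it into a function from
   which the derivative of [E] is built. *)
destruct (fun_choice (fun r l => 0 < r < 1 -> RCd v1 r l /\
     (RtoC (r ^ 2) * l + RtoC r * v1 r)%C = (radial_coef lambda m r * v r)%C)) as [l hl].
{ intros s; destruct (Rlt_dec 0 s) as [h1|h1]; [destruct (Rlt_dec s 1) as [h2|h2]|].
  - destruct (hV s (conj h1 h2)) as [l hl]; now exists l.
  - exists (RtoC 0); intros; lra.
  - exists (RtoC 0); intros; lra. }
set (E := fun r => (Re (v r) * Re (v r) + Im (v r) * Im (v r)) + (Re (v1 r) * Re (v1 r) + Im (v1 r) * Im (v1 r))).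
set (dE := fun r => 2 * (Re (v r) * Re (v1 r) + Im (v r) * Im (v1 r)) + 2 * (Re (v1 r) * Re (l r) + Im (v1 r) * Im (l r))).
(* [Q] bounds |radial_coef| / s^2 on the interval. In [M], the 1 comes from the product of v and v1,
   2 / alpha from the first-order term, and [Q] from 2 Q |v| |v1|. *)
set (Q := (IZR m ^ 2 + Cmod lambda * (4 / (1 - beta ^ 2) ^ 2)) / alpha ^ 2).
set (M := 1 + 2 / alpha + Q).
assert (hE : forall s, E s = Cmod (v s) * Cmod (v s) + Cmod (v1 s) * Cmod (v1 s))
  by (intro s; unfold E; now rewrite !Cmod_sqr).
assert (hz : E r = 0).
{ apply (gronwall_zero E dE M alpha beta r0); auto.
  - intros s hs; destruct (hv s ltac:(lra)) as [d1 d2]; destruct (hl s ltac:(lra)) as [[d3 d4] _].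
    unfold E; evar_last.
    { apply (is_derive_plus (K := R_AbsRing) (V := R_NormedModule));
      apply (is_derive_plus (K := R_AbsRing) (V := R_NormedModule));
      apply (is_derive_mult (K := R_AbsRing)); eauto using Rmult_comm. }
    unfold dE, plus, mult; simpl; ring.
  - intros s hs; rewrite hE; nra.
  - intros s hs; destruct (hl s ltac:(lra)) as [_ eq].
    assert (hs0 : 0 < s < 1) by lra.
    assert (hp : 0 < s ^ 2) by (apply pow_lt; lra).
    assert (hab : 0 < alpha ^ 2) by (apply pow_lt; lra).
    assert (hb2 : 0 < 1 - beta ^ 2) by (simpl; nra).
    assert (hs2 : 1 - beta ^ 2 <= 1 - s ^ 2) by (simpl; nra).
    assert (hcoef : Cmod (radial_coef lambda m s) <= IZR m ^ 2 + Cmod lambda * (4 / (1 - beta ^ 2) ^ 2)).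
    { unfold radial_coef; eapply Rle_trans; [apply Cmod_triangle|]; rewrite Cmod_mult, !Cmod_R.
      rewrite (Rabs_pos_eq (IZR m ^ 2)) by apply pow2_ge_0.
      apply Rplus_le_compat_l, Rmult_le_compat_l; [apply Cmod_ge_0|].
      assert (hd : 0 < (1 - beta ^ 2) ^ 2) by now apply pow_lt.
      assert (hd' : (1 - beta ^ 2) ^ 2 <= (1 - s ^ 2) ^ 2) by (apply pow_incr; lra).
      rewrite Rabs_pos_eq.
      - apply Rmult_le_compat; [lra|left; apply Rinv_0_lt_compat; lra|simpl; nra|].
        now apply Rinv_le_contravar.
      - apply Rmult_le_pos; [lra|left; apply Rinv_0_lt_compat; lra]. }
    assert (hll : Cmod (l s) <= Cmod (v1 s) / alpha + Q * Cmod (v s)).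
    { assert (e : (RtoC (s ^ 2) * l s)%C = (radial_coef lambda m s * v s - RtoC s * v1 s)%C)
        by (rewrite <- eq; ring).
      apply (f_equal Cmod) in e; rewrite Cmod_mult, Cmod_R, Rabs_pos_eq in e by lra.
      assert (e2 : s ^ 2 * Cmod (l s) <= (IZR m ^ 2 + Cmod lambda * (4 / (1 - beta ^ 2) ^ 2)) * Cmod (v s)
        + s * Cmod (v1 s)).
      { rewrite e; eapply Rle_trans; [apply Cmod_triangle|]; rewrite Cmod_opp, !Cmod_mult, Cmod_R, Rabs_pos_eq by lra.
        apply Rplus_le_compat_r, Rmult_le_compat_r; [apply Cmod_ge_0|easy]. }
      set (q := IZR m ^ 2 + Cmod lambda * (4 / (1 - beta ^ 2) ^ 2)) in *.
      assert (hq0 : 0 <= q) by (eapply Rle_trans; [apply Cmod_ge_0|apply hcoef]).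
      assert (n1 := Cmod_ge_0 (v s)); assert (n2 := Cmod_ge_0 (v1 s)).
      apply (Rmult_le_reg_l (s ^ 2)); [easy|]; eapply Rle_trans; [apply e2|].
      rewrite Rmult_plus_distr_l, Rplus_comm; apply Rplus_le_compat.
      - replace (s ^ 2 * (Cmod (v1 s) / alpha)) with (s * Cmod (v1 s) * (s / alpha)) by (field; lra).
        assert (1 <= s / alpha).
        { apply (Rmult_le_reg_r alpha); [easy|]; unfold Rdiv; rewrite Rmult_assoc, Rinv_l; lra. }
        assert (0 <= s * Cmod (v1 s)) by nra. nra.
      - unfold Q; replace (s ^ 2 * (q / alpha ^ 2 * Cmod (v s))) with (q * Cmod (v s) * (s ^ 2 / alpha ^ 2)) by (field; lra).
        assert (1 <= s ^ 2 / alpha ^ 2).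
        { apply (Rmult_le_reg_r (alpha ^ 2)); [easy|]; unfold Rdiv; rewrite Rmult_assoc, Rinv_l by lra.
          rewrite Rmult_1_r, Rmult_1_l; apply pow_incr; lra. }
        assert (0 <= q * Cmod (v s)) by nra. nra. }
    assert (hQ : 0 <= Q).
    { apply Rmult_le_pos; [|left; now apply Rinv_0_lt_compat].
      eapply Rle_trans; [apply Cmod_ge_0|apply hcoef]. }
    rewrite hE; unfold dE.
    assert (b1 := Re_conj_bound (v s) (v1 s)); assert (b2 := Re_conj_bound (v1 s) (l s)).
    eapply Rle_trans; [apply Rabs_triang|]; rewrite !Rabs_mult, (Rabs_pos_eq 2) by lra.
    assert (n1 := Cmod_ge_0 (v s)); assert (n2 := Cmod_ge_0 (v1 s)); assert (n3 := Cmod_ge_0 (l s)).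
    assert (hal : 0 < / alpha) by (now apply Rinv_0_lt_compat).
    assert (b3 : Cmod (v1 s) * Cmod (l s) <= Cmod (v1 s) * (Cmod (v1 s) / alpha + Q * Cmod (v s)))
      by now apply Rmult_le_compat_l.
    unfold M, Rdiv in *.
    set (x := Cmod (v s)) in *; set (y := Cmod (v1 s)) in *; set (ia := / alpha) in *.
    assert (xy : 2 * (x * y) <= x * x + y * y) by (generalize (Rle_0_sqr (x - y)); unfold Rsqr; nra).
    assert (Q * (2 * (x * y)) <= Q * (x * x + y * y)) by (apply Rmult_le_compat_l; lra).
    assert (0 <= ia * (x * x)) by (apply Rmult_le_pos; nra).
    replace (y * (y * ia + Q * x)) with (ia * (y * y) + Q * (x * y)) in b3 by ring.
    nra.
  - rewrite hE, e0, e1, Cmod_0; ring. }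
rewrite hE in hz; apply Cmod_eq_0.
generalize (Cmod_ge_0 (v r)); nra.
Qed.

Lemma radial_minus_scal lambda m a a1 b b1 c : radial lambda m a a1 -> radial lambda m b b1 ->
  radial lambda m (fun r => a r - c * b r)%C (fun r => a1 r - c * b1 r)%C.
Proof.
intros (ha & hA & ea & Ba & hea & hba) (hb & hB & eb & Bb & heb & hbb); split; [|split].
- intros r hr; apply RCd_minus; [now apply ha|apply RCd_scal, hb, hr].
- intros r hr; destruct (hA r hr) as (la & hla & eqa); destruct (hB r hr) as (lb & hlb & eqb).
  exists (la - c * lb)%C; split.
  + apply RCd_minus; [easy|now apply RCd_scal].
  + transitivity ((RtoC (r ^ 2) * la + RtoC r * a1 r) - c * (RtoC (r ^ 2) * lb + RtoC r * b1 r))%C; [ring|].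
    rewrite eqa, eqb; ring.
- exists (Rmin ea eb), (Ba + Cmod c * Bb); split.
  + split; [apply Rmin_pos; lra|]. generalize (Rmin_l ea eb); lra.
  + intros r hr; assert (h1 := Rmin_l ea eb); assert (h2 := Rmin_r ea eb).
    destruct (hba r ltac:(lra)) as [p1 p2]; destruct (hbb r ltac:(lra)) as [p3 p4].
    assert (hc := Cmod_ge_0 c).
    split; (eapply Rle_trans; [apply Cmod_triangle|]); rewrite Cmod_opp, Cmod_mult;
      apply Rplus_le_compat; auto; now apply Rmult_le_compat_l.
Qed.

(** Normalise a - c b to vanish at r0; the Wronskian makes its derivative vanish there too. *)
Lemma radial_proportional lambda m a a1 b b1 r0 : radial lambda m a a1 -> radial lambda m b b1 ->
  0 < r0 < 1 -> b r0 <> 0%C -> exists c, forall r, 0 < r < 1 -> a r = (c * b r)%C.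
Proof.
intros ha hb h0 hne; set (c := (a r0 / b r0)%C); exists c; intros r hr.
assert (e : (a r - c * b r)%C = 0%C).
{ apply (radial_zero lambda m _ _ r0 (radial_minus_scal lambda m a a1 b b1 c ha hb)); auto.
  - unfold c; field; easy.
  - assert (hw := wronskian_zero lambda m a a1 b b1 ha hb r0 h0).
    replace (a1 r0 - c * b1 r0)%C with ((a1 r0 * b r0 - a r0 * b1 r0) / b r0)%C by (unfold c; field; easy).
    rewrite hw; field; easy. }
replace (a r) with (a r - c * b r + c * b r)%C by ring; rewrite e; ring.
Qed.

(** * Functions of class C^k on the disk *)

Definition Ccont (f : C -> C) (z : C) : Prop :=
  forall eps, 0 < eps -> exists d, 0 < d /\ forall w, Cmod (w - z)%C < d -> Cmod (f w - f z)%C < eps.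

Lemma Ccont_continuous f z : Ccont f z <-> continuous f z.
Proof.
split.
- intros h; apply filterlim_locally; intros eps.
  destruct (h eps (cond_pos eps)) as [d [hd h']].
  assert (hd2 : 0 < d / 2) by lra.
  exists (mkposreal _ hd2); intros w hw; apply ball_Cmod, h'.
  apply Cmod_ball in hw; simpl in hw; lra.
- intros h eps he; assert (he2 : 0 < eps / 2) by lra.
  destruct (proj1 (filterlim_locally f (f z)) h (mkposreal _ he2)) as [d hd].
  exists d; split; [apply d|]; intros w hw; specialize (hd w (ball_Cmod _ _ _ hw)).
  apply Cmod_ball in hd; simpl in hd; lra.
Qed.

Lemma is_derive_eps (f : R -> R) t l : is_derive f t l <->
  forall eps, 0 < eps -> exists d, 0 < d /\ forall s, Rabs (s - t) < d ->
    Rabs (f s - f t - l * (s - t)) <= eps * Rabs (s - t).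
Proof.
split.
- intros [_ h] eps he; destruct (h t (fun P hP => hP) (mkposreal eps he)) as [d hd].
  exists d; split; [apply d|]; intros s hs; specialize (hd s hs).
  change (Rabs (f s - f t - (s - t) * l) <= eps * Rabs (s - t)) in hd.
  now rewrite (Rmult_comm l).
- intros h; split; [apply (is_linear_scal_l (V := R_NormedModule) l)|].
  intros x hx; apply (is_filter_lim_locally_unique (V := R_NormedModule)) in hx; rewrite <- hx; clear x hx.
  intros eps; destruct (h eps (cond_pos eps)) as [d [hd h']].
  exists (mkposreal d hd); intros s hs.
  change (Rabs (f s - f t - (s - t) * l) <= eps * Rabs (s - t)).
  rewrite (Rmult_comm _ l); now apply h'.
Qed.

Lemma RCd_eps phi t l : RCd phi t l <->
  forall eps, 0 < eps -> exists d, 0 < d /\ forall s, Rabs (s - t) < d ->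
    Cmod (phi s - phi t - l * RtoC (s - t))%C <= eps * Rabs (s - t).
Proof.
split.
- intros [h1 h2] eps he.
  destruct (proj1 (is_derive_eps _ _ _) h1 (eps / 2)) as [d1 [p1 q1]]; [lra|].
  destruct (proj1 (is_derive_eps _ _ _) h2 (eps / 2)) as [d2 [p2 q2]]; [lra|].
  exists (Rmin d1 d2); split; [now apply Rmin_pos|]; intros s hs.
  specialize (q1 s (Rlt_le_trans _ _ _ hs (Rmin_l _ _))).
  specialize (q2 s (Rlt_le_trans _ _ _ hs (Rmin_r _ _))).
  eapply Rle_trans; [apply Cmod_le_sum|]; unfold Re, Im in *; simpl.
  replace (fst l * (s - t) - snd l * 0) with (fst l * (s - t)) by ring.
  replace (fst l * 0 + snd l * (s - t)) with (snd l * (s - t)) by ring.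
  unfold Rminus in *; lra.
- intros h; split; apply is_derive_eps; intros eps he; destruct (h eps he) as [d [hd h']];
    exists d; split; auto; intros s hs; specialize (h' s hs).
  + apply Rle_trans with (2 := h'), Rle_trans with (2 := Cmod_Re _); unfold Re; simpl; right; f_equal; ring.
  + apply Rle_trans with (2 := h'), Rle_trans with (2 := Cmod_Im _); unfold Im; simpl; right; f_equal; ring.
Qed.

Lemma RCd_remainder (phi : R -> C) s t (l : C) : (phi s - phi t - l * RtoC (s - t))%C =
  minus (minus (phi s) (phi t)) (scal (V := C_R_NormedModule) (minus s t) l).
Proof.
apply C_ext.
- transitivity (fst (phi s) + - fst (phi t) + - ((s + - t) * fst l)); [|reflexivity].
  unfold Re; simpl; unfold Rminus; ring.
- transitivity (snd (phi s) + - snd (phi t) + - ((s + - t) * snd l)); [|reflexivity].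
  unfold Im; simpl; unfold Rminus; ring.
Qed.

Lemma RCd_is_derive phi t l : RCd phi t l <-> is_derive (V := C_R_NormedModule) phi t l.
Proof.
rewrite RCd_eps; split.
- intros h; split; [apply (is_linear_scal_l (V := C_R_NormedModule) l)|].
  intros x hx; apply (is_filter_lim_locally_unique (V := R_NormedModule)) in hx; rewrite <- hx; clear x hx.
  intros eps; destruct (h eps (cond_pos eps)) as [d [hd h']].
  exists (mkposreal d hd); intros s hs; specialize (h' s hs).
  rewrite RCd_remainder, Cmod_norm in h'; exact h'.
- intros [_ h] eps he; destruct (h t (fun P hP => hP) (mkposreal eps he)) as [d hd].
  exists d; split; [apply d|]; intros s hs; specialize (hd s hs).
  rewrite RCd_remainder, Cmod_norm; exact hd.
Qed.

Lemma RCd_Derive phi t l : RCd phi t l ->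
  l = (Derive (fun u => Re (phi u)) t, Derive (fun u => Im (phi u)) t).
Proof. intros [h1 h2]; apply C_ext; symmetry; now apply is_derive_unique. Qed.

Lemma ex_derive_RCd phi t : ex_derive (V := C_R_NormedModule) phi t ->
  RCd phi t (Derive (fun u => Re (phi u)) t, Derive (fun u => Im (phi u)) t).
Proof.
intros [l hl]; apply RCd_is_derive in hl; now rewrite <- (RCd_Derive _ _ _ hl).
Qed.

Lemma disk_open z : disk z -> exists d, 0 < d /\ forall w, Cmod (w - z)%C < d -> disk w.
Proof.
unfold disk; intros hz; exists (1 - Cmod z); split; [lra|]; intros w hw.
generalize (Cmod_diff_bound z w) (Rle_abs (Cmod w - Cmod z)); lra.
Qed.

Lemma disk_open_2d z : disk z -> exists d, 0 < d /\ forall s t,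
  Rabs (s - Re z) < d -> Rabs (t - Im z) < d -> disk (s, t).
Proof.
intros hz; destruct (disk_open z hz) as [d [hd h]]; exists (d / 2); split; [lra|]; intros s t hs ht.
apply h; eapply Rle_lt_trans; [apply Cmod_le_sum|]; unfold Re, Im, Rminus in *; simpl; lra.
Qed.

Lemma Ck_continuous k f z : Ck_disk k f -> disk z -> Ccont f z.
Proof. intros h hz; apply Ccont_continuous; destruct k; now apply h. Qed.

Lemma Ck_Dx k f : Ck_disk (S k) f -> Ck_disk k (Defs.Dx f).
Proof. intros h; apply h. Qed.

Lemma Ck_Dy k f : Ck_disk (S k) f -> Ck_disk k (Defs.Dy f).
Proof. intros h; apply h. Qed.

Lemma Ck_RCd_x k f z : Ck_disk (S k) f -> disk z -> RCd (fun t => f (t, Im z)) (Re z) (Defs.Dx f z).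
Proof. intros (_ & h & _) hz; apply ex_derive_RCd, h, hz. Qed.

Lemma Ck_RCd_y k f z : Ck_disk (S k) f -> disk z -> RCd (fun t => f (Re z, t)) (Im z) (Defs.Dy f z).
Proof. intros (_ & h & _) hz; apply ex_derive_RCd, h, hz. Qed.

Lemma Ccont_2d f x y : Ccont f (x, y) ->
  continuity_2d_pt (fun s t => Re (f (s, t))) x y /\ continuity_2d_pt (fun s t => Im (f (s, t))) x y.
Proof.
intros h; split; intros eps; destruct (h eps (cond_pos eps)) as [d [hd h']];
  assert (hd2 : 0 < d / 2) by lra; exists (mkposreal _ hd2); simpl; intros s t hs ht;
  (eapply Rle_lt_trans; [|apply (h' (s, t))]).
- apply Rle_trans with (2 := Cmod_Re _); unfold Re, Rminus; simpl; lra.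
- eapply Rle_lt_trans; [apply Cmod_le_sum|]; unfold Re, Im, Rminus in *; simpl; lra.
- apply Rle_trans with (2 := Cmod_Im _); unfold Im, Rminus; simpl; lra.
- eapply Rle_lt_trans; [apply Cmod_le_sum|]; unfold Re, Im, Rminus in *; simpl; lra.
Qed.

Lemma Ck_differentiable f x y : Ck_disk 1 f -> disk (x, y) ->
  differentiable_pt_lim (fun s t => Re (f (s, t))) x y (Re (Defs.Dx f (x, y))) (Re (Defs.Dy f (x, y))) /\
  differentiable_pt_lim (fun s t => Im (f (s, t))) x y (Im (Defs.Dx f (x, y))) (Im (Defs.Dy f (x, y))).
Proof.
intros h hz; destruct (disk_open_2d _ hz) as [d [hd ho]]; unfold Re, Im in ho; simpl in ho.
destruct (Ccont_2d _ _ _ (Ck_continuous 0 _ _ (Ck_Dx 0 f h) hz)) as [c1 c2].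
destruct (Ck_RCd_y 0 f _ h hz) as [k1 k2]; simpl in k1, k2.
split.
- apply (differentiable_pt_lim_partial _ (fun s t => Re (Defs.Dx f (s, t)))); auto.
  exists (mkposreal d hd); simpl; intros s t hs ht; apply (Ck_RCd_x 0 f (s, t) h); auto.
- apply (differentiable_pt_lim_partial _ (fun s t => Im (Defs.Dx f (s, t)))); auto.
  exists (mkposreal d hd); simpl; intros s t hs ht; apply (Ck_RCd_x 0 f (s, t) h); auto.
Qed.

Lemma chain_rule f (a b : R -> R) t da db : Ck_disk 1 f -> disk (a t, b t) ->
  is_derive a t da -> is_derive b t db ->
  RCd (fun u => f (a u, b u)) t (RtoC da * Defs.Dx f (a t, b t) + RtoC db * Defs.Dy f (a t, b t))%C.
Proof.
intros h hz ha hb; destruct (Ck_differentiable f _ _ h hz) as [k1 k2].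
apply is_derive_Reals in ha, hb.
split; apply is_derive_Reals.
- evar_last; [apply (derivable_pt_lim_comp_2d _ _ _ _ _ _ _ _ k1 ha hb)|].
  unfold Re; simpl; ring.
- evar_last; [apply (derivable_pt_lim_comp_2d _ _ _ _ _ _ _ _ k2 ha hb)|].
  unfold Im; simpl; ring.
Qed.

(** * Polar coordinates *)

Definition jcont (psi : R -> R -> C) (r t : R) : Prop :=
  continuity_2d_pt (fun u v => Re (psi u v)) r t /\ continuity_2d_pt (fun u v => Im (psi u v)) r t.

Lemma jcont_plus f g r t : jcont f r t -> jcont g r t -> jcont (fun u v => f u v + g u v)%C r t.
Proof. intros [h1 h2] [h3 h4]; split; apply continuity_2d_pt_plus; easy. Qed.

Lemma jcont_mult f g r t : jcont f r t -> jcont g r t -> jcont (fun u v => f u v * g u v)%C r t.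
Proof.
intros [h1 h2] [h3 h4]; split.
- apply continuity_2d_pt_minus; apply continuity_2d_pt_mult; easy.
- apply continuity_2d_pt_plus; apply continuity_2d_pt_mult; easy.
Qed.

Lemma jcont_snd (g : R -> R) (r t : R) : continuous g t -> jcont (fun _ v => RtoC (g v)) r t.
Proof.
intros h; split; [|exact (continuity_2d_pt_const r t 0)].
apply (continuity_1d_2d_pt_comp g (fun _ v => v)); [|apply continuity_2d_pt_id2].
now apply continuity_pt_filterlim.
Qed.

Lemma jcont_slice psi r t : jcont psi r t -> RCc (psi r) t.
Proof.
intros [h1 h2]; split; apply continuous_eps; intros eps he.
- destruct (h1 (mkposreal eps he)) as [d hd]; exists d; split; [apply d|]; intros u hu; apply hd; auto.
  rewrite Rminus_diag, Rabs_R0; apply d.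
- destruct (h2 (mkposreal eps he)) as [d hd]; exists d; split; [apply d|]; intros u hu; apply hd; auto.
  rewrite Rminus_diag, Rabs_R0; apply d.
Qed.

Definition pol (r t : R) : C := (r * cos t, r * sin t).

Lemma pol_eit r t : pol r t = (RtoC r * eit t)%C.
Proof. apply C_ext; unfold pol, eit; simpl; ring. Qed.

Lemma pol_disk r t : 0 <= r < 1 -> disk (pol r t).
Proof. intros h; unfold disk; rewrite pol_eit, Cmod_polar; lra. Qed.

Lemma pol_lip r t r' t' : Cmod (pol r' t' - pol r t)%C <= Rabs (r' - r) + 2 * Rabs r * Rabs (t' - t).
Proof.
rewrite !pol_eit; replace (r' * eit t' - r * eit t)%C with
  (RtoC (r' - r) * eit t' + r * (eit t' - eit t))%C by (rewrite RtoC_minus; ring).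
eapply Rle_trans; [apply Cmod_triangle|]; rewrite !Cmod_mult, eit_mod, !Cmod_R.
generalize (eit_lip t' t) (Rabs_pos r); nra.
Qed.

Lemma jcont_pol f r t : Ccont f (pol r t) -> jcont (fun u v => f (pol u v)) r t.
Proof.
intros h.
assert (hh : forall eps, 0 < eps -> exists d : posreal, forall u v, Rabs (u - r) < d -> Rabs (v - t) < d ->
  Cmod (f (pol u v) - f (pol r t))%C < eps).
{ intros eps he; destruct (h eps he) as [d [hd h']].
  assert (hr := Rabs_pos r).
  assert (hd2 : 0 < d / (1 + 2 * Rabs r)) by (apply Rdiv_lt_0_compat; lra).
  exists (mkposreal _ hd2); simpl; intros u v hu hv; apply h'.
  eapply Rle_lt_trans; [apply pol_lip|].
  apply Rlt_le_trans with ((1 + 2 * Rabs r) * (d / (1 + 2 * Rabs r))); [nra|right; field; lra]. }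
split; intros eps; destruct (hh eps (cond_pos eps)) as [d hd]; exists d; intros u v hu hv;
  (eapply Rle_lt_trans; [|apply (hd u v hu hv)]).
- apply Rle_trans with (2 := Cmod_Re _); unfold Re, Rminus; simpl; lra.
- apply Rle_trans with (2 := Cmod_Im _); unfold Im, Rminus; simpl; lra.
Qed.

Lemma mean_param (psi dpsi : R -> R -> C) r0 d : 0 < d ->
  (forall r t, Rabs (r - r0) < d -> RCd (fun u => psi u t) r (dpsi r t)) ->
  (forall r, Rabs (r - r0) < d -> RCcont (psi r)) -> (forall t, jcont dpsi r0 t) ->
  RCd (fun r => mean (psi r)) r0 (mean (dpsi r0)).
Proof.
intros hd hder hc hj; unfold mean; apply RCd_scal.
assert (hloc : forall P : R -> Prop, (forall r, Rabs (r - r0) < d -> P r) -> locally r0 P).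
{ intros P hP; exists (mkposreal d hd); intros y hy; now apply hP. }
split; cbn [CInt Re Im fst snd].
- evar_last.
  + apply (is_derive_RInt_param (fun r t => Re (psi r t))).
    * apply hloc; intros r hr t _; exists (Re (dpsi r t)); exact (proj1 (hder r t hr)).
    * intros t _; apply continuity_2d_pt_ext_loc with (2 := proj1 (hj t)).
      exists (mkposreal d hd); simpl; intros u v hu _; symmetry; apply is_derive_unique; exact (proj1 (hder u v hu)).
    * apply hloc; intros r hr; apply ex_RInt_cont; intros t; exact (proj1 (hc r hr t)).
  + apply RInt_ext; intros t _; apply is_derive_unique.
    assert (h0 : Rabs (r0 - r0) < d) by (rewrite Rminus_diag, Rabs_R0; lra).
    exact (proj1 (hder r0 t h0)).
- evar_last.
  + apply (is_derive_RInt_param (fun r t => Im (psi r t))).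
    * apply hloc; intros r hr t _; exists (Im (dpsi r t)); exact (proj2 (hder r t hr)).
    * intros t _; apply continuity_2d_pt_ext_loc with (2 := proj2 (hj t)).
      exists (mkposreal d hd); simpl; intros u v hu _; symmetry; apply is_derive_unique; exact (proj2 (hder u v hu)).
    * apply hloc; intros r hr; apply ex_RInt_cont; intros t; exact (proj2 (hc r hr t)).
  + apply RInt_ext; intros t _; apply is_derive_unique.
    assert (h0 : Rabs (r0 - r0) < d) by (rewrite Rminus_diag, Rabs_R0; lra).
    exact (proj2 (hder r0 t h0)).
Qed.

Lemma fourier_param (psi dpsi : R -> R -> C) m r0 d : 0 < d ->
  (forall r t, Rabs (r - r0) < d -> RCd (fun u => psi u t) r (dpsi r t)) ->
  (forall r, Rabs (r - r0) < d -> RCcont (psi r)) -> (forall t, jcont dpsi r0 t) ->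
  RCd (fun r => fourier (psi r) m) r0 (fourier (dpsi r0) m).
Proof.
intros hd hder hc hj; apply (mean_param (fun r t => psi r t * em (- m) t)%C
  (fun r t => dpsi r t * em (- m) t)%C r0 d hd).
- intros r t hr; eapply RCd_ext; [intro; reflexivity| |apply RCd_mult; [now apply hder|apply RCd_const]].
  simpl; ring.
- intros r hr; apply RCcont_mult; auto using RCcont_em.
- intros t; apply jcont_mult; auto; split.
  + apply (continuity_1d_2d_pt_comp (fun v => Re (em (- m) v)) (fun _ v => v)); [|apply continuity_2d_pt_id2].
    apply continuity_pt_filterlim; exact (proj1 (RCc_em (- m) t)).
  + apply (continuity_1d_2d_pt_comp (fun v => Im (em (- m) v)) (fun _ v => v)); [|apply continuity_2d_pt_id2].
    apply continuity_pt_filterlim; exact (proj2 (RCc_em (- m) t)).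
Qed.

Definition harmonic (lambda : C) (f : C -> C) : Prop :=
  Ck_disk 2 f /\ forall z, disk z -> laplacian_minus lambda f z = 0%C.

Definition rad_deriv (f : C -> C) (r t : R) : C :=
  (RtoC (cos t) * Defs.Dx f (pol r t) + RtoC (sin t) * Defs.Dy f (pol r t))%C.

Definition ang_deriv (f : C -> C) (r t : R) : C :=
  (RtoC (- (r * sin t)) * Defs.Dx f (pol r t) + RtoC (r * cos t) * Defs.Dy f (pol r t))%C.

Lemma RCd_rad f r t : Ck_disk 1 f -> 0 < r < 1 -> RCd (fun u => f (pol u t)) r (rad_deriv f r t).
Proof.
intros h hr; eapply RCd_ext; [| |apply (chain_rule f (fun u => u * cos t) (fun u => u * sin t) r (cos t) (sin t) h)].
- easy.
- easy.
- apply pol_disk; lra.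
- auto_derive; [easy|ring].
- auto_derive; [easy|ring].
Qed.

Lemma RCd_ang f r t : Ck_disk 1 f -> 0 < r < 1 -> RCd (fun v => f (pol r v)) t (ang_deriv f r t).
Proof.
intros h hr; eapply RCd_ext; [| |apply (chain_rule f (fun v => r * cos v) (fun v => r * sin v) t
  (- (r * sin t)) (r * cos t) h)].
- easy.
- easy.
- apply pol_disk; lra.
- auto_derive; [easy|ring].
- auto_derive; [easy|ring].
Qed.

Lemma Ck_S k f : Ck_disk (S k) f -> Ck_disk k f.
Proof.
revert f; induction k as [|k ih]; intros f h.
- split; [apply h|easy].
- split; [apply h|]; split; [apply h|]; split; apply ih; apply h.
Qed.

Lemma jcont_pol_Ck k f r t : Ck_disk k f -> 0 < r < 1 -> jcont (fun u v => f (pol u v)) r t.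
Proof. intros h hr; apply jcont_pol, (Ck_continuous k); auto; apply pol_disk; lra. Qed.

Lemma jcont_trig (g : R -> R) r t : (forall v, ex_derive g v) -> jcont (fun _ v => RtoC (g v)) r t.
Proof. intros h; apply jcont_snd, (ex_derive_continuous (K := R_AbsRing) (V := R_NormedModule)), h. Qed.

Lemma periodic_pol (f : C -> C) r : periodic (fun t => f (pol r t)).
Proof.
intros t; unfold pol; replace (t + 2 * PI) with (t + 2 * INR 1 * PI) by (simpl; ring).
now rewrite cos_period, sin_period.
Qed.

Lemma cos_2PI_period t : cos (t + 2 * PI) = cos t.
Proof. replace (t + 2 * PI) with (t + 2 * INR 1 * PI) by (simpl; ring); apply cos_period. Qed.

Lemma sin_2PI_period t : sin (t + 2 * PI) = sin t.
Proof. replace (t + 2 * PI) with (t + 2 * INR 1 * PI) by (simpl; ring); apply sin_period. Qed.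

Lemma jcont_rad f r t : Ck_disk 1 f -> 0 < r < 1 -> jcont (rad_deriv f) r t.
Proof.
intros h hr; apply jcont_plus; apply jcont_mult.
- apply (jcont_trig cos); intros; auto_derive; easy.
- apply (jcont_pol_Ck 0 (Defs.Dx f)); auto; apply h.
- apply (jcont_trig sin); intros; auto_derive; easy.
- apply (jcont_pol_Ck 0 (Defs.Dy f)); auto; apply h.
Qed.

Lemma RCcont_jcont psi r : (forall t, jcont psi r t) -> RCcont (psi r).
Proof. intros h t; now apply jcont_slice. Qed.

(** Write the Laplacian in polar coordinates and take the Fourier coefficient in t: each angular
    derivative becomes a factor i m by integration by parts. *)
Lemma harmonic_radial lambda f m : harmonic lambda f ->
  radial lambda m (fun r => fourier (fun t => f (pol r t)) m) (fun r => fourier (rad_deriv f r) m).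
Proof.
intros [hC2 hL].
assert (hC1 : Ck_disk 1 f) by now apply Ck_S.
assert (hx : Ck_disk 1 (Defs.Dx f)) by apply hC2; assert (hy : Ck_disk 1 (Defs.Dy f)) by apply hC2.
assert (hball : forall r, 0 < r < 1 -> exists d, 0 < d /\ forall s, Rabs (s - r) < d -> 0 < s < 1).
{ intros r hr; exists (Rmin r (1 - r)); split; [apply Rmin_pos; lra|]; intros s hs.
  assert (h1 := Rmin_l r (1 - r)); assert (h2 := Rmin_r r (1 - r)).
  apply Rabs_lt_between in hs; lra. }
split; [|split].
- intros r hr; destruct (hball r hr) as [d [hd hs]].
  apply (fourier_param (fun r t => f (pol r t)) (rad_deriv f) m r d hd).
  + intros s t hst; apply RCd_rad; auto.
  + intros s hst; apply (RCcont_jcont (fun r t => f (pol r t))); intros t; apply (jcont_pol_Ck 1); auto.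
  + intros t; now apply jcont_rad.
- intros r hr; destruct (hball r hr) as [d [hd hs]].
  set (rr := fun r t => (RtoC (cos t) * rad_deriv (Defs.Dx f) r t + RtoC (sin t) * rad_deriv (Defs.Dy f) r t)%C).
  assert (hjrr : forall t, jcont rr r t).
  { intros t; apply jcont_plus; apply jcont_mult; try (now apply jcont_rad).
    - apply (jcont_trig cos); intros; auto_derive; easy.
    - apply (jcont_trig sin); intros; auto_derive; easy. }
  exists (fourier (rr r) m); split.
  + apply (fourier_param (rad_deriv f) rr m r d hd); auto.
    * intros s t hst; apply RCd_plus; apply RCd_scal; apply RCd_rad; auto.
    * intros s hst; apply RCcont_jcont; intros t; apply jcont_rad; auto.
  (* The second angular derivative of f, expanded by the product rule from [ang_deriv]. *)
  + set (tt := fun t => ((RtoC (- (r * cos t)) * Defs.Dx f (pol r t) + RtoC (- (r * sin t)) * ang_deriv (Defs.Dx f) r t)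
       + (RtoC (- (r * sin t)) * Defs.Dy f (pol r t) + RtoC (r * cos t) * ang_deriv (Defs.Dy f) r t))%C).
    assert (hcp : forall g, Ck_disk 0 g -> RCcont (fun t => g (pol r t))).
    { intros g hg; apply (RCcont_jcont (fun r t => g (pol r t))); intros t; now apply (jcont_pol_Ck 0). }
    assert (htr : forall g : R -> R, (forall v, ex_derive g v) -> RCcont (fun t => RtoC (g t))).
    { intros g hg t; apply RCc_RtoC, (ex_derive_continuous (K := R_AbsRing) (V := R_NormedModule)), hg. }
    assert (e1 : forall v, ex_derive (fun t => - (r * sin t)) v) by (intros; auto_derive; easy).
    assert (e2 : forall v, ex_derive (fun t => r * cos t) v) by (intros; auto_derive; easy).
    assert (e3 : forall v, ex_derive (fun t => - (r * cos t)) v) by (intros; auto_derive; easy).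
    assert (hca : forall g, Ck_disk 1 g -> RCcont (ang_deriv g r)).
    { intros g hg t; apply RCc_plus; apply RCc_mult.
      - apply (htr _ e1).
      - apply (hcp (Defs.Dx g)); apply hg.
      - apply (htr _ e2).
      - apply (hcp (Defs.Dy g)); apply hg. }
    assert (hctt : RCcont tt).
    { intros t; apply RCc_plus; apply RCc_plus; apply RCc_mult.
      - exact (htr _ e3 t).
      - exact (hcp (Defs.Dx f) (Ck_S 0 _ hx) t).
      - exact (htr _ e1 t).
      - exact (hca (Defs.Dx f) hx t).
      - exact (htr _ e1 t).
      - exact (hcp (Defs.Dy f) (Ck_S 0 _ hy) t).
      - exact (htr _ e2 t).
      - exact (hca (Defs.Dy f) hy t). }
    assert (hpa : periodic (ang_deriv f r)).
    { intros t; unfold ang_deriv; rewrite cos_2PI_period, sin_2PI_period.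
      now rewrite (periodic_pol (Defs.Dx f) r t), (periodic_pol (Defs.Dy f) r t). }
    assert (f1 : fourier (ang_deriv f r) m = (Ci * RtoC (IZR m) * fourier (fun t => f (pol r t)) m)%C).
    { apply fourier_derive; [apply periodic_pol|intros t; now apply RCd_ang|now apply hca]. }
    assert (f2 : fourier tt m = (Ci * RtoC (IZR m) * fourier (ang_deriv f r) m)%C).
    { apply fourier_derive; auto. intros t; apply RCd_plus.
      - apply (RCd_mult (fun t => RtoC (- (r * sin t))) (fun t => Defs.Dx f (pol r t))).
        + apply (RCd_RtoC (fun t => - (r * sin t))); auto_derive; [easy|ring].
        + now apply (RCd_ang (Defs.Dx f)).
      - apply (RCd_mult (fun t => RtoC (r * cos t)) (fun t => Defs.Dy f (pol r t))).
        + apply (RCd_RtoC (fun t => r * cos t)); auto_derive; [easy|ring].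
        + now apply (RCd_ang (Defs.Dy f)). }
    (* The polar identity r^2 Laplacian = r^2 f_rr + r f_r + f_tt; the mixed derivatives from [rr]
       and [tt] cancel term by term, as do the first-order ones. *)
    assert (hid : forall t, (RtoC (r ^ 2) * rr r t + RtoC r * rad_deriv f r t + tt t)%C =
      ((lambda * RtoC (4 * r ^ 2 / (1 - r ^ 2) ^ 2)) * f (pol r t))%C).
    { intros t; assert (hz := hL (pol r t) (pol_disk r t ltac:(lra))).
      unfold laplacian_minus, hyp_laplacian in hz.
      assert (hm : Cmod (pol r t) = r) by (rewrite pol_eit, Cmod_polar; lra).
      rewrite hm in hz.
      assert (hr2 : 0 < 1 - r ^ 2) by (simpl; nra).
      set (LL := (Defs.Dx (Defs.Dx f) (pol r t) + Defs.Dy (Defs.Dy f) (pol r t))%C) in *.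
      assert (hLL : (RtoC (r ^ 2) * LL)%C = (lambda * RtoC (4 * r ^ 2 / (1 - r ^ 2) ^ 2) * f (pol r t))%C).
      { transitivity (RtoC (4 * r ^ 2 / (1 - r ^ 2) ^ 2) * (RtoC ((1 - r ^ 2) ^ 2 / 4) * LL - lambda * f (pol r t)) +
          lambda * RtoC (4 * r ^ 2 / (1 - r ^ 2) ^ 2) * f (pol r t))%C.
        - replace (r ^ 2) with (4 * r ^ 2 / (1 - r ^ 2) ^ 2 * ((1 - r ^ 2) ^ 2 / 4)) at 1 by (field; lra).
          rewrite RtoC_mult; ring.
        - rewrite hz; ring. }
      rewrite <- hLL; unfold LL, rr, tt, rad_deriv, ang_deriv.
      assert (hsc : (RtoC (sin t) * RtoC (sin t) = 1 - RtoC (cos t) * RtoC (cos t))%C).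
      { rewrite <- !RtoC_mult, <- RtoC_minus; f_equal; generalize (sin2_cos2 t); unfold Rsqr; lra. }
      rewrite !RtoC_opp, !RtoC_mult, !RtoC_pow.
      set (s := RtoC (sin t)) in *; set (c := RtoC (cos t)) in *.
      set (fxx := Defs.Dx (Defs.Dx f) (pol r t)); set (fyx := Defs.Dy (Defs.Dx f) (pol r t)).
      set (fxy := Defs.Dx (Defs.Dy f) (pol r t)); set (fyy := Defs.Dy (Defs.Dy f) (pol r t)).
      set (fx := Defs.Dx f (pol r t)); set (fy := Defs.Dy f (pol r t)).
      transitivity (r ^ 2 * ((c * c + s * s) * fxx + (c * c + s * s) * fyy))%C; [ring|rewrite hsc; ring]. }
    assert (hf := fourier_ext _ _ m hid).
    assert (hcr : RCcont (rr r)) by (now apply RCcont_jcont).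
    assert (hcd : RCcont (rad_deriv f r)) by (apply RCcont_jcont; intros; now apply jcont_rad).
    assert (hsc : forall c g, RCcont g -> RCcont (fun t => c * g t)%C)
      by (intros c g hg; apply RCcont_mult; auto; intro; apply RCc_const).
    rewrite (fourier_plus (fun t => RtoC (r ^ 2) * rr r t + RtoC r * rad_deriv f r t)%C) in hf.
    2: { intros t; apply RCc_plus; now apply hsc. }
    2: easy.
    rewrite (fourier_plus (fun t => RtoC (r ^ 2) * rr r t)%C) in hf by now apply hsc.
    rewrite (fourier_scal _ (rr r)), (fourier_scal _ (rad_deriv f r)) in hf by easy.
    rewrite (fourier_scal _ (fun t => f (pol r t))) in hf by (apply hcp; now apply Ck_S).
    unfold radial_coef; rewrite Cmult_plus_distr_r, <- hf, f2, f1, !RtoC_pow.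
    replace (Ci * IZR m * (Ci * IZR m * fourier (fun t => f (pol r t)) m))%C with
     ((Ci * Ci) * (IZR m ^ 2 * fourier (fun t => f (pol r t)) m))%C by ring.
    replace (Ci * Ci)%C with (RtoC (-1)) by (apply C_ext; simpl; ring). ring.
(* Regularity at the origin: continuity there bounds f and its first derivatives on small circles
   uniformly in t. *)
- assert (hb : forall g, Ck_disk 0 g -> exists eta B, 0 < eta < 1 /\ 0 <= B /\ forall r t, 0 < r < eta -> Cmod (g (pol r t)) <= B).
  { intros g hg; assert (h0 : disk 0) by (unfold disk; rewrite Cmod_0; lra).
    destruct (Ck_continuous 0 g 0 hg h0 1 Rlt_0_1) as [d [hd h]].
    exists (Rmin d (1 / 2)), (Cmod (g 0) + 1); repeat split.
    - apply Rmin_pos; lra.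
    - generalize (Rmin_r d (1 / 2)); lra.
    - generalize (Cmod_ge_0 (g 0)); lra.
    - intros r t hr; assert (hm := Rmin_l d (1 / 2)).
      replace (g (pol r t)) with ((g (pol r t) - g 0) + g 0)%C by ring.
      eapply Rle_trans; [apply Cmod_triangle|]. specialize (h (pol r t)).
      replace (pol r t - 0)%C with (pol r t) in h by ring.
      rewrite pol_eit, Cmod_polar in h by lra; rewrite pol_eit; specialize (h ltac:(lra)); lra. }
  destruct (hb f) as (n1 & B1 & hn1 & p1 & h1); [now do 2 apply Ck_S|].
  destruct (hb (Defs.Dx f)) as (n2 & B2 & hn2 & p2 & h2); [now apply Ck_S|].
  destruct (hb (Defs.Dy f)) as (n3 & B3 & hn3 & p3 & h3); [now apply Ck_S|].
  exists (Rmin n1 (Rmin n2 n3)), (B1 + B2 + B3).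
  assert (m1 := Rmin_l n1 (Rmin n2 n3)); assert (m2 := Rmin_r n1 (Rmin n2 n3)).
  assert (m3 := Rmin_l n2 n3); assert (m4 := Rmin_r n2 n3).
  split; [split; [repeat apply Rmin_pos; lra|lra]|]; intros r hr; split.
  + apply fourier_bound.
    * apply (RCcont_jcont (fun r t => f (pol r t))); intros t; apply (jcont_pol_Ck 1); auto; lra.
    * intros t; specialize (h1 r t ltac:(lra)); lra.
  + apply fourier_bound.
    * apply RCcont_jcont; intros t; apply jcont_rad; auto; lra.
    * intros t; unfold rad_deriv; eapply Rle_trans; [apply Cmod_triangle|]; rewrite !Cmod_mult, !Cmod_R.
      specialize (h2 r t ltac:(lra)); specialize (h3 r t ltac:(lra)).
      assert (Rabs (cos t) <= 1) by (apply Rabs_le, COS_bound).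
      assert (Rabs (sin t) <= 1) by (apply Rabs_le; generalize (SIN_bound t); lra).
      assert (q1 := Cmod_ge_0 (Defs.Dx f (pol r t))); assert (q2 := Cmod_ge_0 (Defs.Dy f (pol r t))).
      assert (q3 := Rabs_pos (cos t)); assert (q4 := Rabs_pos (sin t)). nra.
Qed.

(** * Calculus of kernels *)

Lemma is_derive_inv_components (a b : R -> R) t la lb : is_derive a t la -> is_derive b t lb ->
  0 < a t * a t + b t * b t ->
  is_derive (fun u => a u / (a u ^ 2 + b u ^ 2)) t
    ((la * (b t * b t - a t * a t) - 2 * a t * b t * lb) / ((a t * a t + b t * b t) * (a t * a t + b t * b t))) /\
  is_derive (fun u => - b u / (a u ^ 2 + b u ^ 2)) t
    ((2 * a t * b t * la + lb * (b t * b t - a t * a t)) / ((a t * a t + b t * b t) * (a t * a t + b t * b t))).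
Proof.
intros h1 h2 hp.
assert (x1 : ex_derive a t) by (now exists la); assert (x2 : ex_derive b t) by (now exists lb).
apply is_derive_unique in h1, h2.
split; (auto_derive; [repeat split; auto; simpl; lra|]);
  change (Derive (fun x => a x) t) with (Derive a t); change (Derive (fun x => b x) t) with (Derive b t);
  rewrite h1, h2; field; lra.
Qed.

Lemma is_derive_log_components (a b : R -> R) t la lb : is_derive a t la -> is_derive b t lb -> 0 < a t ->
  is_derive (fun u => ln (a u ^ 2 + b u ^ 2) / 2) t ((a t * la + b t * lb) / (a t * a t + b t * b t)) /\
  is_derive (fun u => atan (b u / a u)) t ((a t * lb - b t * la) / (a t * a t + b t * b t)).
Proof.
intros h1 h2 hp; assert (hp' : 0 < a t * a t + b t * b t) by nra.
assert (x1 : ex_derive a t) by (now exists la); assert (x2 : ex_derive b t) by (now exists lb).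
apply is_derive_unique in h1, h2.
split; (auto_derive; [repeat split; auto; simpl; lra|]);
  change (Derive (fun x => a x) t) with (Derive a t); change (Derive (fun x => b x) t) with (Derive b t);
  rewrite h1, h2; field; repeat split; nra.
Qed.

Lemma RCd_inv (phi : R -> C) t l : phi t <> RtoC 0 -> RCd phi t l ->
  RCd (fun u => / phi u)%C t (- (/ phi t * / phi t) * l)%C.
Proof.
intros hne [h1 h2].
assert (hp : 0 < Re (phi t) * Re (phi t) + Im (phi t) * Im (phi t)).
{ rewrite <- Cmod_sqr; apply Cmod_gt_0 in hne; nra. }
destruct (is_derive_inv_components _ _ _ _ _ h1 h2 hp) as [k1 k2].
split.
- evar_last; [exact k1|]. unfold Re, Im in *; simpl; field; lra.
- evar_last; [exact k2|]. unfold Re, Im in *; simpl; field; lra.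
Qed.

Lemma RCd_Clog_right phi t l : 0 < Re (phi t) -> RCd phi t l -> RCd (fun u => Clog_right (phi u)) t (/ phi t * l)%C.
Proof.
intros hre [h1 h2].
assert (hp : 0 < Re (phi t) * Re (phi t) + Im (phi t) * Im (phi t)) by nra.
destruct (is_derive_log_components _ _ _ _ _ h1 h2 hre) as [k1 k2].
split.
- evar_last; [exact k1|]. unfold Re, Im in *; simpl; field; lra.
- evar_last; [exact k2|]. unfold Re, Im in *; simpl; field; lra.
Qed.

Lemma RC_mean_value g dg d M : (forall t, Rabs t < d -> RCd g t (dg t)) ->
  (forall t, Rabs t < d -> Cmod (dg t) <= M) -> forall t, Rabs t < d -> Cmod (g t - g 0)%C <= 2 * M * Rabs t.
Proof.
intros hg hM t ht.
assert (hin : forall x, Rmin 0 t <= x <= Rmax 0 t -> Rabs x < d).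
{ intros x hx; apply Rle_lt_trans with (2 := ht); revert hx; unfold Rmin, Rmax.
  destruct (Rle_dec 0 t); intros; [rewrite !Rabs_pos_eq; lra|rewrite !Rabs_left1; lra]. }
assert (hr : forall f df : R -> R, (forall t, Rabs t < d -> is_derive f t (df t)) ->
  (forall t, Rabs t < d -> Rabs (df t) <= M) -> Rabs (f t - f 0) <= M * Rabs t).
{ intros f df h1 h2; destruct (MVT_gen f 0 t df) as [c [hc e]].
  - intros x hx; apply h1, hin; lra.
  - intros x hx; apply derivable_continuous_pt; exists (df x); apply is_derive_Reals, h1, hin, hx.
  - rewrite e, Rminus_0_r, Rabs_mult; apply Rmult_le_compat_r; [apply Rabs_pos|apply h2, hin, hc]. }
assert (r1 : Rabs (Re (g t) - Re (g 0)) <= M * Rabs t).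
{ apply (hr (fun t => Re (g t)) (fun t => Re (dg t))).
  - intros s hs; apply (hg s hs).
  - intros s hs; eapply Rle_trans; [apply Cmod_Re|auto]. }
assert (r2 : Rabs (Im (g t) - Im (g 0)) <= M * Rabs t).
{ apply (hr (fun t => Im (g t)) (fun t => Im (dg t))).
  - intros s hs; apply (hg s hs).
  - intros s hs; eapply Rle_trans; [apply Cmod_Im|auto]. }
eapply Rle_trans; [apply Cmod_le_sum|]; unfold Re, Im, Rminus in *; simpl; lra.
Qed.

Lemma Cdiff_Ccont f z : Cdiff f z -> Ccont f z.
Proof.
intros h eps he; destruct (Cdiff_eps f z h) as [l hl]; destruct (hl 1 Rlt_0_1) as [d [hd h']].
assert (hl0 := Cmod_ge_0 l).
exists (Rmin d (eps / (Cmod l + 1))); split; [apply Rmin_pos; [easy|apply Rdiv_lt_0_compat; lra]|].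
intros w hw; specialize (h' w (Rlt_le_trans _ _ _ hw (Rmin_l _ _))).
assert (hw2 := Rlt_le_trans _ _ _ hw (Rmin_r _ _)).
replace (f w - f z)%C with ((f w - f z - l * (w - z)) + l * (w - z))%C by ring.
eapply Rle_lt_trans; [apply Cmod_triangle|]; rewrite Cmod_mult.
apply (Rmult_lt_compat_l (Cmod l + 1)) in hw2; [|lra].
replace ((Cmod l + 1) * (eps / (Cmod l + 1))) with eps in hw2 by (field; lra). lra.
Qed.

(** * Joint continuity in z and xi *)

Definition jointly (F : C -> C -> C) (z xi : C) : Prop :=
  forall eps, 0 < eps -> exists d, 0 < d /\ forall z' xi', Cmod (z' - z)%C < d -> Cmod (xi' - xi)%C < d ->
    Cmod (F z' xi' - F z xi)%C < eps.

Lemma jointly_comp f F z xi : Ccont f (F z xi) -> jointly F z xi -> jointly (fun z xi => f (F z xi)) z xi.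
Proof.
intros hf hF eps he; destruct (hf eps he) as [d [hd h]]; destruct (hF d hd) as [d' [hd' h']].
exists d'; split; auto.
Qed.

Lemma jointly_const c z xi : jointly (fun _ _ => c) z xi.
Proof.
intros eps he; exists 1; split; [lra|]; intros; replace (c - c)%C with (RtoC 0) by ring; now rewrite Cmod_0.
Qed.

Lemma jointly_fst z xi : jointly (fun z _ => z) z xi.
Proof. intros eps he; exists eps; split; auto. Qed.

Lemma jointly_snd z xi : jointly (fun _ xi => xi) z xi.
Proof. intros eps he; exists eps; split; auto. Qed.

Lemma jointly_plus F G z xi : jointly F z xi -> jointly G z xi -> jointly (fun z xi => F z xi + G z xi)%C z xi.
Proof.
intros hF hG eps he; destruct (hF (eps / 2)) as [d1 [p1 q1]]; [lra|]; destruct (hG (eps / 2)) as [d2 [p2 q2]]; [lra|].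
exists (Rmin d1 d2); split; [now apply Rmin_pos|]; intros z' xi' hz hx.
specialize (q1 z' xi' (Rlt_le_trans _ _ _ hz (Rmin_l _ _)) (Rlt_le_trans _ _ _ hx (Rmin_l _ _))).
specialize (q2 z' xi' (Rlt_le_trans _ _ _ hz (Rmin_r _ _)) (Rlt_le_trans _ _ _ hx (Rmin_r _ _))).
replace (F z' xi' + G z' xi' - (F z xi + G z xi))%C with ((F z' xi' - F z xi) + (G z' xi' - G z xi))%C by ring.
eapply Rle_lt_trans; [apply Cmod_triangle|lra].
Qed.

Lemma jointly_mult F G z xi : jointly F z xi -> jointly G z xi -> jointly (fun z xi => F z xi * G z xi)%C z xi.
Proof.
intros hF hG eps he.
set (A := Cmod (F z xi)); set (B := Cmod (G z xi)).
assert (hA : 0 <= A) by apply Cmod_ge_0; assert (hB : 0 <= B) by apply Cmod_ge_0.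
set (e := Rmin 1 (eps / (2 * (A + B + 1)))).
assert (he0 : 0 < e) by (apply Rmin_pos; [lra|apply Rdiv_lt_0_compat; lra]).
assert (e1 : e <= 1) by apply Rmin_l.
assert (e2 : e * (A + B + 1) < eps).
{ apply Rle_lt_trans with (eps / (2 * (A + B + 1)) * (A + B + 1)).
  - apply Rmult_le_compat_r; [lra|apply Rmin_r].
  - replace (eps / (2 * (A + B + 1)) * (A + B + 1)) with (eps / 2) by (field; lra); lra. }
destruct (hF e he0) as [d1 [p1 q1]]; destruct (hG e he0) as [d2 [p2 q2]].
exists (Rmin d1 d2); split; [now apply Rmin_pos|]; intros z' xi' hz hx.
specialize (q1 z' xi' (Rlt_le_trans _ _ _ hz (Rmin_l _ _)) (Rlt_le_trans _ _ _ hx (Rmin_l _ _))).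
specialize (q2 z' xi' (Rlt_le_trans _ _ _ hz (Rmin_r _ _)) (Rlt_le_trans _ _ _ hx (Rmin_r _ _))).
set (x := (F z' xi' - F z xi)%C) in *; set (y := (G z' xi' - G z xi)%C) in *.
replace (F z' xi' * G z' xi' - F z xi * G z xi)%C with (x * y + (x * G z xi + F z xi * y))%C
  by (unfold x, y; ring).
eapply Rle_lt_trans; [apply Cmod_triangle|].
assert (ht := Cmod_triangle (x * G z xi) (F z xi * y)); rewrite !Cmod_mult in ht; rewrite Cmod_mult.
fold A B in ht; assert (hx0 := Cmod_ge_0 x); assert (hy0 := Cmod_ge_0 y).
apply Rle_lt_trans with (2 := e2). nra.
Qed.

Lemma jointly_minus F G z xi : jointly F z xi -> jointly G z xi -> jointly (fun z xi => F z xi - G z xi)%C z xi.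
Proof.
intros hF hG; apply jointly_plus; auto.
intros eps he; destruct (hG eps he) as [d [hd h]]; exists d; split; auto; intros z' xi' hz hx.
specialize (h z' xi' hz hx); rewrite <- Cmod_opp in h.
now replace (- G z' xi' - - G z xi)%C with (- (G z' xi' - G z xi))%C by ring.
Qed.

Lemma jointly_conj_fst z xi : jointly (fun z _ => Cconj z) z xi.
Proof.
intros eps he; exists eps; split; auto; intros; now rewrite <- Cminus_conj, Cmod_conj.
Qed.

Lemma Ccont_Cinv (z : C) : z <> RtoC 0 -> Ccont Cinv z.
Proof. intros h; apply Cdiff_Ccont, ex_derive_Cinv, h. Qed.

Lemma Ccont_ln_Re z : 0 < Re z -> Ccont (fun u => RtoC (ln (Re u))) z.
Proof.
intros hz eps he.
assert (hc : continuous ln (Re z)).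
{ apply (ex_derive_continuous (K := R_AbsRing) (V := R_NormedModule)); auto_derive; easy. }
destruct (proj1 (continuous_eps _ _) hc eps he) as [d [hd h]]; exists d; split; auto; intros w hw.
rewrite <- RtoC_minus, Cmod_R; apply h; apply Rle_lt_trans with (2 := hw), Rle_trans with (2 := Cmod_Re _).
unfold Re, Rminus; simpl; lra.
Qed.

(** * A syntax of kernels closed under differentiation *)

(** The atoms are those produced by differentiating the extended kernel in z: [KV], [KA] and [KB]
    are the reciprocals of 1 - |z|^2, 1 - z / xi and 1 - conj(z) xi, and [KPhi j] extends h^j P^w.
    Holomorphy in xi, joint continuity and the derivative in z are then proved once, by induction on
    expressions. *)
Inductive kexpr : Type :=
| KConst (c : C) | KZ | KZb | KX | KXi | KV | KA | KB | KPhi (j : nat)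
| KAdd (e1 e2 : kexpr) | KMul (e1 e2 : kexpr).

Fixpoint keval (w : C) (e : kexpr) (z xi : C) : C :=
  match e with
  | KConst c => c
  | KZ => z
  | KZb => Cconj z
  | KX => xi
  | KXi => (/ xi)%C
  | KV => (/ (1 - z * Cconj z))%C
  | KA => (/ (1 - z * / xi))%C
  | KB => (/ (1 - Cconj z * xi))%C
  | KPhi j => ((- log_poisson_ext z xi) ^ j * Cexp (w * log_poisson_ext z xi))%C
  | KAdd e1 e2 => (keval w e1 z xi + keval w e2 z xi)%C
  | KMul e1 e2 => (keval w e1 z xi * keval w e2 z xi)%C
  end.

Definition KDabs (c : C) : kexpr := KAdd (KMul (KConst c) KZb) (KMul (KConst (Cconj c)) KZ).

(** The derivative of [log_poisson_ext] in the direction [c]: the first summand comes from log(1 -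
    |z|^2), the other two from the two complex logarithms. *)
Definition KDlog (c : C) : kexpr :=
  KAdd (KMul (KConst (-1)) (KMul KV (KDabs c)))
    (KAdd (KMul (KConst c) (KMul KA KXi)) (KMul (KConst (Cconj c)) (KMul KB KX))).

(** Derivative with respect to [z] in the direction [c]. *)
Fixpoint KD (w c : C) (e : kexpr) : kexpr :=
  match e with
  | KConst _ => KConst 0
  | KZ => KConst c
  | KZb => KConst (Cconj c)
  | KX => KConst 0
  | KXi => KConst 0
  | KV => KMul (KMul KV KV) (KDabs c)
  | KA => KMul (KMul KA KA) (KMul (KConst c) KXi)
  | KB => KMul (KMul KB KB) (KMul (KConst (Cconj c)) KX)
  | KPhi j => KMul (KDlog c) (KAdd (KMul (KConst w) (KPhi j)) (KMul (KConst (RtoC (- INR j))) (KPhi (pred j))))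
  | KAdd e1 e2 => KAdd (KD w c e1) (KD w c e2)
  | KMul e1 e2 => KAdd (KMul (KD w c e1) e2) (KMul e1 (KD w c e2))
  end.

(** Here both complex logarithms of [log_poisson_ext] have arguments in the right half-plane. *)
Definition kdom (z xi : C) : Prop := disk z /\ annulus (1 - Cmod z) xi.

Lemma kdom_facts z xi : kdom z xi -> xi <> RtoC 0 /\ 0 < Re (1 - z * / xi)%C /\ 0 < Re (1 - Cconj z * xi)%C /\
  0 < Re (1 - z * Cconj z)%C.
Proof.
unfold kdom, disk, annulus; intros [hz [h1 h2]]; assert (hz0 := Cmod_ge_0 z).
assert (hxi : xi <> 0) by (apply Cmod_gt_0; lra).
split; [easy|]; split; [|split]; apply Re_1_minus.
- rewrite Cmod_mult, Cmod_inv by easy.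
  apply (Rmult_lt_reg_r (Cmod xi)); [lra|]; rewrite Rmult_assoc, Rinv_l; lra.
- rewrite Cmod_mult, Cmod_conj; nra.
- rewrite Cmod_mult, Cmod_conj; nra.
Qed.

Lemma Re_pos_neq u : 0 < Re u -> u <> RtoC 0.
Proof. intros h ->; simpl in h; lra. Qed.

Lemma keval_Cdiff w e z xi : kdom z xi -> Cdiff (keval w e z) xi.
Proof.
intros hd; destruct (kdom_facts z xi hd) as (h1 & h2 & h3 & h4).
assert (hminus : forall g, Cdiff g xi -> Cdiff (fun xi => 1 - g xi)%C xi).
{ intros g hg; apply Cdiff_ext with (fun xi => 1 + (-1) * g xi)%C; [intro; ring|].
  apply Cdiff_plus; [apply Cdiff_const|now apply Cdiff_scal]. }
assert (hl : Cdiff (log_poisson_ext z) xi) by (apply log_poisson_ext_holo; apply hd).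
induction e as [c| | | | | | | |j|e1 ih1 e2 ih2|e1 ih1 e2 ih2]; simpl.
- apply Cdiff_const.
- apply Cdiff_const.
- apply Cdiff_const.
- apply ex_derive_Cid.
- now apply ex_derive_Cinv.
- apply Cdiff_const.
- apply (ex_derive_Ccomp Cinv (fun xi => 1 - z * / xi)%C).
  + now apply ex_derive_Cinv, Re_pos_neq.
  + apply (hminus (fun xi => z * / xi)%C), Cdiff_scal; now apply ex_derive_Cinv.
- apply (ex_derive_Ccomp Cinv (fun xi => 1 - Cconj z * xi)%C).
  + now apply ex_derive_Cinv, Re_pos_neq.
  + apply (hminus (fun xi => Cconj z * xi)%C), Cdiff_scal, ex_derive_Cid.
- apply Cdiff_mult.
  + apply (ex_derive_Cpow (fun xi => - log_poisson_ext z xi)%C).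
    apply Cdiff_ext with (fun xi => (-1) * log_poisson_ext z xi)%C; [intro; ring|now apply Cdiff_scal].
  + apply (ex_derive_Ccomp Cexp (fun xi => w * log_poisson_ext z xi)%C).
    * eexists; apply is_derive_Cexp.
    * now apply Cdiff_scal.
- now apply Cdiff_plus.
- now apply Cdiff_mult.
Qed.

Lemma log_poisson_ext_alt z xi : log_poisson_ext z xi =
  (RtoC (ln (Re (1 - z * Cconj z)%C)) - (Clog_right (1 - z * / xi) + Clog_right (1 - Cconj z * xi)))%C.
Proof.
unfold log_poisson_ext; do 3 f_equal.
rewrite Cmod2_alt; destruct z as [x y]; simpl; ring.
Qed.

Lemma jointly_inv F z xi : F z xi <> RtoC 0 -> jointly F z xi -> jointly (fun z xi => / F z xi)%C z xi.
Proof. intros h; apply (jointly_comp Cinv); now apply Ccont_Cinv. Qed.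

Lemma jointly_keval w e z xi : kdom z xi -> jointly (keval w e) z xi.
Proof.
intros hd; destruct (kdom_facts z xi hd) as (h1 & h2 & h3 & h4).
assert (jA : jointly (fun z xi => 1 - z * / xi)%C z xi).
{ apply jointly_minus; [apply jointly_const|]; apply jointly_mult; [apply jointly_fst|].
  apply jointly_inv; [easy|apply jointly_snd]. }
assert (jB : jointly (fun z xi => 1 - Cconj z * xi)%C z xi).
{ apply jointly_minus; [apply jointly_const|]; apply jointly_mult; [apply jointly_conj_fst|apply jointly_snd]. }
assert (jV : jointly (fun z xi => 1 - z * Cconj z)%C z xi).
{ apply jointly_minus; [apply jointly_const|]; apply jointly_mult; [apply jointly_fst|apply jointly_conj_fst]. }
assert (jL : jointly log_poisson_ext z xi).
{ replace log_poisson_ext with (fun z xi => RtoC (ln (Re (1 - z * Cconj z)%C)) -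
    (Clog_right (1 - z * / xi) + Clog_right (1 - Cconj z * xi)))%C.
  2: { do 2 (apply functional_extensionality; intro); symmetry; apply log_poisson_ext_alt. }
  apply jointly_minus.
  - apply (jointly_comp (fun u => RtoC (ln (Re u))) (fun z xi => 1 - z * Cconj z)%C); auto; now apply Ccont_ln_Re.
  - apply jointly_plus.
    + apply (jointly_comp Clog_right (fun z xi => 1 - z * / xi)%C); auto; now apply Cdiff_Ccont, ex_derive_Clog_right.
    + apply (jointly_comp Clog_right (fun z xi => 1 - Cconj z * xi)%C); auto; now apply Cdiff_Ccont, ex_derive_Clog_right. }
induction e as [c| | | | | | | |j|e1 ih1 e2 ih2|e1 ih1 e2 ih2]; simpl.
- apply jointly_const.
- apply jointly_fst.
- apply jointly_conj_fst.
- apply jointly_snd.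
- apply jointly_inv; [easy|apply jointly_snd].
- apply jointly_inv; [now apply Re_pos_neq|easy].
- apply jointly_inv; [now apply Re_pos_neq|easy].
- apply jointly_inv; [now apply Re_pos_neq|easy].
- apply jointly_mult.
  + apply (jointly_comp (fun u => (- u) ^ j)%C log_poisson_ext); [|easy].
    apply Cdiff_Ccont, (ex_derive_Cpow (fun u => - u)%C).
    apply Cdiff_ext with (fun u => (-1) * u)%C; [intro; ring|]; apply Cdiff_scal, ex_derive_Cid.
  + apply (jointly_comp (fun u => Cexp (w * u))%C log_poisson_ext); [|easy].
    apply Cdiff_Ccont, Cdiff_Cexp_lin.
- now apply jointly_plus.
- now apply jointly_mult.
Qed.

Lemma RCd_conj phi t l : RCd phi t l -> RCd (fun u => Cconj (phi u)) t (Cconj l).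
Proof.
intros [h1 h2]; split; [exact h1|].
apply (is_derive_opp (K := R_AbsRing) (V := R_NormedModule) (fun u => Im (phi u))), h2.
Qed.

Lemma RCd_pow phi t l j : RCd phi t l -> RCd (fun u => phi u ^ j)%C t (RtoC (INR j) * phi t ^ pred j * l)%C.
Proof.
intros h; induction j as [|j ih].
- eapply RCd_ext; [| |apply (RCd_const 1 t)]; [intro; easy|simpl; ring].
- eapply RCd_ext; [| |apply (RCd_mult _ _ _ _ _ h ih)]; [intro; easy|].
  rewrite S_INR, RtoC_plus; destruct j as [|j]; [simpl; ring|].
  cbn [pred]; rewrite Cpow_S; ring.
Qed.

Lemma RCd_keval w e z c t xi : kdom (z + RtoC t * c)%C xi ->
  RCd (fun u => keval w e (z + RtoC u * c)%C xi) t (keval w (KD w c e) (z + RtoC t * c)%C xi).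
Proof.
intros hd; destruct (kdom_facts _ xi hd) as (h1 & h2 & h3 & h4).
assert (dz : RCd (fun u => z + RtoC u * c)%C t c).
{ eapply RCd_ext; [intro; reflexivity| |apply RCd_plus; [apply RCd_const|apply RCd_mult; [|apply RCd_const]]].
  2: { apply (RCd_RtoC (fun u => u) t 1); auto_derive; easy. }
  cbv beta; ring. }
assert (dzb := RCd_conj _ _ _ dz).
assert (hminus : forall (phi : R -> C) l, RCd phi t l -> RCd (fun u => 1 - phi u)%C t (- l)%C).
{ intros phi l hp; eapply RCd_ext; [intro; reflexivity| |apply (RCd_minus _ _ _ _ _ (RCd_const 1 t) hp)]; cbv beta; ring. }
assert (dA : RCd (fun u => 1 - (z + RtoC u * c) * / xi)%C t (- (c * / xi))%C).
{ apply (hminus (fun u => (z + RtoC u * c) * / xi)%C).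
  eapply RCd_ext; [intro; reflexivity| |apply (RCd_mult _ _ _ _ _ dz (RCd_const (/ xi) t))]; cbv beta; ring. }
assert (dB : RCd (fun u => 1 - Cconj (z + RtoC u * c) * xi)%C t (- (Cconj c * xi))%C).
{ apply (hminus (fun u => Cconj (z + RtoC u * c) * xi)%C).
  eapply RCd_ext; [intro; reflexivity| |apply (RCd_mult _ _ _ _ _ dzb (RCd_const xi t))]; cbv beta; ring. }
assert (dV : RCd (fun u => 1 - (z + RtoC u * c) * Cconj (z + RtoC u * c))%C t
   (- (c * Cconj (z + RtoC t * c) + Cconj c * (z + RtoC t * c)))%C).
{ apply (hminus (fun u => (z + RtoC u * c) * Cconj (z + RtoC u * c))%C).
  eapply RCd_ext; [intro; reflexivity| |apply (RCd_mult _ _ _ _ _ dz dzb)]; cbv beta; ring. }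
assert (dL : RCd (fun u => log_poisson_ext (z + RtoC u * c) xi) t (keval w (KDlog c) (z + RtoC t * c)%C xi)).
{ set (Z := (z + RtoC t * c)%C) in *.
  assert (dln : is_derive (fun u => ln (Re (1 - (z + RtoC u * c) * Cconj (z + RtoC u * c))%C)) t
    (Re (- (c * Cconj Z + Cconj c * Z))%C * / Re (1 - Z * Cconj Z)%C)).
  { apply (is_derive_comp (K := R_AbsRing) (V := R_NormedModule) ln
      (fun u => Re (1 - (z + RtoC u * c) * Cconj (z + RtoC u * c))%C) t).
    - apply is_derive_Reals, derivable_pt_lim_ln, h4.
    - apply dV. }
  eapply RCd_ext; [intros u; symmetry; apply log_poisson_ext_alt| |].
  2: { apply RCd_minus; [apply (RCd_RtoC _ _ _ dln)|
    apply RCd_plus; [apply (RCd_Clog_right _ _ _ h2 dA)|apply (RCd_Clog_right _ _ _ h3 dB)]]. }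
  fold Z.
  assert (hreal : forall u : C, Im u = 0 -> RtoC (Re u) = u) by (intros [a b] h; simpl in h; subst b; easy).
  rewrite RtoC_mult, RtoC_inv by lra.
  rewrite (hreal (- (c * Cconj Z + Cconj c * Z))%C) by (destruct Z, c; simpl; ring).
  rewrite (hreal (1 - Z * Cconj Z)%C) by (destruct Z; simpl; ring).
  cbn [keval KDlog KDabs]; ring. }
induction e as [d| | | | | | | |j|e1 ih1 e2 ih2|e1 ih1 e2 ih2]; cbn [keval KD KDabs].
- apply RCd_const.
- exact dz.
- exact dzb.
- apply RCd_const.
- apply RCd_const.
- eapply RCd_ext; [intro; reflexivity| |apply RCd_inv; [now apply Re_pos_neq|exact dV]]; cbv beta; ring.
- eapply RCd_ext; [intro; reflexivity| |apply RCd_inv; [now apply Re_pos_neq|exact dA]]; cbv beta; ring.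
- eapply RCd_ext; [intro; reflexivity| |apply RCd_inv; [now apply Re_pos_neq|exact dB]]; cbv beta; ring.
- eapply RCd_ext; [intro; reflexivity| |apply RCd_mult; [apply RCd_pow, RCd_opp, dL|apply RCd_Cexp, RCd_scal, dL]].
  cbv beta; rewrite RtoC_opp; ring.
- now apply RCd_plus.
- now apply RCd_mult.
Qed.

(** * Transforms of analytic functionals *)

Lemma keval_holo w e z : disk z -> holomorphic_annulus (1 - Cmod z) (keval w e z).
Proof. intros hz xi hxi; apply keval_Cdiff; now split. Qed.

Lemma disk_pos z : disk z -> 0 < 1 - Cmod z.
Proof. unfold disk; lra. Qed.

Definition kernel_elt (w : C) (e : kexpr) (z : C) (hz : disk z) : Hcircle :=
  mkH (keval w e z) (1 - Cmod z) (disk_pos z hz) (keval_holo w e z hz).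

(** Extended by 0 off the disk, so that it is a plain function to which the partial derivatives
    apply. *)
Definition transform (nu : analytic_functional) (w : C) (e : kexpr) (z : C) : C :=
  match Rlt_dec (Cmod z) 1 with left hz => nu (kernel_elt w e z hz) | right _ => RtoC 0 end.

Lemma transform_eq (nu : analytic_functional) w e z (g : Hcircle) : disk z -> (forall xi : circle, g xi = keval w e z xi) ->
  transform nu w e z = nu g.
Proof.
intros hz hg; unfold transform; destruct (Rlt_dec (Cmod z) 1) as [h|h]; [|easy].
apply af_ext; intros xi; symmetry; apply hg.
Qed.

(** A single annulus serves all z near z0; this is what allows one compact set and one tolerance of
    the functional to control a whole neighbourhood. *)
Lemma kdom_near z0 z xi : disk z0 -> Cmod (z - z0)%C < (1 - Cmod z0) / 2 -> annulus ((1 - Cmod z0) / 2) xi ->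
  kdom z xi.
Proof.
unfold disk, kdom, annulus; intros h0 hz [h1 h2].
assert (h := Cmod_diff_bound z0 z); assert (h' := Rle_abs (Cmod z - Cmod z0)).
unfold disk; lra.
Qed.

Lemma transform_small (nu : analytic_functional) z0 eps : disk z0 -> 0 < eps -> exists K e, compact_C K /\
  (forall xi, K xi -> annulus ((1 - Cmod z0) / 2) xi) /\ 0 < e /\
  forall F (g : Hcircle), holomorphic_annulus ((1 - Cmod z0) / 2) F -> (forall xi : circle, F xi = g xi) ->
    (forall xi, K xi -> Cmod (F xi) < e) -> Cmod (nu g) < eps.
Proof. intros h0 he; apply af_bound; auto; unfold disk in h0; lra. Qed.

Lemma holo_near w e z0 z : disk z0 -> Cmod (z - z0)%C < (1 - Cmod z0) / 2 ->
  holomorphic_annulus ((1 - Cmod z0) / 2) (keval w e z).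
Proof. intros h0 hz xi hxi; apply keval_Cdiff; now apply (kdom_near z0). Qed.

Lemma disk_near z0 z : disk z0 -> Cmod (z - z0)%C < (1 - Cmod z0) / 2 -> disk z.
Proof.
unfold disk; intros h0 hz.
assert (h := Cmod_diff_bound z0 z); assert (h' := Rle_abs (Cmod z - Cmod z0)); lra.
Qed.

Lemma Cmod_self z : Cmod (z - z)%C = 0.
Proof. replace (z - z)%C with (RtoC 0) by ring; apply Cmod_0. Qed.

Lemma holo_lincomb d a b F G : holomorphic_annulus d F -> holomorphic_annulus d G ->
  holomorphic_annulus d (fun xi => a * F xi + b * G xi)%C.
Proof. intros hF hG xi hxi; apply Cdiff_lincomb; [now apply hF|now apply hG]. Qed.

(** Joint continuity made uniform on the compact set that controls the functional. *)
Lemma transform_Ccont nu w e z0 : disk z0 -> Ccont (transform nu w e) z0.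
Proof.
intros h0 eps he.
destruct (transform_small nu z0 eps h0 he) as (K & e0 & hK & hA & he0 & h).
assert (hd0 : 0 < (1 - Cmod z0) / 2) by (unfold disk in h0; lra).
assert (hz0 : Cmod (z0 - z0)%C < (1 - Cmod z0) / 2) by now rewrite Cmod_self.
destruct (compact_unif K (fun d xi => forall z, Cmod (z - z0)%C < d -> Cmod (z - z0)%C < (1 - Cmod z0) / 2 ->
  Cmod (keval w e z xi - keval w e z0 xi)%C < e0) hK) as [d [hd hP]].
- intros d d' xi hdd hp z hz; apply hp; lra.
- intros xi hxi.
  destruct (jointly_keval w e z0 xi (kdom_near z0 z0 xi h0 hz0 (hA xi hxi)) (e0 / 2)) as [d [hd hj]]; [lra|].
  exists d, d; split; [easy|split; [easy|]]; intros xi' hxi' z hz _.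
  assert (j1 := hj z xi' hz hxi'); assert (j2 := hj z0 xi'); rewrite Cmod_self in j2; specialize (j2 hd hxi').
  replace (keval w e z xi' - keval w e z0 xi')%C with
    ((keval w e z xi' - keval w e z0 xi) + - (keval w e z0 xi' - keval w e z0 xi))%C by ring.
  eapply Rle_lt_trans; [apply Cmod_triangle|]; rewrite Cmod_opp; lra.
- exists (Rmin d ((1 - Cmod z0) / 2)); split; [now apply Rmin_pos|]; intros z hz.
  assert (hz1 := Rlt_le_trans _ _ _ hz (Rmin_l _ _)); assert (hz2 := Rlt_le_trans _ _ _ hz (Rmin_r _ _)).
  assert (hF := holo_lincomb _ 1 (-1) _ _ (holo_near w e z0 z h0 hz2) (holo_near w e z0 z0 h0 hz0)).
  set (g := mkH _ _ hd0 hF).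
  rewrite (transform_eq nu w e z (mkH _ _ hd0 (holo_near w e z0 z h0 hz2))) by (auto; now apply (disk_near z0)).
  rewrite (transform_eq nu w e z0 (mkH _ _ hd0 (holo_near w e z0 z0 h0 hz0))) by auto.
  set (g1 := mkH _ _ hd0 (holo_near w e z0 z h0 hz2)); set (g0 := mkH _ _ hd0 (holo_near w e z0 z0 h0 hz0)).
  assert (eg : nu g = (1 * nu g1 + (-1) * nu g0)%C) by (apply (af_linear nu); intros xi; reflexivity).
  replace (nu g1 - nu g0)%C with (nu g) by (rewrite eg; ring).
  apply (h _ g hF); [easy|]; intros xi hxi.
  replace (1 * keval w e z xi + -1 * keval w e z0 xi)%C with (keval w e z xi - keval w e z0 xi)%C by ring.
  now apply hP.
Qed.

(** Differentiation under the functional: the difference quotient minus its limit is holomorphic on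
    the common annulus and uniformly small on the compact set, by the mean value inequality in t. *)
Lemma RCd_transform nu w e z0 c : disk z0 -> Cmod c <= 1 ->
  RCd (fun t => transform nu w e (z0 + RtoC t * c)%C) 0 (transform nu w (KD w c e) z0).
Proof.
intros h0 hc; apply RCd_eps; intros eps he.
destruct (transform_small nu z0 eps h0 he) as (K & e0 & hK & hA & he0 & h).
assert (hd0 : 0 < (1 - Cmod z0) / 2) by (unfold disk in h0; lra).
assert (hz0 : Cmod (z0 - z0)%C < (1 - Cmod z0) / 2) by now rewrite Cmod_self.
assert (hstep : forall t, Cmod (z0 + RtoC t * c - z0)%C <= Rabs t).
{ intros t; replace (z0 + t * c - z0)%C with (t * c)%C by ring; rewrite Cmod_mult, Cmod_R.
  generalize (Rabs_pos t); nra. }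
destruct (compact_unif K (fun d xi => forall t, Rabs t < d -> Rabs t < (1 - Cmod z0) / 2 ->
  Cmod (keval w e (z0 + RtoC t * c) xi - keval w e z0 xi - RtoC t * keval w (KD w c e) z0 xi)%C
    <= e0 / 2 * Rabs t) hK) as [d [hd hP]].
- intros d d' xi hdd hp t ht; apply hp; lra.
- intros xi hxi.
  (* The eighth is doubled by the triangle inequality through the centre and doubled again by
     [RC_mean_value], giving e0 / 2. *)
  destruct (jointly_keval w (KD w c e) z0 xi (kdom_near z0 z0 xi h0 hz0 (hA xi hxi)) (e0 / 8)) as [d [hd hj]]; [lra|].
  destruct (open_C_inv (annulus ((1 - Cmod z0) / 2)) xi) as [d' [hd' hop]].
  { apply open_C; intros v [v1 v2].
    exists (Rmin (Cmod v - (1 - (1 - Cmod z0) / 2)) (1 + (1 - Cmod z0) / 2 - Cmod v)); split.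
    - apply Rmin_pos; lra.
    - intros v' hv'; assert (hv1 := Rlt_le_trans _ _ _ hv' (Rmin_l _ _)).
      assert (hv2 := Rlt_le_trans _ _ _ hv' (Rmin_r _ _)).
      assert (hb := Cmod_diff_bound v v'); apply Rabs_le_between in hb; unfold annulus; lra. }
  { now apply hA. }
  exists (Rmin d ((1 - Cmod z0) / 2)), (Rmin d d'); split; [now apply Rmin_pos|split; [now apply Rmin_pos|]].
  intros xi' hxi' t ht _.
  assert (hx1 := Rlt_le_trans _ _ _ hxi' (Rmin_l _ _)); assert (hx2 := Rlt_le_trans _ _ _ hxi' (Rmin_r _ _)).
  assert (hxa := hop xi' hx2).
  set (L := keval w (KD w c e) z0 xi').
  set (G := fun s => (keval w e (z0 + RtoC s * c) xi' - RtoC s * L)%C).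
  assert (hm := RC_mean_value G (fun s => keval w (KD w c e) (z0 + RtoC s * c) xi' - L)%C
    (Rmin d ((1 - Cmod z0) / 2)) (e0 / 4)).
  assert (hGt : Cmod (G t - G 0)%C <= 2 * (e0 / 4) * Rabs t).
  { apply hm; auto.
    - intros s hs; apply RCd_minus.
      + apply RCd_keval, (kdom_near z0); auto.
        eapply Rle_lt_trans; [apply hstep|]. eapply Rlt_le_trans; [apply hs|apply Rmin_r].
      + eapply RCd_ext; [intro; reflexivity| |apply RCd_mult; [apply (RCd_RtoC (fun u => u) s 1); auto_derive; easy|apply RCd_const]]; cbv beta; ring.
    - intros s hs.
      assert (hs1 : Cmod (z0 + RtoC s * c - z0)%C < d).
      { eapply Rle_lt_trans; [apply hstep|]. eapply Rlt_le_trans; [apply hs|apply Rmin_l]. }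
      assert (j1 := hj (z0 + RtoC s * c)%C xi' hs1 hx1).
      assert (j2 := hj z0 xi'); rewrite Cmod_self in j2; specialize (j2 hd hx1); unfold L.
      replace (keval w (KD w c e) (z0 + s * c) xi' - keval w (KD w c e) z0 xi')%C with
        ((keval w (KD w c e) (z0 + s * c) xi' - keval w (KD w c e) z0 xi) +
         - (keval w (KD w c e) z0 xi' - keval w (KD w c e) z0 xi))%C by ring.
      eapply Rle_trans; [apply Cmod_triangle|]; rewrite Cmod_opp; lra. }
  replace (keval w e (z0 + t * c) xi' - keval w e z0 xi' - t * L)%C with (G t - G 0)%C.
  + lra.
  + unfold G; replace (z0 + 0 * c)%C with z0 by ring; ring.
- exists (Rmin d ((1 - Cmod z0) / 2)); split; [now apply Rmin_pos|]; intros t ht; rewrite Rminus_0_r in *.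
  assert (ht1 := Rlt_le_trans _ _ _ ht (Rmin_l _ _)); assert (ht2 := Rlt_le_trans _ _ _ ht (Rmin_r _ _)).
  replace (z0 + 0 * c)%C with z0 by ring.
  destruct (Req_dec t 0) as [->|htn].
  { replace (z0 + 0 * c)%C with z0 by ring.
    match goal with |- Cmod ?a <= _ => replace a with (RtoC 0) by ring end; rewrite Cmod_0, Rabs_R0; lra. }
  assert (hzt : Cmod (z0 + RtoC t * c - z0)%C < (1 - Cmod z0) / 2) by (eapply Rle_lt_trans; [apply hstep|easy]).
  set (F1 := holo_near w e z0 _ h0 hzt); set (F0 := holo_near w e z0 _ h0 hz0).
  set (FD := holo_near w (KD w c e) z0 _ h0 hz0).
  assert (H1 := holo_lincomb _ 1 (-1) _ _ F1 F0).
  assert (H2 := holo_lincomb _ 1 (RtoC (- t)) _ _ H1 FD).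
  assert (H3 := holo_lincomb _ (RtoC (/ t)) 0 _ _ H2 H2).
  set (g1 := mkH _ _ hd0 F1); set (g0 := mkH _ _ hd0 F0); set (gD := mkH _ _ hd0 FD).
  set (k1 := mkH _ _ hd0 H1); set (k2 := mkH _ _ hd0 H2); set (k3 := mkH _ _ hd0 H3).
  rewrite (transform_eq nu w e (z0 + RtoC t * c)%C g1) by (auto; now apply (disk_near z0)).
  rewrite (transform_eq nu w e z0 g0), (transform_eq nu w (KD w c e) z0 gD) by auto.
  assert (x1 : nu k1 = (1 * nu g1 + (-1) * nu g0)%C) by (apply (af_linear nu); intros xi; reflexivity).
  assert (x2 : nu k2 = (1 * nu k1 + RtoC (- t) * nu gD)%C) by (apply (af_linear nu); intros xi; reflexivity).
  assert (x3 : nu k3 = (RtoC (/ t) * nu k2 + 0 * nu k2)%C) by (apply (af_linear nu); intros xi; reflexivity).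
  assert (htn' : RtoC t <> 0) by (intros e'; apply RtoC_inj in e'; easy).
  replace (nu g1 - nu g0 - nu gD * t)%C with (RtoC t * nu k3)%C.
  2: { rewrite x3, x2, x1, RtoC_inv, RtoC_opp by easy; field; easy. }
  rewrite Cmod_mult, Cmod_R, Rmult_comm; apply Rmult_le_compat_r; [apply Rabs_pos|].
  left; apply (h _ k3 H3); [easy|]; intros xi hxi.
  specialize (hP xi hxi t ht1 ht2).
  match goal with |- Cmod ?a < _ => replace a with (RtoC (/ t) * (keval w e (z0 + t * c) xi - keval w e z0 xi - t * keval w (KD w c e) z0 xi))%C end.
  2: { rewrite RtoC_opp; ring. }
  rewrite Cmod_mult, Cmod_R, Rabs_inv.
  assert (hat : 0 < Rabs t) by now apply Rabs_pos_lt.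
  apply Rle_lt_trans with (/ Rabs t * (e0 / 2 * Rabs t)).
  + apply Rmult_le_compat_l; [left; now apply Rinv_0_lt_compat|easy].
  + replace (/ Rabs t * (e0 / 2 * Rabs t)) with (e0 / 2) by (field; lra); lra.
Qed.

(** * Differential calculus on the disk *)

Definition eq_disk (f g : C -> C) : Prop := forall z, disk z -> f z = g z.

Lemma locally_disk_x z : disk z -> locally (Re z) (fun t => disk (t, Im z)).
Proof.
intros hz; destruct (disk_open_2d z hz) as [d [hd h]]; exists (mkposreal d hd); intros t ht.
apply h; [exact ht|]. rewrite Rminus_diag, Rabs_R0; easy.
Qed.

Lemma locally_disk_y z : disk z -> locally (Im z) (fun t => disk (Re z, t)).
Proof.
intros hz; destruct (disk_open_2d z hz) as [d [hd h]]; exists (mkposreal d hd); intros t ht.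
apply h; [|exact ht]. rewrite Rminus_diag, Rabs_R0; easy.
Qed.

Lemma Dx_RCd f z l : RCd (fun t => f (t, Im z)) (Re z) l -> Defs.Dx f z = l.
Proof. intros h; symmetry; exact (RCd_Derive _ _ _ h). Qed.

Lemma Dy_RCd f z l : RCd (fun t => f (Re z, t)) (Im z) l -> Defs.Dy f z = l.
Proof. intros h; symmetry; exact (RCd_Derive _ _ _ h). Qed.

Lemma eq_disk_x f g z : eq_disk f g -> disk z -> locally (Re z) (fun t => f (t, Im z) = g (t, Im z)).
Proof. intros h hz; generalize (locally_disk_x z hz); apply filter_imp; intros t; apply h. Qed.

Lemma eq_disk_y f g z : eq_disk f g -> disk z -> locally (Im z) (fun t => f (Re z, t) = g (Re z, t)).
Proof. intros h hz; generalize (locally_disk_y z hz); apply filter_imp; intros t; apply h. Qed.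

Lemma Dx_ext f g : eq_disk f g -> eq_disk (Defs.Dx f) (Defs.Dx g).
Proof.
intros h z hz; assert (hl := eq_disk_x f g z h hz).
unfold Defs.Dx; f_equal; apply Derive_ext_loc; revert hl; apply filter_imp; intros t e;
  first [exact (f_equal Re e)|exact (f_equal Im e)].
Qed.

Lemma Dy_ext f g : eq_disk f g -> eq_disk (Defs.Dy f) (Defs.Dy g).
Proof.
intros h z hz; assert (hl := eq_disk_y f g z h hz).
unfold Defs.Dy; f_equal; apply Derive_ext_loc; revert hl; apply filter_imp; intros t e;
  first [exact (f_equal Re e)|exact (f_equal Im e)].
Qed.

Lemma Ccont_ext f g z : eq_disk f g -> disk z -> Ccont f z -> Ccont g z.
Proof.
intros h hz hf eps he; destruct (hf eps he) as [d [hd h']]; destruct (disk_open z hz) as [d' [hd' h'']].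
exists (Rmin d d'); split; [now apply Rmin_pos|]; intros u hu.
assert (h1 := Rlt_le_trans _ _ _ hu (Rmin_l _ _)); assert (h2 := Rlt_le_trans _ _ _ hu (Rmin_r _ _)).
rewrite <- !h; auto.
Qed.

Lemma Ck_intro k f fx fy : (forall z, disk z -> Ccont f z) ->
  (forall z, disk z -> RCd (fun t => f (t, Im z)) (Re z) (fx z)) ->
  (forall z, disk z -> RCd (fun t => f (Re z, t)) (Im z) (fy z)) ->
  Ck_disk k (Defs.Dx f) -> Ck_disk k (Defs.Dy f) -> Ck_disk (S k) f.
Proof.
intros hc hx hy h1 h2; split; [intros; now apply Ccont_continuous, hc|]; split; [|now split].
intros z hz; split; eexists; apply RCd_is_derive; [now apply hx|now apply hy].
Qed.

Lemma Ck_ext k f g : eq_disk f g -> Ck_disk k f -> Ck_disk k g.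
Proof.
revert f g; induction k as [|k ih]; intros f g h hf.
- split; [|easy]; intros z hz; apply Ccont_continuous, (Ccont_ext f); auto; now apply (Ck_continuous 0).
- apply Ck_intro with (Defs.Dx f) (Defs.Dy f).
  + intros z hz; apply (Ccont_ext f); auto; now apply (Ck_continuous (S k)).
  + intros z hz; apply RCd_ext_loc with (1 := eq_disk_x f g z h hz); now apply (Ck_RCd_x k).
  + intros z hz; apply RCd_ext_loc with (1 := eq_disk_y f g z h hz); now apply (Ck_RCd_y k).
  + apply ih with (Defs.Dx f); [now apply Dx_ext|now apply Ck_Dx].
  + apply ih with (Defs.Dy f); [now apply Dy_ext|now apply Ck_Dy].
Qed.

(** Lets the rules proved for [jointly] serve for one variable. *)
Lemma Ccont_jointly f z : Ccont f z <-> jointly (fun _ u => f u) 0 z.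
Proof.
split; intros h eps he; destruct (h eps he) as [d [hd h']]; exists d; split; auto.
intros w hw; apply (h' 0 w); [rewrite Cmod_self|]; auto.
Qed.

Lemma Ccont_plus f g z : Ccont f z -> Ccont g z -> Ccont (fun u => f u + g u)%C z.
Proof. rewrite !Ccont_jointly; apply jointly_plus. Qed.

Lemma Ccont_mult f g z : Ccont f z -> Ccont g z -> Ccont (fun u => f u * g u)%C z.
Proof. rewrite !Ccont_jointly; apply jointly_mult. Qed.

Lemma Ccont_const c z : Ccont (fun _ => c) z.
Proof. apply Ccont_jointly, jointly_const. Qed.

Lemma Ck_const k c : Ck_disk k (fun _ => c).
Proof.
revert c; induction k as [|k ih]; intros c.
- split; [|easy]; intros; apply Ccont_continuous, Ccont_const.
- apply Ck_intro with (fun _ => RtoC 0) (fun _ => RtoC 0).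
  + intros; apply Ccont_const.
  + intros; apply RCd_const.
  + intros; apply RCd_const.
  + apply Ck_ext with (2 := ih 0); intros z _; symmetry; apply Dx_RCd, RCd_const.
  + apply Ck_ext with (2 := ih 0); intros z _; symmetry; apply Dy_RCd, RCd_const.
Qed.

Lemma Ck_plus k f g : Ck_disk k f -> Ck_disk k g -> Ck_disk k (fun u => f u + g u)%C.
Proof.
revert f g; induction k as [|k ih]; intros f g hf hg.
- split; [|easy]; intros z hz; apply Ccont_continuous, Ccont_plus; now apply (Ck_continuous 0).
- assert (hx : forall z, disk z -> RCd (fun t => f (t, Im z) + g (t, Im z))%C (Re z) (Defs.Dx f z + Defs.Dx g z)%C)
    by (intros z hz; apply RCd_plus; now apply (Ck_RCd_x k)).
  assert (hy : forall z, disk z -> RCd (fun t => f (Re z, t) + g (Re z, t))%C (Im z) (Defs.Dy f z + Defs.Dy g z)%C)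
    by (intros z hz; apply RCd_plus; now apply (Ck_RCd_y k)).
  eapply Ck_intro; [| exact hx | exact hy | |].
  + intros; apply Ccont_plus; now apply (Ck_continuous (S k)).
  + apply Ck_ext with (2 := ih _ _ (Ck_Dx k f hf) (Ck_Dx k g hg)).
    intros z hz; symmetry; now apply (Dx_RCd (fun u => f u + g u)%C), hx.
  + apply Ck_ext with (2 := ih _ _ (Ck_Dy k f hf) (Ck_Dy k g hg)).
    intros z hz; symmetry; now apply (Dy_RCd (fun u => f u + g u)%C), hy.
Qed.

Lemma Ck_mult k f g : Ck_disk k f -> Ck_disk k g -> Ck_disk k (fun u => f u * g u)%C.
Proof.
revert f g; induction k as [|k ih]; intros f g hf hg.
- split; [|easy]; intros z hz; apply Ccont_continuous, Ccont_mult; now apply (Ck_continuous 0).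
- assert (hre : forall z : C, (Re z, Im z) = z) by (intros [x y]; easy).
  assert (hx : forall z, disk z -> RCd (fun t => f (t, Im z) * g (t, Im z))%C (Re z) (Defs.Dx f z * g z + f z * Defs.Dx g z)%C).
  { intros z hz; eapply RCd_ext; [intro; reflexivity| |
      apply (RCd_mult _ _ _ _ _ (Ck_RCd_x k f z hf hz) (Ck_RCd_x k g z hg hz))]; cbv beta; now rewrite hre. }
  assert (hy : forall z, disk z -> RCd (fun t => f (Re z, t) * g (Re z, t))%C (Im z) (Defs.Dy f z * g z + f z * Defs.Dy g z)%C).
  { intros z hz; eapply RCd_ext; [intro; reflexivity| |
      apply (RCd_mult _ _ _ _ _ (Ck_RCd_y k f z hf hz) (Ck_RCd_y k g z hg hz))]; cbv beta; now rewrite hre. }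
  eapply Ck_intro; [| exact hx | exact hy | |].
  + intros; apply Ccont_mult; now apply (Ck_continuous (S k)).
  + apply Ck_ext with (fun z => Defs.Dx f z * g z + f z * Defs.Dx g z)%C.
    * intros z hz; symmetry; now apply (Dx_RCd (fun u => f u * g u)%C), hx.
    * apply Ck_plus; apply ih; auto using Ck_Dx, Ck_S.
  + apply Ck_ext with (fun z => Defs.Dy f z * g z + f z * Defs.Dy g z)%C.
    * intros z hz; symmetry; now apply (Dy_RCd (fun u => f u * g u)%C), hy.
    * apply Ck_plus; apply ih; auto using Ck_Dy, Ck_S.
Qed.

Lemma Ck_Re k : Ck_disk k (fun z => RtoC (Re z)).
Proof.
assert (hc : forall z, Ccont (fun z => RtoC (Re z)) z).
{ intros z eps he; exists eps; split; auto; intros w hw.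
  rewrite <- RtoC_minus, Cmod_R; apply Rle_lt_trans with (2 := hw), Rle_trans with (2 := Cmod_Re _).
  unfold Re, Rminus; simpl; lra. }
destruct k as [|k]; [split; [|easy]; intros; now apply Ccont_continuous|].
assert (hx : forall z : C, RCd (fun t => RtoC (Re (t, Im z))) (Re z) 1)
  by (intros; apply (RCd_RtoC (fun t => t)); auto_derive; easy).
assert (hy : forall z : C, RCd (fun t => RtoC (Re (Re z, t))) (Im z) 0)
  by (intros; apply (RCd_const (RtoC (Re z)))).
eapply Ck_intro with (fun _ => RtoC 1) (fun _ => RtoC 0); auto.
- apply Ck_ext with (2 := Ck_const k 1); intros z _; symmetry; apply Dx_RCd, hx.
- apply Ck_ext with (2 := Ck_const k 0); intros z _; symmetry; apply Dy_RCd, hy.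
Qed.

Lemma Ck_Im k : Ck_disk k (fun z => RtoC (Im z)).
Proof.
assert (hc : forall z, Ccont (fun z => RtoC (Im z)) z).
{ intros z eps he; exists eps; split; auto; intros w hw.
  rewrite <- RtoC_minus, Cmod_R; apply Rle_lt_trans with (2 := hw), Rle_trans with (2 := Cmod_Im _).
  unfold Im, Rminus; simpl; lra. }
destruct k as [|k]; [split; [|easy]; intros; now apply Ccont_continuous|].
assert (hx : forall z : C, RCd (fun t => RtoC (Im (t, Im z))) (Re z) 0)
  by (intros; apply (RCd_const (RtoC (Im z)))).
assert (hy : forall z : C, RCd (fun t => RtoC (Im (Re z, t))) (Im z) 1)
  by (intros; apply (RCd_RtoC (fun t => t)); auto_derive; easy).
eapply Ck_intro with (fun _ => RtoC 0) (fun _ => RtoC 1); auto.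
- apply Ck_ext with (2 := Ck_const k 0); intros z _; symmetry; apply Dx_RCd, hx.
- apply Ck_ext with (2 := Ck_const k 1); intros z _; symmetry; apply Dy_RCd, hy.
Qed.

Lemma Ck_weight k : Ck_disk k (fun z => RtoC ((1 - Cmod z ^ 2) ^ 2 / 4)).
Proof.
set (U := fun z : C => (1 + (-1) * (RtoC (Re z) * RtoC (Re z) + RtoC (Im z) * RtoC (Im z)))%C).
assert (hU : Ck_disk k U).
{ apply Ck_plus; [apply Ck_const|]; apply Ck_mult; [apply Ck_const|].
  apply Ck_plus; apply Ck_mult; first [apply Ck_Re | apply Ck_Im]. }
apply Ck_ext with (fun z => RtoC (1 / 4) * (U z * U z))%C.
- intros z _; unfold U; rewrite Cmod2_alt.
  rewrite <- !RtoC_mult, <- RtoC_plus, <- !RtoC_mult, <- RtoC_plus, <- !RtoC_mult; f_equal.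
  simpl; field.
- apply Ck_mult; [apply Ck_const|]; now apply Ck_mult.
Qed.

Lemma Ck_lincomb k a b f g : Ck_disk k f -> Ck_disk k g -> Ck_disk k (fun z => a * f z + b * g z)%C.
Proof. intros; apply Ck_plus; apply Ck_mult; auto; apply Ck_const. Qed.

Lemma Dx_lincomb a b f g : Ck_disk 1 f -> Ck_disk 1 g ->
  eq_disk (Defs.Dx (fun z => a * f z + b * g z)%C) (fun z => a * Defs.Dx f z + b * Defs.Dx g z)%C.
Proof.
intros hf hg z hz; apply Dx_RCd, RCd_plus; apply RCd_scal; now apply (Ck_RCd_x 0).
Qed.

Lemma Dy_lincomb a b f g : Ck_disk 1 f -> Ck_disk 1 g ->
  eq_disk (Defs.Dy (fun z => a * f z + b * g z)%C) (fun z => a * Defs.Dy f z + b * Defs.Dy g z)%C.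
Proof.
intros hf hg z hz; apply Dy_RCd, RCd_plus; apply RCd_scal; now apply (Ck_RCd_y 0).
Qed.

Lemma LM_ext lambda f g : eq_disk f g -> eq_disk (laplacian_minus lambda f) (laplacian_minus lambda g).
Proof.
intros h z hz; unfold laplacian_minus, hyp_laplacian; rewrite (h z hz).
rewrite (Dx_ext _ _ (Dx_ext _ _ h) z hz), (Dy_ext _ _ (Dy_ext _ _ h) z hz); easy.
Qed.

Lemma LM_lincomb lambda a b f g : Ck_disk 2 f -> Ck_disk 2 g ->
  eq_disk (laplacian_minus lambda (fun z => a * f z + b * g z)%C)
    (fun z => a * laplacian_minus lambda f z + b * laplacian_minus lambda g z)%C.
Proof.
intros hf hg z hz; unfold laplacian_minus, hyp_laplacian.
assert (hf1 := Ck_S 1 f hf); assert (hg1 := Ck_S 1 g hg).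
rewrite (Dx_ext _ _ (Dx_lincomb a b f g hf1 hg1) z hz), (Dy_ext _ _ (Dy_lincomb a b f g hf1 hg1) z hz).
rewrite (Dx_lincomb a b _ _ (Ck_Dx 1 f hf) (Ck_Dx 1 g hg) z hz).
rewrite (Dy_lincomb a b _ _ (Ck_Dy 1 f hf) (Ck_Dy 1 g hg) z hz); ring.
Qed.

Lemma Ck_LM lambda k f : Ck_disk (2 + k) f -> Ck_disk k (laplacian_minus lambda f).
Proof.
intros h.
apply Ck_ext with (fun z => RtoC ((1 - Cmod z ^ 2) ^ 2 / 4) * (Defs.Dx (Defs.Dx f) z + Defs.Dy (Defs.Dy f) z) + (- lambda) * f z)%C.
- intros z _; unfold laplacian_minus, hyp_laplacian; ring.
- apply Ck_plus; apply Ck_mult; [apply Ck_weight| |apply Ck_const|now do 2 apply Ck_S].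
  apply Ck_plus; [now apply Ck_Dx, Ck_Dx|now apply Ck_Dy, Ck_Dy].
Qed.

Definition iter_LM (lambda : C) (n : nat) (f : C -> C) : C -> C := Nat.iter n (laplacian_minus lambda) f.

Lemma iter_LM_ext lambda n f g : eq_disk f g -> eq_disk (iter_LM lambda n f) (iter_LM lambda n g).
Proof. intros h; induction n as [|n ih]; [easy|]; now apply (LM_ext lambda). Qed.

Lemma Ck_iter_LM lambda n k f : Ck_disk (2 * n + k) f -> Ck_disk k (iter_LM lambda n f).
Proof.
revert k; induction n as [|n ih]; intros k h; [exact h|].
apply Ck_LM, ih; now replace (2 * n + (2 + k))%nat with (2 * S n + k)%nat by lia.
Qed.

Lemma Ck_le k l f : (k <= l)%nat -> Ck_disk l f -> Ck_disk k f.
Proof. intros h; induction h as [|l h ih]; [easy|]; intros; now apply ih, Ck_S. Qed.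

Lemma iter_LM_lincomb lambda n a b f g : Ck_disk (2 * n) f -> Ck_disk (2 * n) g ->
  eq_disk (iter_LM lambda n (fun z => a * f z + b * g z)%C) (fun z => a * iter_LM lambda n f z + b * iter_LM lambda n g z)%C.
Proof.
induction n as [|n ih]; intros hf hg; [easy|].
intros z hz; unfold iter_LM in *; simpl Nat.iter.
rewrite (LM_ext lambda _ _ (ih (Ck_le (2 * n) (2 * S n) f ltac:(lia) hf) (Ck_le (2 * n) (2 * S n) g ltac:(lia) hg)) z hz).
apply LM_lincomb; auto; apply Ck_iter_LM; now replace (2 * n + 2)%nat with (2 * S n)%nat by lia.
Qed.

Lemma iter_LM_S lambda n f : iter_LM lambda (S n) f = iter_LM lambda n (laplacian_minus lambda f).
Proof. unfold iter_LM; apply Nat.iter_succ_r. Qed.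

(** * The Laplacian of the kernels *)

Lemma RCd_transform_x nu w e z : disk z -> RCd (fun t => transform nu w e (t, Im z)) (Re z) (transform nu w (KD w 1 e) z).
Proof.
intros hz; assert (h := RCd_transform nu w e z 1 hz ltac:(rewrite Cmod_1; lra)).
replace 0 with (Re z - Re z) in h by ring.
eapply RCd_ext; [| |apply (RCd_comp (fun t => t - Re z) _ _ _ 1 h)].
- intros t; cbv beta; f_equal; destruct z; apply C_ext; simpl; ring.
- ring.
- auto_derive; [easy|ring].
Qed.

Lemma RCd_transform_y nu w e z : disk z -> RCd (fun t => transform nu w e (Re z, t)) (Im z) (transform nu w (KD w Ci e) z).
Proof.
intros hz; assert (h := RCd_transform nu w e z Ci hz ltac:(rewrite Cmod_Ci; lra)).
replace 0 with (Im z - Im z) in h by ring.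
eapply RCd_ext; [| |apply (RCd_comp (fun t => t - Im z) _ _ _ 1 h)].
- intros t; cbv beta; f_equal; destruct z; apply C_ext; simpl; ring.
- ring.
- auto_derive; [easy|ring].
Qed.

Lemma Dx_transform nu w e : eq_disk (Defs.Dx (transform nu w e)) (transform nu w (KD w 1 e)).
Proof. intros z hz; now apply Dx_RCd, RCd_transform_x. Qed.

Lemma Dy_transform nu w e : eq_disk (Defs.Dy (transform nu w e)) (transform nu w (KD w Ci e)).
Proof. intros z hz; now apply Dy_RCd, RCd_transform_y. Qed.

Lemma Ck_transform k nu w e : Ck_disk k (transform nu w e).
Proof.
revert e; induction k as [|k ih]; intros e.
- split; [|easy]; intros; now apply Ccont_continuous, transform_Ccont.
- eapply Ck_intro.
  + intros; now apply transform_Ccont.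
  + intros; now apply RCd_transform_x.
  + intros; now apply RCd_transform_y.
  + apply Ck_ext with (2 := ih (KD w 1 e)); intros z hz; symmetry; now apply Dx_transform.
  + apply Ck_ext with (2 := ih (KD w Ci e)); intros z hz; symmetry; now apply Dy_transform.
Qed.

Lemma circle_kdom z (xi : circle) : disk z -> kdom z xi.
Proof.
intros hz; split; [easy|]; destruct xi as [xi h]; unfold disk, annulus in *; simpl; lra.
Qed.

Lemma transform_lincomb nu w a b e e1 e2 z : disk z ->
  (forall xi : circle, keval w e z xi = (a * keval w e1 z xi + b * keval w e2 z xi)%C) ->
  transform nu w e z = (a * transform nu w e1 z + b * transform nu w e2 z)%C.
Proof.
intros hz h.
rewrite (transform_eq nu w e z (kernel_elt w e z hz)), (transform_eq nu w e1 z (kernel_elt w e1 z hz)), (transform_eq nu w e2 z (kernel_elt w e2 z hz)) by easy.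
now apply (af_linear nu).
Qed.

(* With [l = log_poisson_ext z xi] and [V = 1 / (1 - |z|^2)], the complex derivatives of [l] satisfy
   [l_z * l_zbar = V^2] and [l_(z zbar) = - V^2], so the hyperbolic Laplacian of [F(l)] is [F''(l) - F'(l)];
   below [P = l_z] and [Q = l_zbar]. *)
Lemma keval_laplacian w j z xi : kdom z xi ->
  (keval w (KD w 1 (KD w 1 (KPhi j))) z xi + keval w (KD w Ci (KD w Ci (KPhi j))) z xi)%C =
  (4 * (/ (1 - z * Cconj z) * / (1 - z * Cconj z)) *
    ((w * w - w) * keval w (KPhi j) z xi - (2 * w - 1) * RtoC (INR j) * keval w (KPhi (pred j)) z xi
     + RtoC (INR j) * RtoC (INR (pred j)) * keval w (KPhi (pred (pred j))) z xi))%C.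
Proof.
intros hd; destruct (kdom_facts z xi hd) as (h1 & h2 & h3 & h4).
apply Re_pos_neq in h2, h3, h4.
assert (hci : (Ci * Ci)%C = RtoC (-1)) by (apply C_ext; simpl; ring).
assert (hcc : Cconj Ci = (- Ci)%C) by (apply C_ext; simpl; ring).
assert (hc1 : Cconj 1 = 1%C) by (apply C_ext; simpl; ring).
assert (hc0 : Cconj 0 = 0%C) by (apply C_ext; simpl; ring).
set (V := (/ (1 - z * Cconj z))%C); set (A := (/ (1 - z * / xi))%C); set (B := (/ (1 - Cconj z * xi))%C).
set (zb := Cconj z) in *; set (xi' := (/ xi)%C) in *.
set (P := (- (V * zb) + A * xi')%C); set (Q := (- (V * z) + B * xi)%C).
(* The eikonal identity: the hyperbolic gradient of the Busemann function has constant length. *)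
assert (hPQ : (P * Q)%C = (V * V)%C).
{ unfold P, Q, V, A, B, xi'; field; repeat split; auto.
  intros e; apply h2; unfold xi'; replace (1 - z * / xi)%C with ((xi - z) / xi)%C by (field; easy); rewrite e; field; easy. }
assert (hV : (z * zb * V)%C = (V - 1)%C) by (unfold V; field; easy).
assert (e1 : keval w (KDlog 1) z xi = (P + Q)%C).
{ cbn [keval KDlog KDabs]; fold zb xi' V A B; rewrite hc1; unfold P, Q; ring. }
assert (e2 : keval w (KDlog Ci) z xi = (Ci * (P - Q))%C).
{ cbn [keval KDlog KDabs]; fold zb xi' V A B; rewrite hcc; unfold P, Q; ring. }
(* The terms in [A] and [B] cancel because 1 + Ci^2 = 0, the two complex logarithms being harmonic
   in z. Only the part from log(1 - |z|^2) survives. *)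
assert (e3 : (keval w (KD w 1 (KDlog 1)) z xi + keval w (KD w Ci (KDlog Ci)) z xi)%C = (- 4 * (V * V))%C).
{ cbn [keval KD KDlog KDabs]; fold zb xi' V A B; rewrite hc1, hcc.
  transitivity (- (V * V * ((zb + z) * (zb + z) + (Ci * Ci) * ((zb - z) * (zb - z))) + 2 * V - 2 * (Ci * Ci) * V)
    + (1 + Ci * Ci) * (A * A * xi' * xi' + B * B * xi * xi))%C; [ring|].
  rewrite hci.
  transitivity (- (4 * V * (z * zb * V) + 4 * V))%C; [ring|rewrite hV; ring]. }
cbn [KD]; cbn [keval]; cbn [keval] in e3.
fold (keval w (KDlog 1) z xi) (keval w (KDlog Ci) z xi).
rewrite e1, e2.
set (f0 := ((- log_poisson_ext z xi) ^ j * Cexp (w * log_poisson_ext z xi))%C).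
set (f1 := ((- log_poisson_ext z xi) ^ pred j * Cexp (w * log_poisson_ext z xi))%C).
set (f2 := ((- log_poisson_ext z xi) ^ pred (pred j) * Cexp (w * log_poisson_ext z xi))%C).
rewrite !RtoC_opp.
set (n := RtoC (INR j)); set (n1 := RtoC (INR (pred j))).
set (d1 := keval w (KD w 1 (KDlog 1)) z xi) in *; set (d2 := keval w (KD w Ci (KDlog Ci)) z xi) in *.
transitivity ((d1 + d2) * (w * f0 - n * f1) +
   ((P + Q) * (P + Q) + (Ci * Ci) * ((P - Q) * (P - Q))) * (w * (w * f0 - n * f1) - n * (w * f1 - n1 * f2)))%C; [ring|].
change (d1 + d2)%C with (keval w (KD w 1 (KDlog 1)) z xi + keval w (KD w Ci (KDlog Ci)) z xi)%C.
rewrite hci.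
transitivity ((d1 + d2) * (w * f0 - n * f1) + 4 * (P * Q) * (w * (w * f0 - n * f1) - n * (w * f1 - n1 * f2)))%C; [unfold d1, d2; ring|].
rewrite hPQ; replace (d1 + d2)%C with (- 4 * (V * V))%C by (symmetry; exact e3). ring.
Qed.

(** The choice of lambda cancels the term with [KPhi j] itself. For j = 0 and j = 1 the truncated
    predecessors are multiplied by a vanishing [INR] factor. *)
Lemma LM_KPhi nu w lambda j z : lambda = (w * w - w)%C -> disk z ->
  laplacian_minus lambda (transform nu w (KPhi j)) z =
  (- (2 * w - 1) * RtoC (INR j) * transform nu w (KPhi (pred j)) z
   + RtoC (INR j) * RtoC (INR (pred j)) * transform nu w (KPhi (pred (pred j))) z)%C.
Proof.
intros hl hz; unfold laplacian_minus, hyp_laplacian.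
rewrite (Dx_ext _ _ (Dx_transform nu w (KPhi j)) z hz), (Dy_ext _ _ (Dy_transform nu w (KPhi j)) z hz).
rewrite Dx_transform, Dy_transform by easy.
set (exx := KD w 1 (KD w 1 (KPhi j))); set (eyy := KD w Ci (KD w Ci (KPhi j))).
assert (hU : (1 - z * Cconj z)%C = RtoC (1 - Cmod z ^ 2)).
{ rewrite RtoC_minus; f_equal; rewrite RtoC_pow; rewrite <- RtoC_pow, Cmod2_alt; destruct z; apply C_ext; simpl; ring. }
assert (hpos : 0 < 1 - Cmod z ^ 2) by (unfold disk in hz; generalize (Cmod_ge_0 z); simpl; nra).
assert (hne : (1 - z * Cconj z)%C <> RtoC 0) by (rewrite hU; intros e; apply RtoC_inj in e; lra).
assert (e : (transform nu w exx z + transform nu w eyy z)%C =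
  (4 * (/ (1 - z * Cconj z) * / (1 - z * Cconj z)) *
    ((w * w - w) * transform nu w (KPhi j) z - (2 * w - 1) * RtoC (INR j) * transform nu w (KPhi (pred j)) z
     + RtoC (INR j) * RtoC (INR (pred j)) * transform nu w (KPhi (pred (pred j))) z))%C).
{ set (a := (4 * (/ (1 - z * Cconj z) * / (1 - z * Cconj z)))%C).
  set (b1 := (w * w - w)%C); set (b2 := ((2 * w - 1) * RtoC (INR j))%C); set (b3 := (RtoC (INR j) * RtoC (INR (pred j)))%C).
  set (c12 := KAdd (KMul (KConst b1) (KPhi j)) (KMul (KConst (- b2)%C) (KPhi (pred j)))).
  transitivity (1 * transform nu w exx z + 1 * transform nu w eyy z)%C; [ring|].
  rewrite <- (transform_lincomb nu w 1 1 (KAdd exx eyy)) by (auto; intros; cbn [keval]; ring).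
  rewrite (transform_lincomb nu w a (a * b3) (KAdd exx eyy) c12 (KPhi (pred (pred j)))).
  - rewrite (transform_lincomb nu w b1 (- b2) c12 (KPhi j) (KPhi (pred j))) by (auto; intros; cbn [keval c12]; easy).
    ring.
  - easy.
  - intros xi; change (keval w (KAdd exx eyy) z xi) with (keval w exx z xi + keval w eyy z xi)%C.
    unfold exx, eyy; rewrite keval_laplacian by now apply circle_kdom.
    change (keval w c12 z xi) with (b1 * keval w (KPhi j) z xi + - b2 * keval w (KPhi (pred j)) z xi)%C.
    unfold a, b1, b2, b3; ring. }
rewrite e; replace (RtoC ((1 - Cmod z ^ 2) ^ 2 / 4)) with (/ 4 * ((1 - z * Cconj z) * (1 - z * Cconj z)))%C.
- rewrite hl; field. repeat split; auto; intros e4; apply RtoC_inj in e4; lra.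
- rewrite hU, <- RtoC_inv by lra; rewrite <- !RtoC_mult; f_equal; field.
Qed.

(** * Representation of eigenfunctions *)

Lemma poisson_pol r theta phi : 0 <= r < 1 -> poisson (pol r theta) (eit phi) = poisson_circle r (phi - theta).
Proof.
intros hr; unfold poisson, poisson_circle; rewrite pol_eit, Cmod_polar by lra; f_equal.
rewrite Cmod2_alt, cos_minus; unfold eit; simpl.
generalize (sin2_cos2 phi) (sin2_cos2 theta); unfold Rsqr; intros h1 h2.
transitivity (1 * (sin phi * sin phi + cos phi * cos phi) + r * r * (sin theta * sin theta + cos theta * cos theta)
  - 2 * r * (cos phi * cos theta + sin phi * sin theta)); [ring|].
rewrite h1, h2; ring.
Qed.

Lemma keval_KPhi w j z (xi : circle) : disk z -> keval w (KPhi j) z xi = kernel_fun j w z xi.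
Proof.
intros hz; cbn [keval]; unfold kernel_fun, Rcpow, busemann.
rewrite log_poisson_ext_eq by easy; now rewrite RtoC_pow, RtoC_opp.
Qed.

Lemma gcoef_KPhi w r theta (hz : disk (pol r theta)) m : 0 <= r < 1 ->
  gcoef (kernel_elt w (KPhi 0) (pol r theta) hz) m = (em m (- theta) * kernel_coef w r m)%C.
Proof.
intros hr; unfold gcoef, kernel_coef.
rewrite <- fourier_shift by (auto using periodic_kernel_circle, RCcont_kernel_circle).
apply fourier_ext; intros t; change (keval w (KPhi 0) (pol r theta) (circle_pt t) = kernel_circle w r (t + - theta)).
rewrite keval_KPhi by easy; unfold kernel_fun, kernel_circle.
change (circle_C (circle_pt t)) with (eit t); rewrite poisson_pol by easy.
rewrite pow_O; unfold Rminus; ring.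
Qed.

(** The kernel extends holomorphically in xi, so its coefficients decay geometrically like those of
    any element of [Hcircle]. *)
Lemma kernel_coef_geo w r : 0 <= r < 1 -> exists M q, 0 < q < 1 /\ zgeo (kernel_coef w r) M q.
Proof.
intros hr; destruct (gcoef_geo (kernel_elt w (KPhi 0) (pol r 0) (pol_disk r 0 hr))) as (M & q & hq & h).
exists M, q; split; [easy|]; intros m; specialize (h m).
rewrite gcoef_KPhi, Cmod_mult, em_mod in h by easy; lra.
Qed.

Lemma zsub_opp c : zsub c -> zsub (fun m => c (- m)%Z).
Proof.
intros h q hq; destruct (h q hq) as [M hM]; exists M; intros m; specialize (hM (- m)%Z).
now replace (Z.abs_nat (- m)) with (Z.abs_nat m) in hM by lia.
Qed.

(** The kernel at angle theta has the phase em m (- theta). Replacing m by -m and using that the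
    coefficients are even gives a Fourier series in theta; hence the moment of index -m is paired
    with the frequency m. *)
Lemma kernel_coef_series w r c theta : 0 <= r < 1 -> zsub c ->
  Zlim (fun m => em m (- theta) * kernel_coef w r m * c (- m)%Z)%C = Zlim (fun m => kernel_coef w r m * c m * em m theta)%C.
Proof.
intros hr hc; destruct (kernel_coef_geo w r hr) as (M & q & hq & hP).
destruct (zgeo_zsub _ _ _ _ hq hP hc) as (M' & h & hs).
assert (hs' : 0 <= sqrt q < 1) by lra.
rewrite <- (Zlim_opp_arg _ _ _ hs' (zgeo_em _ _ _ theta h)).
apply Zlim_ext; intros m; rewrite kernel_coef_opp, em_opp by easy; ring.
Qed.

Lemma transform_af_of w r c theta (hc : zsub (fun m => c (- m)%Z)) : 0 <= r < 1 -> zsub c ->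
  transform (af_of _ hc) w (KPhi 0) (pol r theta) = Zlim (fun m => kernel_coef w r m * c m * em m theta)%C.
Proof.
intros hr hc'; rewrite <- kernel_coef_series by easy.
rewrite (transform_eq _ w (KPhi 0) _ (kernel_elt w (KPhi 0) _ (pol_disk r theta hr))) by (auto using pol_disk).
change (af_of _ hc (kernel_elt w (KPhi 0) _ (pol_disk r theta hr))) with
  (Zlim (fun m => gcoef (kernel_elt w (KPhi 0) _ (pol_disk r theta hr)) m * c (- m)%Z)%C).
apply Zlim_ext; intros m; now rewrite gcoef_KPhi.
Qed.

Lemma transform_expand nu w r theta : 0 <= r < 1 ->
  transform nu w (KPhi 0) (pol r theta) = Zlim (fun m => kernel_coef w r m * nu (mono (- m)) * em m theta)%C.
Proof.
intros hr.
assert (hsub : zsub (fun m => nu (mono (- m)))) by apply (zsub_opp _ (af_moments_sub nu)).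
rewrite <- (kernel_coef_series w r (fun m => nu (mono (- m)))) by easy.
rewrite (transform_eq _ w (KPhi 0) _ (kernel_elt w (KPhi 0) _ (pol_disk r theta hr))) by (auto using pol_disk).
rewrite af_expand; apply Zlim_ext; intros m; rewrite gcoef_KPhi by easy; now rewrite Z.opp_involutive.
Qed.

Lemma transform_harmonic nu w lambda : lambda = (w * w - w)%C -> harmonic lambda (transform nu w (KPhi 0)).
Proof.
intros hl; split; [apply Ck_transform|]; intros z hz; rewrite (LM_KPhi nu w lambda 0 z hl hz); simpl; ring.
Qed.

Lemma zsub_1 : zsub (fun _ => RtoC 1).
Proof.
intros q hq; exists 1; intros m; rewrite Cmod_1, Rmult_1_l.
rewrite <- (pow1 (Z.abs_nat m)); apply pow_incr; lra.
Qed.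

Lemma fourier_series_coef u M q m : 0 <= q < 1 -> zgeo u M q ->
  forall phi, (forall t, phi t = Zlim (fun m => u m * em m t)%C) -> fourier phi m = u m.
Proof. intros hq h phi e; rewrite (fourier_ext _ _ m e); eapply fourier_Zlim; eauto. Qed.

(** The functional with all moments 1 is evaluation at xi = 1. Its transform is an eigenfunction
    with Fourier coefficients [kernel_coef], so the radial equation comes from [harmonic_radial]. *)
Lemma kernel_coef_radial w lambda m : lambda = (w * w - w)%C -> exists b b1, radial lambda m b b1 /\
  forall r, 0 < r < 1 -> b r = kernel_coef w r m.
Proof.
intros hl.
set (f := transform (af_of _ zsub_1) w (KPhi 0)).
exists (fun r => fourier (fun t => f (pol r t)) m), (fun r => fourier (rad_deriv f r) m); split.
- now apply harmonic_radial, transform_harmonic.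
- intros r hr; destruct (kernel_coef_geo w r) as (M & q & hq & hP); [lra|].
  apply (fourier_series_coef (kernel_coef w r) M q); [lra|easy|].
  intros t; unfold f; rewrite (transform_af_of w r (fun _ => RtoC 1) t zsub_1); [|lra|apply zsub_1].
  apply Zlim_ext; intros k; ring.
Qed.

Lemma harmonic_coef w lambda f : lambda = (w * w - w)%C -> 0 < Re w -> harmonic lambda f ->
  exists c, forall m r, 0 < r < 1 -> fourier (fun t => f (pol r t)) m = (kernel_coef w r m * c m)%C.
Proof.
intros hl hw hf.
assert (h : forall m, exists c, forall r, 0 < r < 1 -> fourier (fun t => f (pol r t)) m = (kernel_coef w r m * c)%C).
{ intros m; destruct (kernel_coef_radial w lambda m hl) as (b & b1 & hb & hbP).
  destruct (kernel_coef_somewhere_nonzero w hw) as (r0 & hr0 & hne).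
  destruct (radial_proportional lambda m _ _ b b1 r0 (harmonic_radial lambda f m hf) hb hr0) as [c hc].
  - rewrite hbP by easy; apply hne.
  - exists c; intros r hr; rewrite hc, hbP by easy; ring. }
apply (fun_choice (fun m c => forall r, 0 < r < 1 -> fourier (fun t => f (pol r t)) m = (kernel_coef w r m * c)%C) h).
Qed.

Lemma bounded_initial (u : Z -> R) N : exists B, forall m, (Z.abs_nat m < N)%nat -> u m <= B.
Proof.
induction N as [|N [B hB]]; [exists 0; intros; lia|].
exists (Rmax B (Rmax (u (Z.of_nat N)) (u (- Z.of_nat N)%Z))); intros m hm.
destruct (Nat.lt_ge_cases (Z.abs_nat m) N) as [h|h].
- eapply Rle_trans; [now apply hB|apply Rmax_l].
- eapply Rle_trans; [|apply Rmax_r].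
  assert (hc : m = Z.of_nat N \/ m = (- Z.of_nat N)%Z) by lia.
  destruct hc as [-> | ->]; [apply Rmax_l|apply Rmax_r].
Qed.

Lemma RCcont_pol lambda f r : harmonic lambda f -> 0 < r < 1 -> RCcont (fun t => f (pol r t)).
Proof.
intros [h _] hr; apply (RCcont_jcont (fun r t => f (pol r t))); intros t; now apply (jcont_pol_Ck 2).
Qed.

Lemma harmonic_coef_sub w lambda f c : 0 < Re w -> harmonic lambda f ->
  (forall m r, 0 < r < 1 -> fourier (fun t => f (pol r t)) m = (kernel_coef w r m * c m)%C) -> zsub c.
Proof.
intros hw hf hc q hq.
(* A radius strictly between q and 1: on that circle the coefficients of f are bounded, and those of
   the kernel are eventually at least a constant times q^|m|. *)
set (r := (1 + q) / 2).
assert (hr : q < r < 1) by (unfold r; lra).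
destruct (kernel_coef_lower w r q hw) as (N & k & hk & hlow); [lra|lra|].
destruct (fourier_bounded (fun t => f (pol r t))) as [M [hM0 hM]].
{ apply RCcont_pol with lambda; auto; lra. }
destruct (bounded_initial (fun m => Cmod (c m) * q ^ Z.abs_nat m) N) as [B hB].
exists (Rmax B (M / k)); intros m.
destruct (Nat.lt_ge_cases (Z.abs_nat m) N) as [h|h].
- eapply Rle_trans; [now apply hB|apply Rmax_l].
- eapply Rle_trans; [|apply Rmax_r].
  specialize (hlow m h); specialize (hM m); rewrite hc, Cmod_mult in hM by lra.
  apply (Rmult_le_reg_l k); [easy|]; replace (k * (M / k)) with M by (field; lra).
  apply Rle_trans with (2 := hM).
  replace (k * (Cmod (c m) * q ^ Z.abs_nat m)) with ((k * q ^ Z.abs_nat m) * Cmod (c m)) by ring.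
  apply Rmult_le_compat_r; [apply Cmod_ge_0|easy].
Qed.

Lemma disk_polar z : disk z -> exists r t, 0 <= r < 1 /\ z = pol r t.
Proof.
intros hz; destruct (polar_form z) as [t [_ e]]; exists (Cmod z), t; split.
- split; [apply Cmod_ge_0|easy].
- now rewrite pol_eit.
Qed.

(** The radial equation lives on 0 < r < 1, so the origin is recovered by continuity. *)
Lemma Ccont_eq_0 f g : Ccont f 0 -> Ccont g 0 ->
  (forall r t, 0 < r < 1 -> f (pol r t) = g (pol r t)) -> f 0 = g 0.
Proof.
intros hf hg h; assert (e : (f 0 - g 0)%C = 0%C).
{ apply Cmod_small; intros eps he.
  destruct (hf (eps / 2)) as [d1 [p1 q1]]; [lra|]; destruct (hg (eps / 2)) as [d2 [p2 q2]]; [lra|].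
  set (r := Rmin (1 / 2) (Rmin d1 d2 / 2)).
  assert (hm : 0 < Rmin d1 d2) by now apply Rmin_pos.
  assert (hr : 0 < r) by (apply Rmin_pos; lra).
  assert (r1 : r <= 1 / 2) by apply Rmin_l; assert (r2 : r <= Rmin d1 d2 / 2) by apply Rmin_r.
  assert (m1 := Rmin_l d1 d2); assert (m2 := Rmin_r d1 d2).
  assert (hz : Cmod (pol r 0 - 0)%C = r).
  { replace (pol r 0 - 0)%C with (pol r 0) by ring; rewrite pol_eit; apply Cmod_polar; lra. }
  specialize (q1 (pol r 0) ltac:(lra)); specialize (q2 (pol r 0) ltac:(lra)).
  specialize (h r 0 ltac:(lra)).
  replace (f 0 - g 0)%C with (- (f (pol r 0) - f 0) + (g (pol r 0) - g 0))%C by (rewrite h; ring).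
  eapply Rle_lt_trans; [apply Cmod_triangle|]; rewrite Cmod_opp; lra. }
replace (f 0) with (f 0 - g 0 + g 0)%C by ring; rewrite e; ring.
Qed.

Lemma eigen_representation w lambda f : lambda = (w * w - w)%C -> 0 < Re w -> harmonic lambda f ->
  exists nu, eq_disk f (transform nu w (KPhi 0)).
Proof.
intros hl hw hf; destruct (harmonic_coef w lambda f hl hw hf) as [c hc].
assert (hsub := harmonic_coef_sub w lambda f c hw hf hc).
(* The sequence is reversed because frequency m is paired with the moment of index -m. *)
exists (af_of _ (zsub_opp c hsub)).
assert (h : forall r t, 0 < r < 1 -> f (pol r t) = transform (af_of _ (zsub_opp c hsub)) w (KPhi 0) (pol r t)).
{ intros r t hr; rewrite transform_af_of by (auto; lra).
  destruct (kernel_coef_geo w r) as (M & q & hq & hP); [lra|].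
  destruct (zgeo_zsub _ _ _ _ hq hP hsub) as (M' & hg & hs).
  rewrite (fourier_inversion (fun t => f (pol r t)) M' (sqrt q)).
  - apply Zlim_ext; intros m; now rewrite hc.
  - apply periodic_pol.
  - now apply RCcont_pol with lambda.
  - lra.
  - intros m; rewrite hc by easy; apply hg. }
intros z hz; destruct (disk_polar z hz) as (r & t & hr & ->).
destruct (Req_dec r 0) as [->|hr0]; [|apply h; lra].
replace (pol 0 t) with (RtoC 0) by (unfold pol; rewrite !Rmult_0_l; easy).
assert (h0 : disk 0) by (unfold disk; rewrite Cmod_0; lra).
apply Ccont_eq_0; auto.
- apply (Ck_continuous 2); [apply hf|easy].
- now apply transform_Ccont.
Qed.

(** On a circle where no coefficient of the kernel vanishes, the transform reveals every moment. *)
Lemma eigen_unique w nu nu' : 0 < Re w -> eq_disk (transform nu w (KPhi 0)) (transform nu' w (KPhi 0)) ->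
  forall g, nu g = nu' g.
Proof.
intros hw he g; destruct (kernel_coef_somewhere_nonzero w hw) as (r & hr & hne).
assert (hr' : 0 <= r < 1) by lra.
destruct (kernel_coef_geo w r hr') as (M & q & hq & hP).
assert (hm : forall m, nu (mono m) = nu' (mono m)).
{ intros m; set (k := (- m)%Z).
  assert (coef : forall mu : analytic_functional, fourier (fun t => transform mu w (KPhi 0) (pol r t)) k = (kernel_coef w r k * mu (mono (- k)))%C).
  { intros mu; destruct (zgeo_zsub _ _ _ _ hq hP (zsub_opp _ (af_moments_sub mu))) as (M' & h & hs).
    apply (fourier_series_coef (fun m => kernel_coef w r m * mu (mono (- m)))%C M' (sqrt q)); [lra|easy|].
    intros t; now apply transform_expand. }
  assert (e : (kernel_coef w r k * nu (mono (- k)))%C = (kernel_coef w r k * nu' (mono (- k)))%C).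
  { rewrite <- !coef; apply fourier_ext; intros t; apply he, pol_disk, hr'. }
  apply Cmult_reg_l in e; [|apply hne]. unfold k in e; now rewrite Z.opp_involutive in e. }
rewrite !af_expand; apply Zlim_ext; intros m; now rewrite hm.
Qed.

(** * Polyharmonic functions *)

(** The operator lowers the index of the [k]-th kernel [KPhi (kappa k)] by one, up to a nonzero factor
    and lower order terms. *)
Definition triangular (w lambda : C) (kappa : nat -> nat) : Prop := kappa 0%nat = 0%nat /\
  forall k, exists c, c <> RtoC 0 /\ forall nu,
    eq_disk (iter_LM lambda k (transform nu w (KPhi (kappa k)))) (fun z => c * transform nu w (KPhi 0) z)%C /\
    forall i, (k < i)%nat -> eq_disk (iter_LM lambda i (transform nu w (KPhi (kappa k)))) (fun _ => RtoC 0).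

Lemma iter_LM_KPhi w lambda : lambda = (w * w - w)%C -> forall i j nu,
  eq_disk (iter_LM lambda (S i) (transform nu w (KPhi j)))
    (fun z => - (2 * w - 1) * RtoC (INR j) * iter_LM lambda i (transform nu w (KPhi (pred j))) z
       + RtoC (INR j) * RtoC (INR (pred j)) * iter_LM lambda i (transform nu w (KPhi (pred (pred j)))) z)%C.
Proof.
intros hl i j nu z hz; rewrite iter_LM_S.
rewrite (iter_LM_ext lambda i _ _ (fun z hz => LM_KPhi nu w lambda j z hl hz) z hz).
apply iter_LM_lincomb; auto; apply Ck_transform.
Qed.

(** Applying the operator to index k + 1 produces the indices k and k - 1, whence strong induction.
    The leading factor - (2w - 1) (k + 1) is nonzero. *)
Lemma triangular_generic w lambda : lambda = (w * w - w)%C -> (2 * w - 1)%C <> RtoC 0 ->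
  triangular w lambda (fun k => k).
Proof.
intros hl hw; split; [easy|].
assert (h : forall N k, (k < N)%nat -> exists c, c <> RtoC 0 /\ forall nu,
    eq_disk (iter_LM lambda k (transform nu w (KPhi k))) (fun z => c * transform nu w (KPhi 0) z)%C /\
    forall i, (k < i)%nat -> eq_disk (iter_LM lambda i (transform nu w (KPhi k))) (fun _ => RtoC 0)).
{ induction N as [|N ih]; [intros; lia|]; intros k hk.
  destruct k as [|k].
  - exists (RtoC 1); split; [intros e; apply RtoC_inj in e; lra|]; intros nu; split.
    + intros z hz; unfold iter_LM; simpl; ring.
    + intros [|i] hi; [lia|]; intros z hz; rewrite (iter_LM_KPhi w lambda hl i 0 nu z hz); simpl; ring.
  - destruct (ih k ltac:(lia)) as (c & hc & hk').
    (* The part that drops two indices is annihilated by k iterations; for k = 0 its coefficient is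
       zero. *)
    assert (hlow : forall nu i z, (k <= i)%nat -> disk z ->
      (RtoC (INR (S k)) * RtoC (INR k) * iter_LM lambda i (transform nu w (KPhi (pred k))) z)%C = 0%C).
    { intros nu i z hi hz; destruct k as [|k]; [simpl; ring|].
      destruct (ih k ltac:(lia)) as (c' & _ & h'); destruct (h' nu) as [_ h0].
      cbn [pred]; rewrite (h0 i ltac:(lia) z hz); ring. }
    exists (- (2 * w - 1) * RtoC (INR (S k)) * c)%C; split.
    + repeat apply Cmult_neq_0; auto.
      * intros e; apply hw; replace (2 * w - 1)%C with (- - (2 * w - 1))%C by ring; rewrite e; ring.
      * intros e; apply RtoC_inj in e; apply (not_0_INR (S k)); auto.
    + intros nu; destruct (hk' nu) as [k1 k2]; split.
      * intros z hz; rewrite (iter_LM_KPhi w lambda hl k (S k) nu z hz); cbn [pred].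
        rewrite hlow by auto; rewrite (k1 z hz); ring.
      * intros [|i] hi; [lia|]; intros z hz; rewrite (iter_LM_KPhi w lambda hl i (S k) nu z hz); cbn [pred].
        rewrite hlow by (auto; lia); rewrite (k2 i ltac:(lia) z hz); ring. }
intros k; apply (h (S k)); lia.
Qed.

(** The term that lowers the index by one has the factor 2w - 1 = 0. Each application lowers it by
    two, with the nonzero factor (2k + 2) (2k + 1) at index 2k + 2. *)
Lemma triangular_critical w lambda : lambda = (w * w - w)%C -> (2 * w - 1)%C = RtoC 0 ->
  triangular w lambda (fun k => 2 * k)%nat.
Proof.
intros hl hw; split; [easy|].
assert (hs : forall i j nu, eq_disk (iter_LM lambda (S i) (transform nu w (KPhi j)))
    (fun z => RtoC (INR j) * RtoC (INR (pred j)) * iter_LM lambda i (transform nu w (KPhi (pred (pred j)))) z)%C).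
{ intros i j nu z hz; rewrite (iter_LM_KPhi w lambda hl i j nu z hz), hw; ring. }
induction k as [|k (c & hc & ih)].
- exists (RtoC 1); split; [intros e; apply RtoC_inj in e; lra|]; intros nu; split.
  + intros z hz; unfold iter_LM; simpl; ring.
  + intros [|i] hi; [lia|]; intros z hz; rewrite (hs i (2 * 0)%nat nu z hz); simpl; ring.
- exists (RtoC (INR (2 * S k)) * RtoC (INR (pred (2 * S k))) * c)%C; split.
  + repeat apply Cmult_neq_0; auto; intros e; apply RtoC_inj in e; revert e; apply not_0_INR; lia.
  + assert (e : pred (pred (2 * S k)) = (2 * k)%nat) by lia.
    intros nu; destruct (ih nu) as [k1 k2]; split.
    * intros z hz; rewrite (hs k (2 * S k)%nat nu z hz), e, (k1 z hz); ring.
    * intros [|i] hi; [lia|]; intros z hz; rewrite (hs i (2 * S k)%nat nu z hz), e, (k2 i ltac:(lia) z hz); ring.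
Qed.

Fixpoint expansion (w : C) (kappa : nat -> nat) (nu : nat -> analytic_functional) (n : nat) (z : C) : C :=
  match n with
  | O => 0%C
  | S n => (expansion w kappa nu n z + transform (nu n) w (KPhi (kappa n)) z)%C
  end.

Lemma expansion_ext w kappa nu nu' n z : (forall k, (k < n)%nat -> nu k = nu' k) ->
  expansion w kappa nu n z = expansion w kappa nu' n z.
Proof.
intros h; induction n as [|n ih]; [easy|]; simpl; rewrite ih by (intros; apply h; lia); now rewrite h by lia.
Qed.

Lemma Ck_expansion k w kappa nu n : Ck_disk k (expansion w kappa nu n).
Proof.
induction n as [|n ih]; [exact (Ck_const k 0)|].
apply (Ck_plus k (expansion w kappa nu n)); [easy|apply Ck_transform].
Qed.

Lemma iter_LM_expansion_0 w lambda kappa nu n i : triangular w lambda kappa -> (n <= i)%nat ->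
  eq_disk (iter_LM lambda i (expansion w kappa nu n)) (fun _ => RtoC 0).
Proof.
intros [_ ht]; induction n as [|n ih]; intros hn z hz.
- rewrite (iter_LM_ext lambda i (expansion w kappa nu 0) (fun z => 0 * (fun _ => RtoC 0) z + 0 * (fun _ => RtoC 0) z)%C).
  + rewrite iter_LM_lincomb by (auto; apply Ck_const); ring.
  + intros u _; simpl; ring.
  + easy.
- rewrite (iter_LM_ext lambda i (expansion w kappa nu (S n))
    (fun z => 1 * expansion w kappa nu n z + 1 * transform (nu n) w (KPhi (kappa n)) z)%C).
  + rewrite iter_LM_lincomb by (auto using Ck_expansion, Ck_transform).
    rewrite ih by (auto; lia); destruct (ht n) as (c & _ & h); destruct (h (nu n)) as [_ h0].
    rewrite h0 by (auto; lia); ring.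
  + intros u _; simpl; ring.
  + easy.
Qed.

Lemma iter_LM_expansion_top w lambda kappa nu n c : triangular w lambda kappa ->
  (forall nu, eq_disk (iter_LM lambda n (transform nu w (KPhi (kappa n)))) (fun z => c * transform nu w (KPhi 0) z)%C) ->
  eq_disk (iter_LM lambda n (expansion w kappa nu (S n))) (fun z => c * transform (nu n) w (KPhi 0) z)%C.
Proof.
intros ht hc z hz.
rewrite (iter_LM_ext lambda n (expansion w kappa nu (S n))
    (fun z => 1 * expansion w kappa nu n z + 1 * transform (nu n) w (KPhi (kappa n)) z)%C).
- rewrite iter_LM_lincomb by (auto using Ck_expansion, Ck_transform).
  rewrite (iter_LM_expansion_0 w lambda kappa nu n n ht (le_n _) z hz), hc by easy; ring.
- intros u _; simpl; ring.
- easy.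
Qed.

Lemma zsub_0 : zsub (fun _ => RtoC 0).
Proof. intros q hq; exists 0; intros m; rewrite Cmod_0; lra. Qed.

Lemma expansion_exists w lambda kappa : lambda = (w * w - w)%C -> 0 < Re w -> triangular w lambda kappa ->
  forall n f, Ck_disk (2 * n) f -> eq_disk (iter_LM lambda n f) (fun _ => RtoC 0) ->
  exists nu, eq_disk f (expansion w kappa nu n).
Proof.
intros hl hw ht; induction n as [|n ih]; intros f hf h.
- exists (fun _ => af_of _ zsub_0); exact h.
- destruct (proj2 ht n) as (c & hc & hk).
  set (g := iter_LM lambda n f).
  assert (hg2 : Ck_disk 2 g) by (apply Ck_iter_LM; now replace (2 * n + 2)%nat with (2 * S n)%nat by lia).
  assert (hlap : forall z, disk z -> laplacian_minus lambda g z = 0%C) by exact h.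
  (* Dividing by [c] compensates the factor that the iterated operator puts on the top term; the
     null summand puts the multiple into the shape of [LM_lincomb]. *)
  set (g' := fun z => (/ c * g z + 0 * g z)%C).
  assert (hg' : harmonic lambda g').
  { split; [now apply Ck_lincomb|]; intros z hz; unfold g'.
    rewrite LM_lincomb by auto; rewrite hlap by easy; ring. }
  destruct (eigen_representation w lambda g' hl hw hg') as [mu hmu].
  set (f' := fun z => (1 * f z + (-1) * transform mu w (KPhi (kappa n)) z)%C).
  assert (hf0 : Ck_disk (2 * n) f) by (apply (Ck_le _ (2 * S n)); [lia|easy]).
  destruct (ih f') as [nu hnu].
  + apply Ck_lincomb; [easy|apply Ck_transform].
  + intros z hz; unfold f'; rewrite iter_LM_lincomb by (auto using Ck_transform); fold g.
    destruct (hk mu) as [k1 _]; rewrite k1, <- hmu by easy; unfold g'; field; easy.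
  + set (nu' := fun k => if Nat.eq_dec k n then mu else nu k).
    exists nu'; intros z hz; simpl.
    assert (en : nu' n = mu) by (unfold nu'; now destruct (Nat.eq_dec n n)).
    rewrite en, (expansion_ext w kappa nu' nu).
    * rewrite <- hnu by easy; unfold f'; ring.
    * intros k hk'; unfold nu'; destruct (Nat.eq_dec k n); [lia|easy].
Qed.

Lemma expansion_unique w lambda kappa : 0 < Re w -> triangular w lambda kappa ->
  forall n nu nu', eq_disk (expansion w kappa nu n) (expansion w kappa nu' n) ->
  forall k, (k < n)%nat -> forall g, nu k g = nu' k g.
Proof.
intros hw ht; induction n as [|n ih]; intros nu nu' h k hk; [lia|].
destruct (proj2 ht n) as (c & hc & hkk).
assert (htop : forall nu, eq_disk (iter_LM lambda n (transform nu w (KPhi (kappa n)))) (fun z => c * transform nu w (KPhi 0) z)%C)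
  by (intros mu; apply hkk).
assert (hn : forall g, nu n g = nu' n g).
{ apply (eigen_unique w (nu n) (nu' n) hw); intros z hz; apply (Cmult_reg_l c); [easy|].
  rewrite <- (iter_LM_expansion_top w lambda kappa nu n c ht htop z hz).
  rewrite <- (iter_LM_expansion_top w lambda kappa nu' n c ht htop z hz).
  now apply iter_LM_ext. }
destruct (Nat.eq_dec k n) as [->|hkn]; [easy|].
apply ih; [|lia]; intros z hz; specialize (h z hz); simpl in h.
(* The top functionals are known to agree on every test function, so both top terms become the same
   number and cancel. *)
rewrite (transform_eq (nu n) w _ z (kernel_elt w (KPhi (kappa n)) z hz)), (transform_eq (nu' n) w _ z (kernel_elt w (KPhi (kappa n)) z hz)), hn in h by easy.
set (x := nu' n _) in h.
replace (expansion w kappa nu n z) with (expansion w kappa nu n z + x - x)%C by ring; rewrite h; ring.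
Qed.

Lemma represents_expansion w kappa nu n f : (1 <= n)%nat ->
  represents n (fun k => kernel (kappa k) w) nu f <-> eq_disk f (expansion w kappa nu n).
Proof.
intros hn.
assert (e : forall z (hz : disk z) m, sum_n (fun k => nu k (kernel (kappa k) w z hz) : C) m = expansion w kappa nu (S m) z).
{ intros z hz; assert (hk : forall k, transform (nu k) w (KPhi (kappa k)) z = nu k (kernel (kappa k) w z hz)).
  { intros k; apply transform_eq; [easy|]; intros xi; symmetry; now apply keval_KPhi. }
  induction m as [|m ih].
  - rewrite sum_O; simpl; rewrite hk; ring.
  - rewrite sum_Sn, ih; change plus with Cplus; cbn [expansion]; now rewrite (hk (S m)). }
destruct n as [|n]; [lia|].
unfold represents; replace (S n - 1)%nat with n by lia; split.
- intros h z hz; now rewrite (h z hz).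
- intros h z hz; rewrite (h z hz); symmetry; apply e.
Qed.

Lemma polyharmonic_representation w lambda kappa n f : lambda = (w * w - w)%C -> 0 < Re w ->
  triangular w lambda kappa -> (1 <= n)%nat -> polyharmonic lambda n f ->
  exists nu : nat -> analytic_functional, represents n (fun k => kernel (kappa k) w) nu f /\
    forall nu' : nat -> analytic_functional, represents n (fun k => kernel (kappa k) w) nu' f ->
    forall k, (k < n)%nat -> forall g : Hcircle, nu' k g = nu k g.
Proof.
intros hl hw ht hn [hC hz].
destruct (expansion_exists w lambda kappa hl hw ht n f hC hz) as [nu hnu].
exists nu; split; [now apply represents_expansion|].
intros nu' h'; apply represents_expansion in h'; [|easy].
apply (expansion_unique w lambda kappa hw ht n nu' nu).
intros z hzz; now rewrite <- h', <- hnu.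
Qed.

(** * The square root and the choice of the exponent *)

Lemma Csqrt_sqr u : (Csqrt u * Csqrt u)%C = u.
Proof.
unfold Csqrt; rewrite Cexp_Ci.
transitivity (RtoC (sqrt (Cmod u) * sqrt (Cmod u)) * (eit (Carg u / 2) * eit (Carg u / 2)))%C.
- rewrite RtoC_mult; unfold eit; ring.
- rewrite sqrt_sqrt by apply Cmod_ge_0; rewrite <- eit_plus.
  replace (Carg u / 2 + Carg u / 2) with (Carg u) by field.
  rewrite (Carg_polar u) at 3; now rewrite Cexp_Ci.
Qed.

Lemma Csqrt_Re u : 0 <= Re (Csqrt u).
Proof.
unfold Csqrt; rewrite Cexp_Ci; unfold Re; simpl; rewrite Rmult_0_l, Rminus_0_r.
apply Rmult_le_pos; [apply sqrt_pos|].
destruct (Carg_bounds u); apply cos_ge_0; lra.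
Qed.

Theorem theorem1p1 (lambda : C) (n : nat) (hn : (1 <= n)%nat)
    (f : C -> C) (hf : polyharmonic lambda n f) :
  (lambda <> RtoC (- 1 / 4) ->
   exists nu : nat -> analytic_functional,
     represents n (fun k => kernel k (Csqrt (lambda + RtoC (1 / 4)) + RtoC (1 / 2))%C) nu f /\
     forall nu' : nat -> analytic_functional,
       represents n (fun k => kernel k (Csqrt (lambda + RtoC (1 / 4)) + RtoC (1 / 2))%C) nu' f ->
       forall k, (k < n)%nat -> forall g : Hcircle, nu' k g = nu k g) /\
  (lambda = RtoC (- 1 / 4) ->
   exists nu : nat -> analytic_functional,
     represents n (fun k => kernel (2 * k) (RtoC (1 / 2))) nu f /\
     forall nu' : nat -> analytic_functional,
       represents n (fun k => kernel (2 * k) (RtoC (1 / 2))) nu' f ->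
       forall k, (k < n)%nat -> forall g : Hcircle, nu' k g = nu k g).
Proof.
split; intros hlam.
- set (s := Csqrt (lambda + RtoC (1 / 4))).
  assert (hs2 : (s * s)%C = (lambda + RtoC (1 / 4))%C) by apply Csqrt_sqr.
  assert (hsre : 0 <= Re s) by apply Csqrt_Re.
  assert (hs0 : s <> RtoC 0).
  { intros e; apply hlam; rewrite e in hs2.
    transitivity (lambda + RtoC (1 / 4) - RtoC (1 / 4))%C; [ring|rewrite <- hs2].
    apply C_ext; simpl; field. }
  (* With w = s + 1/2 one has w^2 - w = s^2 - 1/4 = lambda and 2w - 1 = 2s, so lambda <> -1/4 is
     exactly the nondegenerate case; Re s >= 0 gives Re w >= 1/2. *)
  assert (hl : lambda = ((s + RtoC (1 / 2)) * (s + RtoC (1 / 2)) - (s + RtoC (1 / 2)))%C).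
  { transitivity (s * s - RtoC (1 / 4))%C; [rewrite hs2; ring|].
    apply C_ext; simpl; field. }
  apply (polyharmonic_representation (s + RtoC (1 / 2))%C lambda (fun k => k)); auto.
  + change (0 < fst s + 1 / 2); change (0 <= fst s) in hsre; lra.
  + apply triangular_generic; [easy|]; intros e; apply hs0.
    transitivity (/ 2 * (2 * (s + RtoC (1 / 2)) - 1))%C; [apply C_ext; simpl; field|rewrite e; ring].
- assert (hl : lambda = (RtoC (1 / 2) * RtoC (1 / 2) - RtoC (1 / 2))%C)
    by (rewrite hlam; apply C_ext; simpl; field).
  apply (polyharmonic_representation (RtoC (1 / 2)) lambda (fun k => 2 * k)%nat); auto.
  + simpl; lra.
  + apply triangular_critical; [easy|]; apply C_ext; simpl; field.
Qed.
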